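(* For any integer $l\ge 0$, there is a metric $G$ on $\mathrm{Imm}(S^1,\mathbb R^2)$ which dominates the Sobolev $H^l$ metric $$G^{H^l}_c(h,h)=\int_{S^1}\sum_{i=0}^l|D_s^ih|^2\,ds,$$ and which has the property that the horizontal and normal bundles coincide, i.e. $\mathrm{Hor}_c=\mathrm{Nor}_c$ for all $c\in\mathrm{Imm}(S^1,\mathbb R^2)$.
   Context: $\mathrm{Imm}(S^1,\mathbb R^2)$ is the Fréchet manifold of smooth immersions $c:S^1\to\mathbb R^2$ (open in $C^\infty(S^1,\mathbb R^2)$), with tangent spaces $T_c\mathrm{Imm}(S^1,\mathbb R^2)=C^\infty(S^1,\mathbb R^2)$. For a curve $c$: $D_s=\frac{1}{|\partial_\theta c|}\partial_\theta$ is the arclength derivative, $ds=|\partial_\theta c|\,d\theta$, $v=\partial_\theta c/|\partial_\theta c|$ is the unit tangent, $n=Jv$ the unit normal, with $J$ the counter-clockwise rotation by $\pi/2$. $\mathrm{Diff}(S^1)$ acts on curves by $(c,\varphi)\mapsto c\circ\varphi$. Metrics considered: a metric means a $\mathrm{Diff}(S^1)$-invariant Riemannian metric on $\mathrm{Imm}(S^1,\mathbb R^2)$ of the form $G_c(h,k)=\int_{S^1}\langle L_ch,k\rangle\,ds$, where $L$ is a smooth bundle automorphism of $T\mathrm{Imm}(S^1,\mathbb R^2)$, each $L_c$ is a pseudo-differential operator of order $2p$ for some $p$, symmetric and positive with respect to the $L^2$-metric $\int_{S^1}\langle h,k\rangle\,ds$, and $L_{c\circ\varphi}(h\circ\varphi)=L_c(h)\circ\varphi$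 for $\varphi\in\mathrm{Diff}(S^1)$. Bundles: $\mathrm{Tan}_c=\{bv:b\in C^\infty(S^1,\mathbb R)\}$, $\mathrm{Nor}_c=\{an:a\in C^\infty(S^1,\mathbb R)\}$. The vertical bundle is $\mathrm{Ver}_c=\mathrm{Tan}_c$ and the horizontal bundle $\mathrm{Hor}_c$ of $G$ is the $G_c$-orthogonal complement of $\mathrm{Ver}_c$ in $T_c\mathrm{Imm}(S^1,\mathbb R^2)$. $G$ dominates $G^{H^l}$ means $G^{H^l}_c(h,h)\le G_c(h,h)$ for all $c\in\mathrm{Imm}(S^1,\mathbb R^2)$ and $h\in T_c\mathrm{Imm}(S^1,\mathbb R^2)$. *)

(* Defs.v *)
From Stdlib Require Import Reals ZArith.
From Coquelicot Require Import Coquelicot.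
Open Scope R_scope.

(** * Functions on the circle

    S^1 is R / 2 pi Z, so a function on S^1 is a 2 pi-periodic function of a
    real variable. The target R^2 is R * R, on which Coquelicot's [plus],
    [minus], [scal] are componentwise and [norm] is the Euclidean norm;
    Coquelicot's complex numbers [C] are the same type, and the definitions of
    this section are also used for complex-valued functions. *)

Definition R2 : Type := (R * R)%type.

Definition dot (x y : R2) : R := fst x * fst y + snd x * snd y.

Definition J (x : R2) : R2 := (- snd x, fst x).

Definition smooth (f : R -> R) : Prop := forall n x, ex_derive_n f n x.

Definition periodic {T : Type} (f : R -> T) : Prop :=
  forall theta, f (theta + 2 * PI) = f theta.

(** C^oo(S^1, R) and C^oo(S^1, R^2). *)
Definition Cinf1 (f : R -> R) : Prop := smooth f /\ periodic f.

Definition Cinf (h : R -> R2) : Prop :=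
  smooth (fun theta => fst (h theta)) /\
  smooth (fun theta => snd (h theta)) /\
  periodic h.

Definition dtheta (n : nat) (h : R -> R2) (theta : R) : R2 :=
  (Derive_n (fun t => fst (h t)) n theta, Derive_n (fun t => snd (h t)) n theta).

(** * Immersed curves *)

Definition Imm (c : R -> R2) : Prop :=
  Cinf c /\ forall theta, dtheta 1 c theta <> (0, 0).

Definition speed (c : R -> R2) (theta : R) : R :=
  sqrt (dot (dtheta 1 c theta) (dtheta 1 c theta)).

Definition Ds (c : R -> R2) (h : R -> R2) (theta : R) : R2 :=
  scal (/ speed c theta) (dtheta 1 h theta).

Definition tangent (c : R -> R2) (theta : R) : R2 := Ds c c theta.

Definition normal (c : R -> R2) (theta : R) : R2 := J (tangent c theta).

(** The integral over S^1 of f ds. *)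
Definition int_ds (c : R -> R2) (f : R -> R) : R :=
  RInt (fun theta => f theta * speed c theta) 0 (2 * PI).

Definition Tan (c h : R -> R2) : Prop :=
  exists b, Cinf1 b /\ forall theta, h theta = scal (b theta) (tangent c theta).

Definition Nor (c h : R -> R2) : Prop :=
  exists a, Cinf1 a /\ forall theta, h theta = scal (a theta) (normal c theta).

(** Diff(S^1), by lifts to the universal cover: the lifts of diffeomorphisms of
    S^1, orientation-preserving or not, are the diffeomorphisms of R that
    induce maps of R / 2 pi Z in both directions. *)
Definition circle_map (phi : R -> R) : Prop :=
  smooth phi /\
  exists d : Z, forall theta, phi (theta + 2 * PI) = phi theta + IZR d * (2 * PI).

Definition Diff (phi : R -> R) : Prop :=
  circle_map phi /\
  exists psi, circle_map psi /\
    (forall theta, phi (psi theta) = theta) /\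
    (forall theta, psi (phi theta) = theta).

(** * Smooth maps on T Imm

    T Imm = Imm x C^oo(S^1, R^2) is open in a Frechet space. Smoothness is
    that of convenient calculus: a map is smooth when it sends smooth
    curves to smooth curves. Smooth curves are taken for the Frechet topology
    of C^oo(S^1, R^2), that of uniform convergence of every derivative. *)

Definition frechet_derivative
    (gamma : R -> R -> R2) (t : R) (g : R -> R2) : Prop :=
  forall (k : nat) (eps : posreal),
    locally' 0 (fun s => forall theta,
      norm (dtheta k (fun x =>
              minus (scal (/ s) (minus (gamma (t + s) x) (gamma t x))) (g x))
            theta) < eps).

Definition smooth_curve (gamma : R -> R -> R2) : Prop :=
  exists delta : nat -> R -> R -> R2,
    (forall t theta, delta 0%nat t theta = gamma t theta) /\
    (forall n t, Cinf (delta n t)) /\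
    (forall n t, frechet_derivative (delta n) t (delta (S n) t)).

Definition smooth_on_TImm (F : (R -> R2) -> (R -> R2) -> (R -> R2)) : Prop :=
  forall c h : R -> R -> R2,
    smooth_curve c -> (forall t, Imm (c t)) -> smooth_curve h ->
    smooth_curve (fun t => F (c t) (h t)).

Definition linear_op (A : (R -> R2) -> (R -> R2)) : Prop :=
  (forall h, Cinf h -> Cinf (A h)) /\
  (forall h k, Cinf h -> Cinf k -> forall theta,
     A (fun x => plus (h x) (k x)) theta = plus (A h theta) (A k theta)) /\
  (forall (r : R) h, Cinf h -> forall theta,
     A (fun x => scal r (h x)) theta = scal r (A h theta)).

Definition smooth_bundle_automorphism
    (L : (R -> R2) -> (R -> R2) -> (R -> R2)) : Prop :=
  (forall c, Imm c -> linear_op (L c)) /\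
  smooth_on_TImm L /\
  exists M : (R -> R2) -> (R -> R2) -> (R -> R2),
    (forall c, Imm c -> linear_op (M c)) /\
    smooth_on_TImm M /\
    (forall c h, Imm c -> Cinf h -> forall theta,
       M c (L c h) theta = h theta /\ L c (M c h) theta = h theta).

(** * Pseudo-differential operators on the circle

    Operators are written through the toroidal (global) quantization
      (A f)(theta) = sum_(k in Z) a(theta, k) f^(k) e^(i k theta),
    with symbols in S^m_(1,0)(S^1 x Z), differences in k replacing derivatives
    in the covariable. Operators on C^oo(S^1, R^2) have 2 x 2 matrices of
    complex symbols. *)

Definition expi (x : R) : C := (cos x, sin x).

Definition fourier (f : R -> R) (k : Z) : C :=
  (/ (2 * PI) * RInt (fun x => f x * cos (IZR k * x)) 0 (2 * PI),
   - / (2 * PI) * RInt (fun x => f x * sin (IZR k * x)) 0 (2 * PI)).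

Definition diff_k (n : nat) (a : Z -> R -> C) : Z -> R -> C :=
  Nat.iter n (fun b k theta => Cminus (b (k + 1)%Z theta) (b k theta)) a.

Definition toroidal_symbol (m : R) (a : Z -> R -> C) : Prop :=
  (forall k, Cinf (a k)) /\
  forall alpha beta : nat, exists K : R, forall (k : Z) (theta : R),
    Cmod (dtheta beta (diff_k alpha a k) theta)
      <= K * Rpower (1 + Rabs (IZR k)) (m - INR alpha).

(** [comp false] and [comp true] are the two coordinates of R^2. *)
Definition comp (i : bool) (x : R2) : R := if i then snd x else fst x.

Definition symbol_term (a : bool -> bool -> Z -> R -> C) (i : bool)
    (h : R -> R2) (theta : R) (k : Z) : C :=
  Cmult
    (Cplus
       (Cmult (a i false k theta) (fourier (fun x => comp false (h x)) k))
       (Cmult (a i true k theta) (fourier (fun x => comp true (h x)) k)))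
    (expi (IZR k * theta)).

Definition sum_symmetric (u : Z -> C) (N : nat) : C :=
  sum_n (fun j => u (Z.of_nat j - Z.of_nat N)%Z) (2 * N).

Definition pseudo_differential (m : R) (A : (R -> R2) -> (R -> R2)) : Prop :=
  exists a : bool -> bool -> Z -> R -> C,
    (forall i j, toroidal_symbol m (a i j)) /\
    forall h, Cinf h -> forall (i : bool) (theta : R),
      filterlim (sum_symmetric (symbol_term a i h theta)) eventually
        (locally (RtoC (comp i (A h theta)))).

(** * Metrics *)

Definition L2 (c h k : R -> R2) : R :=
  int_ds c (fun theta => dot (h theta) (k theta)).

Definition symmetric_op (c : R -> R2) (A : (R -> R2) -> (R -> R2)) : Prop :=
  forall h k, Cinf h -> Cinf k -> L2 c (A h) k = L2 c h (A k).

Definition positive_op (c : R -> R2) (A : (R -> R2) -> (R -> R2)) : Prop :=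
  forall h, Cinf h -> (exists theta, h theta <> (0, 0)) -> 0 < L2 c (A h) h.

Definition reparam_equivariant
    (L : (R -> R2) -> (R -> R2) -> (R -> R2)) : Prop :=
  forall c h phi, Imm c -> Cinf h -> Diff phi -> forall theta,
    L (fun x => c (phi x)) (fun x => h (phi x)) theta = L c h (phi theta).

Definition metric (G : (R -> R2) -> (R -> R2) -> (R -> R2) -> R) : Prop :=
  exists L : (R -> R2) -> (R -> R2) -> (R -> R2),
    smooth_bundle_automorphism L /\
    (exists p : R, forall c, Imm c -> pseudo_differential (2 * p) (L c)) /\
    (forall c, Imm c -> symmetric_op c (L c) /\ positive_op c (L c)) /\
    reparam_equivariant L /\
    forall c h k, Imm c -> Cinf h -> Cinf k -> G c h k = L2 c (L c h) k.

Definition Hor (G : (R -> R2) -> (R -> R2) -> (R -> R2) -> R)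
    (c h : R -> R2) : Prop :=
  Cinf h /\ forall k, Tan c k -> G c h k = 0.

(** G^(H^l)_c(h, h). *)
Definition sobolev (l : nat) (c h : R -> R2) : R :=
  int_ds c (fun theta =>
    sum_f_R0 (fun i => dot (Nat.iter i (Ds c) h theta)
                           (Nat.iter i (Ds c) h theta)) l).

Definition dominates (G : (R -> R2) -> (R -> R2) -> (R -> R2) -> R)
    (l : nat) : Prop :=
  forall c h, Imm c -> Cinf h -> sobolev l c h <= G c h h.

(* Main.v *)
(** The metric is diagonal in the moving frame. Write [h = b v + a n] and
    [G_c(h, h) = K_c * (int ((1 - D_s^2)^l b) b ds + int ((1 - D_s^2)^l a) a ds)].
    Since [L_c] acts on the coordinates [b] and [a] separately, [Tan_c] and
    [Nor_c] are orthogonal, and positivity on [Tan_c] gives [Hor_c = Nor_c].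
    Integration by parts shows that the two integrals control the [L^2] norms of
    [D_s^j b] and [D_s^j a] for [j <= l]; the Leibniz rule then gives domination
    as soon as [K_c] bounds the arclength derivatives of [v]. Each of these is
    the derivative of a periodic function, hence has a zero, so its maximum is
    controlled by an integral of the next derivative: this gives a bound [K_c]
    that is smooth in [c] and invariant.

    The inverse of [L_c] is explicit: [1 - D_s^2 = (1 + D_s)(1 - D_s)], and
    [u + e D_s u = g] is solved on the circle by variation of constants.
    Smoothness on [T Imm] reduces to joint smoothness in [(t, theta)], because
    the smooth curves in [C^oo(S^1)] are the jointly smooth functions. That a
    differential operator is pseudo-differential is Fourier inversion. *)
From Stdlib Require Import Reals ZArith Lra Lia FunctionalExtensionality.
From Coquelicot Require Import Coquelicot.
Require Import Defs.

(** A supremum over the circle does not depend smoothly on the curve, whereas K_c must. Hence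
    integrals of 1 + u^2, which dominate |u| pointwise and are polynomial in u. The same squares
    absorb the sign that D_s acquires under reversal of orientation, so K_c is invariant under all
    of Diff(S^1). Since v is itself D_s c, the case of order zero is covered as well: no function of
    arbitrary mean ever has to be bounded. K_c is constant along each curve, so it commutes with D_s
    and leaves L_c symmetric. Powers of 1 - D_s^2 are chosen because they are inverted one first
    order factor at a time and because their quadratic forms obey a Pascal recursion. The explicit
    solution is a right inverse, visibly smooth in the curve; that it is also a left inverse, and
    linear, comes from injectivity, that is from positivity of the quadratic form. The
    pseudo-differential condition sums over symmetric ranges of k, so pointwise convergence of
    Dirichlet partial sums is exactly what it asks for. *)

Ltac conjs := repeat match goal with |- _ /\ _ => split end.

(** * Functions of two real variables with continuous partial derivatives of all orders *)

Lemma is_derive_Rmult (f g : R -> R) x df dg :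
  is_derive f x df -> is_derive g x dg ->
  is_derive (fun u => f u * g u) x (df * g x + f x * dg).
Proof.
  intros Hf Hg. apply (is_derive_mult f g x df dg); auto. intros; apply Rmult_comm.
Qed.

(** The class C^n, by recursion on the partial derivatives themselves: each closure property is then
    an induction on n that never has to name or commute a mixed partial derivative. *)
Fixpoint jointly_C (n : nat) (F : R -> R -> R) : Prop :=
  (forall t x, continuity_2d_pt F t x) /\
  match n with
  | O => True
  | S n => exists Ft Fx : R -> R -> R,
      (forall t x, is_derive (fun u => F u x) t (Ft t x)) /\
      (forall t x, is_derive (F t) x (Fx t x)) /\ jointly_C n Ft /\ jointly_C n Fx
  end.

Definition smooth2 (F : R -> R -> R) : Prop := forall n, jointly_C n F.

Lemma jointly_C_cont n F : jointly_C n F -> forall t x, continuity_2d_pt F t x.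
Proof. destruct n; intros [H _]; exact H. Qed.

Lemma jointly_C_mono n F : jointly_C (S n) F -> jointly_C n F.
Proof.
  revert F; induction n; intros F [H1 H2]; split; auto.
  destruct H2 as (Ft & Fx & A & B & C & D).
  exists Ft, Fx; auto.
Qed.

Lemma jointly_C_const n a : jointly_C n (fun _ _ => a).
Proof.
  revert a; induction n; intros a; split; auto;
    try (intros; apply continuity_2d_pt_const).
  exists (fun _ _ => 0), (fun _ _ => 0); conjs; auto;
    intros; apply (is_derive_const a).
Qed.

Lemma jointly_C_plus n F G : jointly_C n F -> jointly_C n G -> jointly_C n (fun t x => F t x + G t x).
Proof.
  revert F G; induction n; intros F G HF HG; split; auto;
    try (intros; apply continuity_2d_pt_plus; eauto using jointly_C_cont).
  destruct HF as (_ & Ft & Fx & A & B & C & D).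
  destruct HG as (_ & Gt & Gx & A' & B' & C' & D').
  exists (fun t x => Ft t x + Gt t x), (fun t x => Fx t x + Gx t x);
    conjs; auto; intros; apply @is_derive_plus; auto.
Qed.

Lemma jointly_C_mult n F G : jointly_C n F -> jointly_C n G -> jointly_C n (fun t x => F t x * G t x).
Proof.
  revert F G; induction n; intros F G HF HG; split; auto;
    try (intros; apply continuity_2d_pt_mult; eauto using jointly_C_cont).
  pose proof (jointly_C_mono _ _ HF) as HF0. pose proof (jointly_C_mono _ _ HG) as HG0.
  destruct HF as (_ & Ft & Fx & A & B & C & D).
  destruct HG as (_ & Gt & Gx & A' & B' & C' & D').
  exists (fun t x => Ft t x * G t x + F t x * Gt t x),
    (fun t x => Fx t x * G t x + F t x * Gx t x); conjs;
    try (apply jointly_C_plus; auto).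
  - intros t x. apply (is_derive_Rmult (fun u => F u x) (fun u => G u x)); auto.
  - intros t x. apply is_derive_Rmult; auto.
Qed.


(** The derivative of 1/F is a product containing 1/F again, so the induction hypothesis at order n
    serves for both partial derivatives; [exp] and [sqrt] work in the same way. *)
Lemma jointly_C_inv n F :
  (forall t x, F t x <> 0) -> jointly_C n F -> jointly_C n (fun t x => / F t x).
Proof.
  intros H0; induction n; intros HF; split; auto;
    try (intros; apply continuity_2d_pt_inv; eauto using jointly_C_cont).
  pose proof (IHn (jointly_C_mono _ _ HF)) as HI.
  destruct HF as (_ & Ft & Fx & A & B & C & D).
  assert (E : forall G, jointly_C n G ->
     jointly_C n (fun t x => (- 1 * G t x) * (/ F t x * / F t x))).
  { intros G HG. apply jointly_C_mult; [apply jointly_C_mult; auto using jointly_C_const|].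
    apply jointly_C_mult; auto. }
  exists (fun t x => (- 1 * Ft t x) * (/ F t x * / F t x)),
    (fun t x => (- 1 * Fx t x) * (/ F t x * / F t x)); conjs; auto.
  - intros t x. replace (- 1 * Ft t x * (/ F t x * / F t x))
      with (- Ft t x / F t x ^ 2) by (field; auto).
    apply (is_derive_inv (fun u => F u x)); auto.
  - intros t x. replace (- 1 * Fx t x * (/ F t x * / F t x))
      with (- Fx t x / F t x ^ 2) by (field; auto).
    apply is_derive_inv; auto.
Qed.

Lemma jointly_C_exp n F : jointly_C n F -> jointly_C n (fun t x => exp (F t x)).
Proof.
  induction n; intros HF; split; auto;
    try (intros; apply continuity_1d_2d_pt_comp; eauto using jointly_C_cont;
         apply derivable_continuous_pt, derivable_pt_exp).
  pose proof (IHn (jointly_C_mono _ _ HF)) as HI.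
  destruct HF as (_ & Ft & Fx & A & B & C & D).
  exists (fun t x => Ft t x * exp (F t x)), (fun t x => Fx t x * exp (F t x));
    conjs; try (apply jointly_C_mult; auto).
  - intros t x. apply (is_derive_comp exp (fun u => F u x)); auto.
    apply is_derive_exp.
  - intros t x. apply (is_derive_comp exp (F t)); auto.
    apply is_derive_exp.
Qed.

Lemma jointly_C_sqrt n F :
  (forall t x, 0 < F t x) -> jointly_C n F -> jointly_C n (fun t x => sqrt (F t x)).
Proof.
  intros H0; induction n; intros HF; split; auto;
    try (intros; apply continuity_1d_2d_pt_comp; eauto using jointly_C_cont;
         apply continuity_pt_sqrt; left; auto).
  pose proof (IHn (jointly_C_mono _ _ HF)) as HI.
  destruct HF as (_ & Ft & Fx & A & B & C & D).
  assert (P : forall t x, sqrt (F t x) > 0) by (intros; apply sqrt_lt_R0; auto).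
  assert (E : forall G, jointly_C n G ->
     jointly_C n (fun t x => G t x * / (2 * sqrt (F t x)))).
  { intros G HG. apply jointly_C_mult; auto. apply jointly_C_inv.
    - intros t x. specialize (P t x). lra.
    - apply jointly_C_mult; auto using jointly_C_const. }
  exists (fun t x => Ft t x * / (2 * sqrt (F t x))),
    (fun t x => Fx t x * / (2 * sqrt (F t x))); conjs; auto.
  - intros t x. apply (is_derive_sqrt (fun u => F u x)); auto.
  - intros t x. apply is_derive_sqrt; auto.
Qed.

Lemma smooth2_const a : smooth2 (fun _ _ => a).
Proof. intros n; apply jointly_C_const. Qed.

Lemma smooth2_plus F G : smooth2 F -> smooth2 G -> smooth2 (fun t x => F t x + G t x).
Proof. intros HF HG n; apply jointly_C_plus; auto. Qed.

Lemma smooth2_mult F G : smooth2 F -> smooth2 G -> smooth2 (fun t x => F t x * G t x).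
Proof. intros HF HG n; apply jointly_C_mult; auto. Qed.

Lemma smooth2_opp F : smooth2 F -> smooth2 (fun t x => - F t x).
Proof.
  intros HF. replace (fun t x => - F t x) with (fun t x => - 1 * F t x).
  - apply smooth2_mult; auto using smooth2_const.
  - do 2 (apply functional_extensionality; intro); ring.
Qed.

Lemma smooth2_minus F G : smooth2 F -> smooth2 G -> smooth2 (fun t x => F t x - G t x).
Proof. intros HF HG; apply smooth2_plus; auto using smooth2_opp. Qed.

Lemma smooth2_inv F :
  (forall t x, F t x <> 0) -> smooth2 F -> smooth2 (fun t x => / F t x).
Proof. intros H0 HF n; apply jointly_C_inv; auto. Qed.

Lemma smooth2_exp F : smooth2 F -> smooth2 (fun t x => exp (F t x)).
Proof. intros HF n; apply jointly_C_exp; auto. Qed.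

Lemma smooth2_sqrt F :
  (forall t x, 0 < F t x) -> smooth2 F -> smooth2 (fun t x => sqrt (F t x)).
Proof. intros H0 HF n; apply jointly_C_sqrt; auto. Qed.

(** * Canonical partial derivatives, sections and constant families *)

Definition dt (F : R -> R -> R) (t x : R) : R := Derive (fun u => F u x) t.
Definition dx (F : R -> R -> R) (t x : R) : R := Derive (F t) x.

Lemma smooth2_cont F : smooth2 F -> forall t x, continuity_2d_pt F t x.
Proof. intros H; apply (jointly_C_cont 0 F (H 0%nat)). Qed.

Lemma smooth2_ex_dt F : smooth2 F -> forall t x, ex_derive (fun u => F u x) t.
Proof.
  intros H t x. destruct (H 1%nat) as (_ & Ft & Fx & A & _). exists (Ft t x); apply A.
Qed.

Lemma smooth2_ex_dx F : smooth2 F -> forall t x, ex_derive (F t) x.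
Proof.
  intros H t x. destruct (H 1%nat) as (_ & Ft & Fx & _ & A & _).
  exists (Fx t x); apply A.
Qed.

Lemma smooth2_dt F : smooth2 F -> smooth2 (dt F).
Proof.
  intros H n. destruct (H (S n)) as (_ & Ft & Fx & A & _ & B & _).
  replace (dt F) with Ft; auto.
  do 2 (apply functional_extensionality; intro).
  symmetry; apply is_derive_unique; auto.
Qed.

Lemma smooth2_dx F : smooth2 F -> smooth2 (dx F).
Proof.
  intros H n. destruct (H (S n)) as (_ & Ft & Fx & _ & A & _ & B).
  replace (dx F) with Fx; auto.
  do 2 (apply functional_extensionality; intro).
  symmetry; apply is_derive_unique; auto.
Qed.

Lemma smooth2_cont_x F : smooth2 F -> forall t x, continuous (F t) x.
Proof. intros H t x; apply @ex_derive_continuous; apply smooth2_ex_dx; auto. Qed.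

Lemma smooth2_ex_RInt F : smooth2 F -> forall t a b, ex_RInt (F t) a b.
Proof.
  intros H t a b; apply @ex_RInt_continuous; intros; apply smooth2_cont_x; auto.
Qed.

Lemma dt_dx F : smooth2 F -> dt (dx F) = dx (dt F).
Proof.
  intros H. do 2 (apply functional_extensionality; intro).
  pose proof (smooth2_dt _ H) as Ht. pose proof (smooth2_dx _ H) as Hx.
  apply (Schwarz F).
  - apply locally_2d_forall; intros u v. conjs.
    + apply (smooth2_ex_dt F H).
    + apply (smooth2_ex_dx F H).
    + apply (smooth2_ex_dt _ Hx).
    + apply (smooth2_ex_dx _ Ht u).
  - apply (smooth2_cont _ (smooth2_dt _ Hx)).
  - apply (smooth2_cont _ (smooth2_dx _ Ht)).
Qed.

Lemma smooth2_iter_dx F n : smooth2 F -> smooth2 (Nat.iter n dx F).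
Proof. intros H; induction n; simpl; auto using smooth2_dx. Qed.

Lemma smooth2_iter_dt F n : smooth2 F -> smooth2 (Nat.iter n dt F).
Proof. intros H; induction n; simpl; auto using smooth2_dt. Qed.

Lemma iter_dx_dt F n : smooth2 F -> Nat.iter n dx (dt F) = dt (Nat.iter n dx F).
Proof.
  intros H; induction n; simpl; auto.
  rewrite IHn, dt_dx; auto using smooth2_iter_dx.
Qed.

Lemma Derive_n_iter_dx F n t x : Derive_n (F t) n x = Nat.iter n dx F t x.
Proof.
  revert x; induction n; intros x; simpl; auto. unfold dx at 1.
  apply Derive_ext; auto.
Qed.

Lemma smooth2_smooth F t : smooth2 F -> smooth (F t).
Proof.
  intros H [|n] x; simpl; auto.
  apply (ex_derive_ext (Nat.iter n dx F t)).
  - intros; symmetry; apply Derive_n_iter_dx.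
  - apply smooth2_ex_dx, smooth2_iter_dx; auto.
Qed.

Lemma Derive_n_Derive (f : R -> R) n x : Derive_n (Derive f) n x = Derive_n f (S n) x.
Proof.
  revert x; induction n; intros x; auto. simpl.
  apply Derive_ext. intros y; rewrite IHn; auto.
Qed.

Lemma smooth_Derive f : smooth f -> smooth (Derive f).
Proof.
  intros H [|n] x; simpl; auto.
  apply (ex_derive_ext (Derive_n f (S n))).
  - intros; symmetry; apply Derive_n_Derive.
  - apply (H (S (S n))).
Qed.

Lemma smooth_ex_derive f : smooth f -> forall x, ex_derive f x.
Proof. intros H x; apply (H 1%nat). Qed.

Lemma continuity_2d_pt_snd f t x :
  continuous f x -> continuity_2d_pt (fun _ y => f y) t x.
Proof.
  intros H. apply (continuity_1d_2d_pt_comp f (fun _ y => y)).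
  - apply continuity_pt_filterlim, H.
  - apply continuity_2d_pt_id2.
Qed.

Lemma smooth_smooth2 f : smooth f -> smooth2 (fun _ => f).
Proof.
  intros H n; revert f H; induction n; intros f H; split; auto;
    try (intros; apply continuity_2d_pt_snd, @ex_derive_continuous,
           smooth_ex_derive; auto).
  exists (fun _ _ => 0), (fun _ => Derive f); conjs.
  - intros; apply (is_derive_const (f x)).
  - intros; apply Derive_correct, smooth_ex_derive; auto.
  - apply jointly_C_const.
  - apply IHn, smooth_Derive; auto.
Qed.

(** * From smooth curves in the Fréchet space to jointly smooth functions *)

Lemma smooth2_family (Phi : nat -> nat -> R -> R -> R) :
  (forall m k t x, continuity_2d_pt (Phi m k) t x) ->
  (forall m k t x, is_derive (fun u => Phi m k u x) t (Phi (S m) k t x)) ->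
  (forall m k t x, is_derive (Phi m k t) x (Phi m (S k) t x)) ->
  forall m k, smooth2 (Phi m k).
Proof.
  intros A B C m k n; revert m k; induction n; intros m k; split; auto.
  exists (Phi (S m) k), (Phi m (S k)); conjs; auto.
Qed.

Lemma Derive_n_quotient f g h r n x : smooth f -> smooth g -> smooth h ->
  Derive_n (fun y => r * (f y - g y) - h y) n x =
  r * (Derive_n f n x - Derive_n g n x) - Derive_n h n x.
Proof.
  intros Hf Hg Hh.
  assert (E : forall u, smooth u -> forall y,
    locally y (fun z => forall k, (k <= n)%nat -> ex_derive_n u k z)).
  { intros u Hu y; apply filter_forall; auto. }
  assert (Efg : smooth (fun y => r * (f y - g y))).
  { intros k y. apply ex_derive_n_scal_l, ex_derive_n_minus;
      apply filter_forall; auto. }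
  rewrite (Derive_n_minus (fun y => r * (f y - g y)) h); auto.
  rewrite Derive_n_scal_l, Derive_n_minus; auto.
Qed.

Section FromUniform.
Variable delta : nat -> R -> R -> R.
Hypothesis Hs : forall n t, smooth (delta n t).
Hypothesis Hd : forall n t k (eps : posreal), locally' 0 (fun s => forall x,
  Rabs (Derive_n (fun y => / s * (delta n (t + s) y - delta n t y)
                           - delta (S n) t y) k x) < eps).

(** The index m counts derivatives in t, taken in the Fréchet space, and k those in x. The family is
    closed under both partial derivatives, so continuity of its members is all that joint smoothness
    still asks for. *)
Let Phi m k t x := Derive_n (delta m t) k x.

Lemma uniform_quotient m k t (eps : posreal) : exists d : posreal,
  forall s, Rabs s < d -> s <> 0 -> forall x,
  Rabs (/ s * (Phi m k (t + s) x - Phi m k t x) - Phi (S m) k t x) < eps.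
Proof.
  destruct (Hd m t k eps) as [d H]. exists d. intros s Hsd Hs0 x.
  unfold Phi. rewrite <- Derive_n_quotient; auto. apply H; auto.
  unfold ball; simpl; unfold AbsRing_ball, abs, minus, plus, opp; simpl.
  replace (s + - 0) with s by ring; auto.
Qed.

Lemma uniform_family_dx m k t x : is_derive (Phi m k t) x (Phi m (S k) t x).
Proof. apply Derive_correct. apply (Hs m t (S k) x). Qed.

Lemma uniform_family_dt m k t x :
  is_derive (fun u => Phi m k u x) t (Phi (S m) k t x).
Proof.
  apply is_derive_Reals. intros eps Heps.
  destruct (uniform_quotient m k t (mkposreal eps Heps)) as [d H].
  exists d. intros h Hh0 Hh. unfold Rdiv. rewrite Rmult_comm. apply H; auto.
Qed.

(** The increment is split into a move from t to u at the point v and a move from v to x at time t.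
    The first is u - t times a difference quotient, and such quotients are bounded uniformly in v
    because convergence to the derivative is uniform. *)
Lemma uniform_family_cont m k t x : continuity_2d_pt (Phi m k) t x.
Proof.
  intros eps.
  destruct (uniform_quotient m k t (mkposreal 1 Rlt_0_1)) as [d1 H1].
  assert (C : forall j, continuous (Phi j k t) x).
  { intros j; apply @ex_derive_continuous. eexists; apply uniform_family_dx. }
  pose proof (is_pos_div_2 eps) as He2.
  destruct (proj1 (filterlim_locally _ _) (C (S m)) (mkposreal 1 Rlt_0_1)) as [d2 H2].
  destruct (proj1 (filterlim_locally _ _) (C m) (mkposreal _ He2)) as [d3 H3].
  (* One unit pays for replacing the quotient by the derivative at v, the other for replacing v by
     x. *)
  set (M := Rabs (Phi (S m) k t x) + 2).
  assert (HM : 0 < M) by (unfold M; pose proof (Rabs_pos (Phi (S m) k t x)); lra).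
  assert (Hd4 : 0 < eps / 2 / M) by (apply Rdiv_lt_0_compat; auto).
  assert (Hm : 0 < Rmin (Rmin d1 (eps / 2 / M)) (Rmin d2 d3)).
  { pose proof (cond_pos d1); pose proof (cond_pos d2); pose proof (cond_pos d3).
    repeat apply Rmin_glb_lt; auto. }
  exists (mkposreal _ Hm). simpl. intros u v Hu Hv.
  pose proof (Rmin_l (Rmin d1 (eps / 2 / M)) (Rmin d2 d3)).
  pose proof (Rmin_r (Rmin d1 (eps / 2 / M)) (Rmin d2 d3)).
  pose proof (Rmin_l d1 (eps / 2 / M)). pose proof (Rmin_r d1 (eps / 2 / M)).
  pose proof (Rmin_l d2 d3). pose proof (Rmin_r d2 d3).
  assert (B2 : Rabs (Phi (S m) k t v - Phi (S m) k t x) < 1).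
  { apply H2. change (Rabs (v - x) < d2). lra. }
  assert (B3 : Rabs (Phi m k t v - Phi m k t x) < eps / 2).
  { apply H3. change (Rabs (v - x) < d3). lra. }
  assert (B4 : Rabs (Phi m k u v - Phi m k t v) <= eps / 2).
  { destruct (Req_dec (u - t) 0) as [E|E].
    - replace u with t by lra. rewrite Rminus_diag, Rabs_R0. lra.
    - specialize (H1 (u - t) ltac:(lra) E v). simpl in H1.
      replace (t + (u - t)) with u in H1 by ring.
      set (q := / (u - t) * (Phi m k u v - Phi m k t v)) in *.
      replace (Phi m k u v - Phi m k t v) with ((u - t) * q)
        by (unfold q; field; auto).
      rewrite Rabs_mult.
      assert (Hq : Rabs q <= M).
      { unfold M. revert H1 B2. unfold Rabs.
        repeat destruct Rcase_abs; lra. }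
      apply Rle_trans with (eps / 2 / M * M).
      + apply Rmult_le_compat; auto using Rabs_pos. lra.
      + right; field; lra. }
  replace (Phi m k u v - Phi m k t x) with
    ((Phi m k u v - Phi m k t v) + (Phi m k t v - Phi m k t x)) by ring.
  eapply Rle_lt_trans; [apply Rabs_triang|]. lra.
Qed.

Lemma uniform_smooth2 : smooth2 (delta 0%nat).
Proof.
  apply (smooth2_family Phi uniform_family_cont uniform_family_dt
           uniform_family_dx 0%nat 0%nat).
Qed.
End FromUniform.

Lemma R2_norm_lt (p : R2) (eps : R) :
  norm p < eps -> Rabs (fst p) < eps /\ Rabs (snd p) < eps.
Proof.
  intros H. destruct (@norm_prod R_AbsRing R_NormedModule R_NormedModule (fst p) (snd p)) as [A _].
  destruct p as [a b]; simpl in *.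
  change (Rmax (Rabs a) (Rabs b) <= @norm _ (prod_NormedModule R_AbsRing R_NormedModule R_NormedModule) (a, b)) in A.
  change (@norm _ (prod_NormedModule R_AbsRing R_NormedModule R_NormedModule) (a, b) < eps) in H.
  pose proof (Rmax_l (Rabs a) (Rabs b)). pose proof (Rmax_r (Rabs a) (Rabs b)). lra.
Qed.

(** Halving absorbs the factor sqrt 2 between the Euclidean and the maximum norm. *)
Lemma lt_R2_norm (p : R2) (eps : R) :
  Rabs (fst p) < eps / 2 -> Rabs (snd p) < eps / 2 -> norm p < eps.
Proof.
  intros H1 H2. destruct (@norm_prod R_AbsRing R_NormedModule R_NormedModule (fst p) (snd p)) as [_ A].
  destruct p as [a b]; simpl in *.
  change (@norm _ (prod_NormedModule R_AbsRing R_NormedModule R_NormedModule) (a, b) <= sqrt 2 * Rmax (Rabs a) (Rabs b)) in A.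
  change (@norm _ (prod_NormedModule R_AbsRing R_NormedModule R_NormedModule) (a, b) < eps).
  eapply Rle_lt_trans; [apply A|].
  assert (Rmax (Rabs a) (Rabs b) < eps / 2) by (apply Rmax_lub_lt; auto).
  assert (0 <= Rmax (Rabs a) (Rabs b)) by
    (eapply Rle_trans; [apply Rabs_pos|apply Rmax_l]).
  assert (sqrt 2 <= 2).
  { rewrite <- (sqrt_square 2) at 2 by lra. apply sqrt_le_1; lra. }
  nra.
Qed.

Lemma smooth_curve_smooth2 gamma : smooth_curve gamma ->
  smooth2 (fun t x => fst (gamma t x)) /\
  smooth2 (fun t x => snd (gamma t x)) /\
  forall t, periodic (gamma t).
Proof.
  intros (delta & H0 & H1 & H2).
  assert (E : gamma = delta 0%nat)
    by (do 2 (apply functional_extensionality; intro); auto).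
  subst gamma. conjs.
  - apply (uniform_smooth2 (fun n t x => fst (delta n t x))).
    + intros n t; apply (H1 n t).
    + intros n t k eps. eapply filter_imp; [|apply (H2 n t k eps)].
      intros s Hs x. apply (R2_norm_lt _ _ (Hs x)).
  - apply (uniform_smooth2 (fun n t x => snd (delta n t x))).
    + intros n t; apply (H1 n t).
    + intros n t k eps. eapply filter_imp; [|apply (H2 n t k eps)].
      intros s Hs x. apply (R2_norm_lt _ _ (Hs x)).
  - intros t; apply (H1 0%nat t).
Qed.

(** * Periodicity, and back from jointly smooth functions to smooth curves *)

Lemma periodic_IZR {T : Type} (f : R -> T) (z : Z) x :
  periodic f -> f (x + IZR z * (2 * PI)) = f x.
Proof.
  intros H.
  assert (N : forall n y, f (y + INR n * (2 * PI)) = f y).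
  { induction n; intros y.
    - simpl. rewrite Rmult_0_l, Rplus_0_r; auto.
    - rewrite S_INR.
      replace (y + (INR n + 1) * (2 * PI)) with (y + INR n * (2 * PI) + 2 * PI) by ring.
      rewrite H; auto. }
  destruct (Z_le_gt_dec 0 z).
  - rewrite <- (Z2Nat.id z), <- INR_IZR_INZ; auto.
  - rewrite <- (N (Z.to_nat (- z)) (x + IZR z * (2 * PI))).
    rewrite INR_IZR_INZ, Z2Nat.id, opp_IZR by lia. f_equal; ring.
Qed.

Lemma circle_representative x :
  exists z, 0 <= x + IZR z * (2 * PI) <= 2 * PI.
Proof.
  pose proof PI_RGT_0.
  exists (- (up (x / (2 * PI)) - 1))%Z.
  destruct (archimed (x / (2 * PI))) as [A B].
  rewrite opp_IZR, minus_IZR. set (u := IZR (up (x / (2 * PI)))) in *.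
  assert (E : x = x / (2 * PI) * (2 * PI)) by (field; lra).
  set (y := x / (2 * PI)) in *. nra.
Qed.

Lemma periodic_dt F : (forall t, periodic (F t)) -> forall t, periodic (dt F t).
Proof.
  intros H t x. unfold dt. apply Derive_ext. intros u; apply H.
Qed.

(** The two difference quotients are the same function of h, so the identity of limits holds for
    arbitrary f; this makes [periodic_Derive] free of regularity assumptions. *)
Lemma Derive_shift (f : R -> R) (a x : R) : Derive (fun y => f (y + a)) x = Derive f (x + a).
Proof.
  assert (E : forall h : R, x + h + a = x + a + h)
    by (intros h; rewrite !Rplus_assoc, (Rplus_comm h a); auto).
  unfold Derive. f_equal. apply Lim_ext. intros h. rewrite E; auto.
Qed.

Lemma periodic_Derive f : periodic f -> periodic (Derive f).
Proof.
  intros H x. rewrite <- Derive_shift. apply Derive_ext; auto.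
Qed.

Lemma periodic_iter_dx F k :
  (forall t, periodic (F t)) -> forall t, periodic (Nat.iter k dx F t).
Proof.
  intros H; induction k; simpl; auto. intros t; apply periodic_Derive; auto.
Qed.

Lemma periodic_iter_dt F k :
  (forall t, periodic (F t)) -> forall t, periodic (Nat.iter k dt F t).
Proof. intros H; induction k; simpl; auto using periodic_dt. Qed.

(** The mean value theorem in t turns the quotient into [dt F] at an intermediate time. Uniform
    continuity of [dt F] on one compact rectangle gives the estimate over a period, and periodicity
    extends it to all x. *)
Lemma smooth2_uniform_quotient F t (eps : posreal) :
  smooth2 F -> (forall t, periodic (F t)) ->
  locally' 0 (fun s => forall x,
    Rabs (/ s * (F (t + s) x - F t x) - dt F t x) < eps).
Proof.
  intros H P.
  pose proof (smooth2_dt _ H) as Ht.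
  destruct (uniform_continuity_2d (dt F) (t - 1) (t + 1) 0 (2 * PI)
    (fun u v _ _ => smooth2_cont _ Ht u v) eps) as [d Hd].
  assert (Hm : 0 < Rmin d 1) by (apply Rmin_glb_lt; [apply cond_pos | lra]).
  exists (mkposreal _ Hm). refine (fun (s : R) => _). intros Hs Hs0.
  change (Rabs (s + - 0) < Rmin d 1) in Hs. rewrite Ropp_0, Rplus_0_r in Hs.
  pose proof (Rmin_l d 1). pose proof (Rmin_r d 1).
  assert (Main : forall x, 0 <= x <= 2 * PI ->
    Rabs (/ s * (F (t + s) x - F t x) - dt F t x) < eps).
  { intros x Hx.
    destruct (MVT_gen (fun u => F u x) t (t + s) (fun u => dt F u x)) as (c & Hc & E).
    - intros u _. unfold dt. apply Derive_correct, (smooth2_ex_dt F H u x).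
    - intros u _. apply continuity_pt_filterlim, (ex_derive_continuous (fun u => F u x) u).
      apply (smooth2_ex_dt F H u x).
    - simpl in E. rewrite E. replace (/ s * (dt F c x * (t + s - t))) with (dt F c x)
        by (field; auto).
      assert (Hct : Rabs (c - t) <= Rabs s).
      { revert Hc. unfold Rmin, Rmax, Rabs.
        repeat destruct Rle_dec; repeat destruct Rcase_abs; lra. }
      assert (t - 1 <= c <= t + 1).
      { assert (Rabs (c - t) <= 1) by lra. revert H2. unfold Rabs.
        destruct Rcase_abs; lra. }
      apply Hd; auto; try lra.
      rewrite Rminus_diag, Rabs_R0. apply cond_pos. }
  intros x. destruct (circle_representative x) as [z Hz].
  rewrite <- (periodic_IZR (F (t + s)) z), <- (periodic_IZR (F t) z),
    <- (periodic_IZR (dt F t) z); auto using periodic_dt.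
Qed.

(** Since [dx] commutes with [dt], this is the undifferentiated estimate applied to the k-th
    derivative in x. *)
Lemma smooth2_uniform_quotient_n F t k (eps : posreal) :
  smooth2 F -> (forall t, periodic (F t)) ->
  locally' 0 (fun s => forall x,
    Rabs (Derive_n (fun y => / s * (F (t + s) y - F t y) - dt F t y) k x) < eps).
Proof.
  intros H P.
  eapply filter_imp; [|apply (smooth2_uniform_quotient (Nat.iter k dx F) t eps);
    auto using smooth2_iter_dx, periodic_iter_dx].
  intros s Hs x. rewrite Derive_n_quotient; auto using smooth2_smooth, smooth2_dt.
  rewrite !Derive_n_iter_dx, iter_dx_dt; auto.
Qed.

Lemma smooth2_smooth_curve F G :
  smooth2 F -> smooth2 G -> (forall t, periodic (F t)) -> (forall t, periodic (G t)) ->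
  smooth_curve (fun t x => (F t x, G t x)).
Proof.
  intros HF HG PF PG.
  exists (fun n t x => (Nat.iter n dt F t x, Nat.iter n dt G t x)). conjs; auto.
  - intros n t. split; [|split]; simpl.
    + apply (smooth2_smooth (Nat.iter n dt F)), smooth2_iter_dt; auto.
    + apply (smooth2_smooth (Nat.iter n dt G)), smooth2_iter_dt; auto.
    + intros x. f_equal; apply periodic_iter_dt; auto.
  - intros n t k eps.
    pose proof (is_pos_div_2 eps) as He2.
    pose proof (smooth2_uniform_quotient_n (Nat.iter n dt F) t k (mkposreal _ He2)
      (smooth2_iter_dt _ _ HF) (periodic_iter_dt _ _ PF)) as A.
    pose proof (smooth2_uniform_quotient_n (Nat.iter n dt G) t k (mkposreal _ He2)
      (smooth2_iter_dt _ _ HG) (periodic_iter_dt _ _ PG)) as B.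
    eapply filter_imp; [|apply (filter_and _ _ A B)].
    intros s [Hs1 Hs2] x. apply lt_R2_norm; [apply Hs1 | apply Hs2].
Qed.

(** * Integrals depending on a parameter *)

Lemma RInt_param_close F t x (eps : posreal) : smooth2 F ->
  exists d : posreal, forall u y, Rabs (u - t) < d -> Rabs y <= x ->
    Rabs (RInt (F u) 0 y - RInt (F t) 0 y) <= x * eps.
Proof.
  intros HF.
  destruct (uniform_continuity_2d_1d' F (- x) x t
    (fun v _ => smooth2_cont _ HF t v) eps) as [d Hd].
  exists d. intros u y Hu Hy.
  assert (B : forall z, - x <= z <= x -> Rabs (F u z - F t z) <= eps).
  { intros z Hz. left. apply Hd; auto.
    - pose proof (cond_pos d); lra.
    - apply Rabs_lt_between in Hu; lra.
    - rewrite Rminus_diag, Rabs_R0; apply cond_pos. }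
  assert (E : forall z, ex_RInt (fun w => F u w - F t w) 0 z)
    by (intros; apply @ex_RInt_minus; apply smooth2_ex_RInt; auto).
  rewrite <- (RInt_minus (V := R_CompleteNormedModule)) by
    (apply smooth2_ex_RInt; auto).
  apply Rabs_le_between in Hy. pose proof (cond_pos eps).
  destruct (Rle_dec 0 y).
  - eapply Rle_trans; [apply (abs_RInt_le_const _ 0 y eps r (E y))|].
    + intros w Hw. apply B; lra.
    + rewrite Rminus_0_r. nra.
  - rewrite <- (opp_RInt_swap (V := R_CompleteNormedModule)) by
      (apply @ex_RInt_swap, E).
    change (Rabs (- RInt (fun w => F u w - F t w) y 0) <= x * eps).
    rewrite Rabs_Ropp.
    eapply Rle_trans; [apply (abs_RInt_le_const _ y 0 eps)|].
    + lra.
    + apply @ex_RInt_swap, E.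
    + intros w Hw. apply B; lra.
    + nra.
Qed.

Lemma is_derive_RInt_x F t x : smooth2 F ->
  is_derive (fun y => RInt (F t) 0 y) x (F t x).
Proof.
  intros HF. apply (is_derive_RInt (F t) _ 0).
  - apply filter_forall. intros y. apply (@RInt_correct R_CompleteNormedModule).
    apply smooth2_ex_RInt; auto.
  - apply smooth2_cont_x; auto.
Qed.

Lemma is_derive_RInt_t F t x : smooth2 F ->
  is_derive (fun u => RInt (F u) 0 x) t (RInt (dt F t) 0 x).
Proof.
  intros HF. apply (is_derive_RInt_param F 0 x t).
  - apply filter_forall. intros u y _. apply (smooth2_ex_dt F HF u y).
  - intros y _. apply (smooth2_cont _ (smooth2_dt _ HF)).
  - apply filter_forall. intros u. apply smooth2_ex_RInt; auto.
Qed.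

(** The parameter is moved first, uniformly over endpoints y with |y| <= |x| + 1; the endpoint is
    moved afterwards at the fixed parameter t. *)
Lemma RInt_param_cont F t x : smooth2 F ->
  continuity_2d_pt (fun u y => RInt (F u) 0 y) t x.
Proof.
  intros HF eps.
  set (X := Rabs x + 1).
  assert (HX : 0 < X) by (unfold X; pose proof (Rabs_pos x); lra).
  assert (He : 0 < eps / 2 / X).
  { apply Rdiv_lt_0_compat; auto. apply is_pos_div_2. }
  destruct (RInt_param_close F t X (mkposreal _ He) HF) as [d Hd].
  assert (C : continuous (fun y => RInt (F t) 0 y) x).
  { apply @ex_derive_continuous. eexists; apply is_derive_RInt_x; auto. }
  destruct (proj1 (filterlim_locally _ _) C (mkposreal _ (is_pos_div_2 eps))) as [d2 H2].
  assert (Hm : 0 < Rmin d (Rmin d2 1)).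
  { pose proof (cond_pos d); pose proof (cond_pos d2).
    repeat apply Rmin_glb_lt; auto; lra. }
  exists (mkposreal _ Hm). simpl. intros u y Hu Hy.
  pose proof (Rmin_l d (Rmin d2 1)). pose proof (Rmin_r d (Rmin d2 1)).
  pose proof (Rmin_l d2 1). pose proof (Rmin_r d2 1).
  assert (B : Rabs (RInt (F t) 0 y - RInt (F t) 0 x) < eps / 2).
  { apply H2. change (Rabs (y - x) < d2). lra. }
  assert (A : Rabs (RInt (F u) 0 y - RInt (F t) 0 y) <= eps / 2).
  { replace (eps / 2) with (X * (eps / 2 / X)) by (field; lra).
    apply (Hd u y); try lra. unfold X.
    replace y with ((y - x) + x) by ring.
    eapply Rle_trans; [apply Rabs_triang|]. lra. }
  replace (RInt (F u) 0 y - RInt (F t) 0 x) with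
    ((RInt (F u) 0 y - RInt (F t) 0 y) + (RInt (F t) 0 y - RInt (F t) 0 x)) by ring.
  eapply Rle_lt_trans; [apply Rabs_triang|]. lra.
Qed.

(** The derivative in x gives back F, and the derivative in t is an integral of the same kind with
    [dt F]; generalizing over F closes the induction. *)
Lemma smooth2_RInt F : smooth2 F -> smooth2 (fun t x => RInt (F t) 0 x).
Proof.
  intros HF n; revert F HF; induction n; intros F HF; split; auto;
    try (intros; apply RInt_param_cont; auto).
  exists (fun t x => RInt (dt F t) 0 x), F; conjs; auto.
  - intros; apply is_derive_RInt_t; auto.
  - intros; apply is_derive_RInt_x; auto.
  - apply IHn, smooth2_dt; auto.
Qed.

(** Keeping a dummy second variable lets scalars such as lengths and total integrals live in the
    same calculus as functions on the circle. *)
Lemma smooth2_at F a : smooth2 F -> smooth2 (fun t _ => F t a).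
Proof.
  intros HF n; revert F HF; induction n; intros F HF; split; auto;
    try (intros t x eps; destruct (smooth2_cont _ HF t a eps) as [d Hd];
         exists d; intros u v Hu _; apply Hd; auto;
         rewrite Rminus_diag, Rabs_R0; apply cond_pos).
  exists (fun t _ => dt F t a), (fun _ _ => 0); conjs; auto.
  - intros; apply Derive_correct, (smooth2_ex_dt F HF t a).
  - intros; apply (is_derive_const (F t a)).
  - apply (IHn (dt F)), smooth2_dt; auto.
  - apply jointly_C_const.
Qed.

(** * Smooth families of functions on the circle *)

Definition smooth_family (F : R -> R -> R) : Prop := smooth2 F /\ forall t, periodic (F t).

Lemma sfam_const a : smooth_family (fun _ _ => a).
Proof. split; [apply smooth2_const | intros t x; auto]. Qed.

Lemma sfam_plus F G : smooth_family F -> smooth_family G -> smooth_family (fun t x => F t x + G t x).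
Proof.
  intros [A B] [C D]; split; [apply smooth2_plus; auto|].
  intros t x. rewrite B, D; auto.
Qed.

Lemma sfam_minus F G : smooth_family F -> smooth_family G -> smooth_family (fun t x => F t x - G t x).
Proof.
  intros [A B] [C D]; split; [apply smooth2_minus; auto|].
  intros t x. rewrite B, D; auto.
Qed.

Lemma sfam_opp F : smooth_family F -> smooth_family (fun t x => - F t x).
Proof.
  intros [A B]; split; [apply smooth2_opp; auto|].
  intros t x. rewrite B; auto.
Qed.

Lemma sfam_mult F G : smooth_family F -> smooth_family G -> smooth_family (fun t x => F t x * G t x).
Proof.
  intros [A B] [C D]; split; [apply smooth2_mult; auto|].
  intros t x. rewrite B, D; auto.
Qed.

Lemma sfam_inv F : (forall t x, F t x <> 0) -> smooth_family F -> smooth_family (fun t x => / F t x).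
Proof.
  intros H [A B]; split; [apply smooth2_inv; auto|].
  intros t x. rewrite B; auto.
Qed.

Lemma sfam_sqrt F : (forall t x, 0 < F t x) -> smooth_family F -> smooth_family (fun t x => sqrt (F t x)).
Proof.
  intros H [A B]; split; [apply smooth2_sqrt; auto|].
  intros t x. rewrite B; auto.
Qed.

Lemma sfam_Derive F : smooth_family F -> smooth_family (fun t => Derive (F t)).
Proof.
  intros [A B]; split; [apply (smooth2_dx F); auto|].
  intros t. apply periodic_Derive; auto.
Qed.

Lemma Cinf1_sfam f : Cinf1 f -> smooth_family (fun _ => f).
Proof. intros [A B]; split; auto. apply smooth_smooth2; auto. Qed.

Lemma sfam_Cinf1 F t : smooth_family F -> Cinf1 (F t).
Proof. intros [A B]; split; auto. apply smooth2_smooth; auto. Qed.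

(** * Calculus along a curve of speed [sigma] *)

Definition ds (sigma f : R -> R) (x : R) : R := / sigma x * Derive f x.

Definition ints (sigma f : R -> R) : R := RInt (fun x => f x * sigma x) 0 (2 * PI).

Definition Q (sigma f : R -> R) (x : R) : R := f x - ds sigma (ds sigma f) x.

Definition arclength_family (S : R -> R -> R) : Prop :=
  smooth_family S /\ forall t x, 0 < S t x.

Lemma sfam_ds S F : arclength_family S -> smooth_family F -> smooth_family (fun t => ds (S t) (F t)).
Proof.
  intros [A B] HF. apply sfam_mult; [|apply sfam_Derive; auto].
  apply sfam_inv; auto. intros t x; specialize (B t x); lra.
Qed.

Lemma sfam_iter_ds S F n :
  arclength_family S -> smooth_family F -> smooth_family (fun t => Nat.iter n (ds (S t)) (F t)).
Proof. intros A HF; induction n; simpl; auto using sfam_ds. Qed.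

Lemma sfam_Q S F : arclength_family S -> smooth_family F -> smooth_family (fun t => Q (S t) (F t)).
Proof.
  intros A HF. apply sfam_minus; auto. apply (sfam_ds S (fun t => ds (S t) (F t)));
    auto using sfam_ds.
Qed.

Lemma sfam_iter_Q S F n :
  arclength_family S -> smooth_family F -> smooth_family (fun t => Nat.iter n (Q (S t)) (F t)).
Proof. intros A HF; induction n; simpl; auto using sfam_Q. Qed.

(** The integral over the circle is a parameter integral with its upper limit frozen at 2 pi. *)
Lemma sfam_ints S F : arclength_family S -> smooth_family F -> smooth_family (fun t _ => ints (S t) (F t)).
Proof.
  intros [A B] HF. split; [|intros t x; auto].
  apply (smooth2_at (fun t x => RInt (fun y => F t y * S t y) 0 x)).
  apply (smooth2_RInt (fun t y => F t y * S t y)).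
  apply smooth2_mult; [apply HF | apply A].
Qed.

(** [Tinv e] inverts [T e] on periodic functions, by variation of constants. *)
Definition T (e : R) (sigma f : R -> R) (x : R) : R := f x + e * ds sigma f x.

(** Let L be the arclength measured from 0. When e^2 = 1, multiplication by exp(e L) turns
    [T e sigma f = g] into (exp(e L) f)' = e exp(e L) g sigma; this is a primitive of the right hand
    side, up to the factor e. *)
Definition Tprim (e : R) (sigma g : R -> R) (x : R) : R :=
  RInt (fun y => exp (e * RInt sigma 0 y) * g y * sigma y) 0 x.

(** The first summand in the bracket is the constant of integration C. Equality of the values at 0
    and 2 pi forces C (exp(e length) - 1) = e [Tprim] (2 pi). *)
Definition Tinv (e : R) (sigma g : R -> R) (x : R) : R :=
  exp (- (e * RInt sigma 0 x)) *
  (e * Tprim e sigma g (2 * PI) / (exp (e * RInt sigma 0 (2 * PI)) - 1)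
   + e * Tprim e sigma g x).

Lemma RInt_shift (f : R -> R) a b : (forall x, continuous f x) -> periodic f ->
  RInt f (a + 2 * PI) (b + 2 * PI) = RInt f a b.
Proof.
  intros C P.
  transitivity (RInt f (1 * a + 2 * PI) (1 * b + 2 * PI)); [f_equal; ring|].
  rewrite <- (RInt_comp_lin (V := R_CompleteNormedModule) f 1 (2 * PI) a b).
  - apply RInt_ext. intros x _. change (1 * f (1 * x + 2 * PI) = f x).
    rewrite !Rmult_1_l; apply P.
  - apply @ex_RInt_continuous; auto.
Qed.

Lemma RInt_period (f : R -> R) x : (forall x, continuous f x) -> periodic f ->
  RInt f 0 (x + 2 * PI) = RInt f 0 (2 * PI) + RInt f 0 x.
Proof.
  intros C P.
  rewrite <- (RInt_shift f 0 x) by auto. rewrite Rplus_0_l. symmetry.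
  apply (RInt_Chasles f); apply @ex_RInt_continuous; auto.
Qed.

Lemma smooth2_Tprim e S G : arclength_family S -> smooth_family G ->
  smooth2 (fun t => Tprim e (S t) (G t)).
Proof.
  intros [[A _] _] [B _].
  apply (smooth2_RInt (fun t y => exp (e * RInt (S t) 0 y) * G t y * S t y)).
  repeat apply smooth2_mult; auto. apply smooth2_exp, smooth2_mult.
  - apply smooth2_const.
  - apply smooth2_RInt; auto.
Qed.

Lemma length_pos S t : arclength_family S -> 0 < RInt (S t) 0 (2 * PI).
Proof.
  intros [[A _] B]. apply RInt_gt_0; auto.
  - pose proof PI_RGT_0; lra.
  - intros; apply smooth2_cont_x; auto.
Qed.

(** The homogeneous solution exp(-e L) is multiplied by a factor other than 1 along a closed curve
    of positive length, so the constant of integration is determined. *)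
Lemma exp_length_neq S e t : e <> 0 -> arclength_family S ->
  exp (e * RInt (S t) 0 (2 * PI)) - 1 <> 0.
Proof.
  intros He HS H. pose proof (length_pos S t HS).
  assert (E : exp (e * RInt (S t) 0 (2 * PI)) = exp 0) by (rewrite exp_0; lra).
  apply exp_inv, Rmult_integral in E. lra.
Qed.

Lemma smooth2_Tinv e S G : e <> 0 -> arclength_family S -> smooth_family G ->
  smooth2 (fun t => Tinv e (S t) (G t)).
Proof.
  intros He HS HG. pose proof (smooth2_Tprim e S G HS HG) as HP.
  assert (HL : smooth2 (fun t x => e * RInt (S t) 0 x)).
  { apply smooth2_mult; [apply smooth2_const|].
    apply smooth2_RInt, HS. }
  apply smooth2_mult.
  - apply smooth2_exp, smooth2_opp; auto.
  - apply smooth2_plus.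
    + apply (smooth2_mult (fun t _ => e * Tprim e (S t) (G t) (2 * PI))
        (fun t _ => / (exp (e * RInt (S t) 0 (2 * PI)) - 1))).
      * apply (smooth2_mult (fun _ _ => e)); [apply smooth2_const|].
        apply (smooth2_at (fun t => Tprim e (S t) (G t))); auto.
      * apply smooth2_inv; [intros; apply exp_length_neq; auto|].
        apply smooth2_minus; [|apply smooth2_const].
        apply smooth2_exp. apply (smooth2_at (fun t x => e * RInt (S t) 0 x)); auto.
    + apply smooth2_mult; auto. apply smooth2_const.
Qed.

Lemma periodic_Tinv e S G t : e <> 0 -> arclength_family S -> smooth_family G ->
  periodic (Tinv e (S t) (G t)).
Proof.
  intros He HS HG x. pose proof (exp_length_neq S e t He HS) as H0.
  destruct HS as [[A A'] B]; destruct HG as [C C'].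
  unfold Tinv, Tprim.
  set (w := fun y => exp (e * RInt (S t) 0 y) * G t y * S t y).
  assert (Cs : forall y, continuous (S t) y) by (apply smooth2_cont_x; auto).
  assert (Cw : forall y, continuous w y).
  { apply (smooth2_cont_x (fun t y => exp (e * RInt (S t) 0 y) * G t y * S t y)).
    repeat apply smooth2_mult; auto. apply smooth2_exp, smooth2_mult.
    - apply smooth2_const.
    - apply smooth2_RInt; auto. }
  (* A shift by one period adds the whole length to the exponent, hence multiplies w by exp(e
     length); the outer exponential of [Tinv] is multiplied by the inverse factor. *)
  assert (Ew : RInt w (0 + 2 * PI) (x + 2 * PI) =
    exp (e * RInt (S t) 0 (2 * PI)) * RInt w 0 x).
  { rewrite <- (RInt_scal (V := R_CompleteNormedModule)) by
      (apply @ex_RInt_continuous; auto).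
    transitivity (RInt w (1 * 0 + 2 * PI) (1 * x + 2 * PI)); [f_equal; ring|].
    rewrite <- (RInt_comp_lin (V := R_CompleteNormedModule) w 1 (2 * PI) 0 x) by
      (apply @ex_RInt_continuous; auto).
    apply RInt_ext. intros y _. unfold scal; simpl; unfold mult; simpl.
    unfold w. rewrite !Rmult_1_l, A', C', RInt_period, Rmult_plus_distr_l, exp_plus
      by auto. ring. }
  assert (Ew' : RInt w 0 (x + 2 * PI) = RInt w 0 (2 * PI) +
    exp (e * RInt (S t) 0 (2 * PI)) * RInt w 0 x).
  { rewrite <- Ew, Rplus_0_l. symmetry.
    apply (RInt_Chasles w); apply @ex_RInt_continuous; auto. }
  rewrite Ew', RInt_period by auto.
  rewrite (Rmult_plus_distr_l e (RInt (S t) 0 (2 * PI)) (RInt (S t) 0 x)),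
    Ropp_plus_distr, exp_plus.
  rewrite (exp_Ropp (e * RInt (S t) 0 (2 * PI))).
  pose proof (exp_pos (e * RInt (S t) 0 (2 * PI))).
  field. split; lra.
Qed.

Lemma sfam_Tinv e S G : e <> 0 -> arclength_family S -> smooth_family G ->
  smooth_family (fun t => Tinv e (S t) (G t)).
Proof.
  intros He HS HG; split; [apply smooth2_Tinv | intros t; apply periodic_Tinv]; auto.
Qed.

Lemma T_Tinv e S G t x : e * e = 1 -> arclength_family S -> smooth_family G ->
  T e (S t) (Tinv e (S t) (G t)) x = G t x.
Proof.
  intros He HS HG. pose proof (smooth2_Tprim e S G HS HG) as HP.
  destruct HS as [[A A'] B]; destruct HG as [C C'].
  assert (D1 : forall y, is_derive (fun x => RInt (S t) 0 x) y (S t y))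
    by (intros; apply is_derive_RInt_x; auto).
  assert (D2 : forall y, is_derive (Tprim e (S t) (G t)) y
      (exp (e * RInt (S t) 0 y) * G t y * S t y)).
  { intros y. 
    apply (is_derive_RInt_x (fun t y => exp (e * RInt (S t) 0 y) * G t y * S t y)).
    repeat apply smooth2_mult; auto. apply smooth2_exp, smooth2_mult.
    - apply smooth2_const.
    - apply smooth2_RInt; auto. }
  set (K := e * Tprim e (S t) (G t) (2 * PI) / (exp (e * RInt (S t) 0 (2 * PI)) - 1)).
  assert (D : is_derive (Tinv e (S t) (G t)) x
    (- (e * S t x) * Tinv e (S t) (G t) x + e * G t x * S t x)).
  { replace (- (e * S t x) * Tinv e (S t) (G t) x + e * G t x * S t x) with
      ((- (e * S t x) * exp (- (e * RInt (S t) 0 x))) * (K + e * Tprim e (S t) (G t) x)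
       + exp (- (e * RInt (S t) 0 x)) *
         (0 + e * (exp (e * RInt (S t) 0 x) * G t x * S t x))).
    - apply (is_derive_Rmult (fun x => exp (- (e * RInt (S t) 0 x)))
        (fun x => K + e * Tprim e (S t) (G t) x)).
      + apply (is_derive_comp exp (fun x => - (e * RInt (S t) 0 x)) x).
        * apply is_derive_exp.
        * apply (is_derive_opp (fun x => e * RInt (S t) 0 x)).
          apply (is_derive_scal (fun x => RInt (S t) 0 x)); auto.
      + apply (is_derive_plus (fun _ => K)).
        * apply (is_derive_const K).
        * apply (is_derive_scal (Tprim e (S t) (G t))); auto.
    - unfold Tinv; fold K. rewrite exp_Ropp.
      pose proof (exp_pos (e * RInt (S t) 0 x)). field; lra. }
  unfold T, ds. rewrite (is_derive_unique _ _ _ D).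
  specialize (B t x).
  (* The factor e in [T] meets the factor e in the derivative: e^2 = 1 makes the two occurrences of
     [Tinv] cancel. *)
  transitivity (Tinv e (S t) (G t) x +
    e * e * (- Tinv e (S t) (G t) x + G t x)); [field; lra | rewrite He; ring].
Qed.

(** * Functions on a single curve *)

Definition arclength (sigma : R -> R) : Prop := Cinf1 sigma /\ forall x, 0 < sigma x.

(** A single function is a family constant in t; the smoothness of [ds], [Q], [Tinv] and the speed
    on one curve is inherited from families in this way. *)
Lemma arclength_const_family s : arclength s -> arclength_family (fun _ => s).
Proof. intros [A B]; split; auto. apply Cinf1_sfam; auto. Qed.

Lemma Cinf1_cont f : Cinf1 f -> forall x, continuous f x.
Proof. intros H; apply (smooth2_cont_x (fun _ => f) (proj1 (Cinf1_sfam f H)) 0). Qed.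

Lemma Cinf1_ex_derive f : Cinf1 f -> forall x, ex_derive f x.
Proof. intros [H _]; apply smooth_ex_derive; auto. Qed.

Lemma Cinf1_const a : Cinf1 (fun _ => a).
Proof. apply (sfam_Cinf1 (fun _ _ => a) 0), sfam_const. Qed.

Lemma Cinf1_plus f g : Cinf1 f -> Cinf1 g -> Cinf1 (fun x => f x + g x).
Proof.
  intros; apply (sfam_Cinf1 (fun _ x => f x + g x) 0), (sfam_plus (fun _ => f) (fun _ => g));
    apply Cinf1_sfam; auto.
Qed.

Lemma Cinf1_minus f g : Cinf1 f -> Cinf1 g -> Cinf1 (fun x => f x - g x).
Proof.
  intros; apply (sfam_Cinf1 (fun _ x => f x - g x) 0), (sfam_minus (fun _ => f) (fun _ => g));
    apply Cinf1_sfam; auto.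
Qed.

Lemma Cinf1_mult f g : Cinf1 f -> Cinf1 g -> Cinf1 (fun x => f x * g x).
Proof.
  intros; apply (sfam_Cinf1 (fun _ x => f x * g x) 0), (sfam_mult (fun _ => f) (fun _ => g));
    apply Cinf1_sfam; auto.
Qed.

Lemma Cinf1_opp f : Cinf1 f -> Cinf1 (fun x => - f x).
Proof.
  intros; apply (sfam_Cinf1 (fun _ x => - f x) 0), (sfam_opp (fun _ => f));
    apply Cinf1_sfam; auto.
Qed.

Lemma Cinf1_Derive f : Cinf1 f -> Cinf1 (Derive f).
Proof.
  intros [A B]; split; [apply smooth_Derive | apply periodic_Derive]; auto.
Qed.

Lemma Cinf1_ds s f : arclength s -> Cinf1 f -> Cinf1 (ds s f).
Proof.
  intros; apply (sfam_Cinf1 (fun _ => ds s f) 0), (sfam_ds (fun _ => s) (fun _ => f));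
    auto using Cinf1_sfam, arclength_const_family.
Qed.

Lemma Cinf1_iter_ds s f n : arclength s -> Cinf1 f -> Cinf1 (Nat.iter n (ds s) f).
Proof. intros H Hf; induction n; simpl; auto using Cinf1_ds. Qed.

Lemma Cinf1_Q s f : arclength s -> Cinf1 f -> Cinf1 (Q s f).
Proof. intros; apply Cinf1_minus; auto using Cinf1_ds. Qed.

Lemma Cinf1_iter_Q s f n : arclength s -> Cinf1 f -> Cinf1 (Nat.iter n (Q s) f).
Proof. intros H Hf; induction n; simpl; auto using Cinf1_Q. Qed.

Lemma Cinf1_pow2 f : Cinf1 f -> Cinf1 (fun x => f x ^ 2).
Proof. intros; simpl; auto using Cinf1_mult, Cinf1_const. Qed.

#[local] Hint Resolve Cinf1_pow2 Cinf1_const Cinf1_plus Cinf1_minus Cinf1_mult Cinf1_opp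
  Cinf1_ds Cinf1_iter_ds Cinf1_Q Cinf1_iter_Q : smooth.

(** * Algebra of D_s and of Q = 1 - D_s^2 *)

Lemma ds_plus s f g : Cinf1 f -> Cinf1 g ->
  ds s (fun x => f x + g x) = fun x => ds s f x + ds s g x.
Proof.
  intros Hf Hg; apply functional_extensionality; intros x. unfold ds.
  rewrite Derive_plus by (apply Cinf1_ex_derive; auto). ring.
Qed.

Lemma ds_minus s f g : Cinf1 f -> Cinf1 g ->
  ds s (fun x => f x - g x) = fun x => ds s f x - ds s g x.
Proof.
  intros Hf Hg; apply functional_extensionality; intros x. unfold ds.
  rewrite Derive_minus by (apply Cinf1_ex_derive; auto). ring.
Qed.

Lemma ds_scal s a f : ds s (fun x => a * f x) = fun x => a * ds s f x.
Proof.
  apply functional_extensionality; intros x. unfold ds.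
  rewrite Derive_scal. ring.
Qed.

Lemma ds_mult s f g : Cinf1 f -> Cinf1 g ->
  ds s (fun x => f x * g x) = fun x => ds s f x * g x + f x * ds s g x.
Proof.
  intros Hf Hg; apply functional_extensionality; intros x. unfold ds.
  rewrite Derive_mult by (apply Cinf1_ex_derive; auto). ring.
Qed.

Lemma Q_plus s f g : arclength s -> Cinf1 f -> Cinf1 g ->
  Q s (fun x => f x + g x) = fun x => Q s f x + Q s g x.
Proof.
  intros H Hf Hg; apply functional_extensionality; intros x. unfold Q.
  rewrite !ds_plus by auto with smooth. ring.
Qed.

Lemma Q_scal s a f : Q s (fun x => a * f x) = fun x => a * Q s f x.
Proof.
  apply functional_extensionality; intros x. unfold Q. rewrite !ds_scal. ring.
Qed.

Lemma iter_Q_plus s f g n : arclength s -> Cinf1 f -> Cinf1 g ->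
  Nat.iter n (Q s) (fun x => f x + g x) =
  fun x => Nat.iter n (Q s) f x + Nat.iter n (Q s) g x.
Proof.
  intros H Hf Hg; induction n; simpl; auto.
  rewrite IHn, Q_plus; auto with smooth.
Qed.

Lemma iter_Q_scal s a f n :
  Nat.iter n (Q s) (fun x => a * f x) = fun x => a * Nat.iter n (Q s) f x.
Proof. induction n; simpl; auto. rewrite IHn, Q_scal; auto. Qed.

Lemma ds_Q s f : arclength s -> Cinf1 f -> ds s (Q s f) = Q s (ds s f).
Proof.
  intros H Hf. unfold Q at 1. rewrite ds_minus; auto with smooth.
Qed.

Lemma ds_iter_Q s f n : arclength s -> Cinf1 f ->
  ds s (Nat.iter n (Q s) f) = Nat.iter n (Q s) (ds s f).
Proof.
  intros H Hf; induction n; simpl; auto.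
  rewrite ds_Q, IHn; auto with smooth.
Qed.

(** * Integration in arclength *)

Lemma ints_ex s f : arclength s -> Cinf1 f ->
  forall a b, ex_RInt (fun x => f x * s x) a b.
Proof.
  intros [H _] Hf a b. apply @ex_RInt_continuous; intros.
  apply Cinf1_cont; auto with smooth.
Qed.

Lemma ints_plus s f g : arclength s -> Cinf1 f -> Cinf1 g ->
  ints s (fun x => f x + g x) = ints s f + ints s g.
Proof.
  intros H Hf Hg. unfold ints.
  rewrite <- (RInt_plus (V := R_CompleteNormedModule)) by (apply ints_ex; auto).
  apply RInt_ext; intros; apply Rmult_plus_distr_r.
Qed.

Lemma ints_scal s a f : arclength s -> Cinf1 f ->
  ints s (fun x => a * f x) = a * ints s f.
Proof.
  intros H Hf. unfold ints.
  rewrite <- (RInt_scal (V := R_CompleteNormedModule) (fun x => f x * s x))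
    by (apply ints_ex; auto).
  apply RInt_ext; intros; apply Rmult_assoc.
Qed.

Lemma ints_ext s f g : (forall x, f x = g x) -> ints s f = ints s g.
Proof. intros H. unfold ints. apply RInt_ext; intros; rewrite H; auto. Qed.

Lemma ints_minus s f g : arclength s -> Cinf1 f -> Cinf1 g ->
  ints s (fun x => f x - g x) = ints s f - ints s g.
Proof.
  intros H Hf Hg.
  rewrite (ints_ext s _ (fun x => f x + (-1) * g x)) by (intros; ring).
  rewrite ints_plus, ints_scal by auto with smooth. ring.
Qed.

Lemma ints_le s f g : arclength s -> Cinf1 f -> Cinf1 g ->
  (forall x, f x <= g x) -> ints s f <= ints s g.
Proof.
  intros H Hf Hg Hle. apply RInt_le; auto using ints_ex.
  - pose proof PI_RGT_0; lra.
  - intros x _. destruct H as [_ H]. specialize (H x); specialize (Hle x). nra.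
Qed.

Lemma ints_ge_0 s f : arclength s -> Cinf1 f ->
  (forall x, 0 <= f x) -> 0 <= ints s f.
Proof.
  (* Zero is written as 0 * 0 so that [ints_scal] evaluates the integral. *)
  intros H Hf Hp. replace 0 with (ints s (fun _ => 0 * 0)).
  - apply ints_le; auto with smooth. intros x; rewrite Rmult_0_l; auto.
  - rewrite ints_scal by auto with smooth. ring.
Qed.

Lemma RInt_ge_0_pos (f : R -> R) a b x0 : a < x0 < b ->
  (forall x, continuous f x) -> (forall x, 0 <= f x) -> 0 < f x0 -> 0 < RInt f a b.
Proof.
  intros Hx C P H0.
  assert (E : forall u v, ex_RInt f u v) by (intros; apply @ex_RInt_continuous; auto).
  destruct (proj1 (filterlim_locally _ _) (C x0) (mkposreal _ H0)) as [d Hd].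
  set (m := Rmin (x0 + d / 2) b).
  assert (Hm : x0 < m <= b).
  { unfold m. pose proof (cond_pos d). pose proof (Rmin_r (x0 + d / 2) b).
    split; auto. apply Rmin_glb_lt; lra. }
  assert (Hm' : m <= x0 + d / 2) by apply Rmin_l.
  rewrite <- (RInt_Chasles (V := R_CompleteNormedModule) f a x0 b) by auto.
  rewrite <- (RInt_Chasles (V := R_CompleteNormedModule) f x0 m b) by auto.
  assert (A : 0 <= RInt f a x0) by (apply RInt_ge_0; auto; lra).
  assert (B : 0 <= RInt f m b) by (apply RInt_ge_0; auto; lra).
  assert (D : 0 < RInt f x0 m).
  { apply RInt_gt_0; auto; try lra. intros x Hx2.
    assert (K : Rabs (f x - f x0) < f x0).
    { apply Hd. change (Rabs (x - x0) < d). pose proof (cond_pos d).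
      rewrite Rabs_pos_eq; lra. }
    apply Rabs_lt_between in K. lra. }
  unfold plus; simpl. lra.
Qed.

Lemma RInt_any_period (f : R -> R) a : (forall x, continuous f x) -> periodic f ->
  RInt f a (a + 2 * PI) = RInt f 0 (2 * PI).
Proof.
  intros C P.
  assert (E : forall u v, ex_RInt f u v) by (intros; apply @ex_RInt_continuous; auto).
  pose proof (RInt_Chasles (V := R_CompleteNormedModule) f 0 a (a + 2 * PI)
    (E _ _) (E _ _)) as H.
  rewrite RInt_period in H by auto. unfold plus in H; simpl in H. lra.
Qed.

Lemma ints_pos s f x0 : arclength s -> Cinf1 f ->
  (forall x, 0 <= f x) -> 0 < f x0 -> 0 < ints s f.
Proof.
  intros [A B] Hf P H0. unfold ints.
  assert (Hfs : Cinf1 (fun x => f x * s x)) by auto with smooth.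
  (* The period is centred at x0, which makes x0 an interior point of the interval. *)
  rewrite <- (RInt_any_period _ (x0 - PI)); [|apply Cinf1_cont; auto|apply Hfs].
  apply (RInt_ge_0_pos _ _ _ x0).
  - pose proof PI_RGT_0; lra.
  - apply Cinf1_cont; auto.
  - intros x. specialize (P x); specialize (B x); nra.
  - specialize (B x0); nra.
Qed.

Lemma ints_ds s f : arclength s -> Cinf1 f -> ints s (ds s f) = 0.
Proof.
  intros H Hf. transitivity (RInt (Derive f) 0 (2 * PI)).
  - apply RInt_ext. intros x _. unfold ds. destruct H as [_ H]. specialize (H x).
    change (/ s x * Derive f x * s x = Derive f x). field. lra.
  - rewrite RInt_Derive.
    + destruct Hf as [_ Hf]. specialize (Hf 0). rewrite Rplus_0_l in Hf. lra.
    + intros; apply Cinf1_ex_derive; auto.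
    + intros; apply Cinf1_cont, Cinf1_Derive; auto.
Qed.

Lemma ints_ibp s f g : arclength s -> Cinf1 f -> Cinf1 g ->
  ints s (fun x => ds s f x * g x) = - ints s (fun x => f x * ds s g x).
Proof.
  intros H Hf Hg.
  assert (E : ints s (ds s (fun x => f x * g x)) = 0)
    by (apply ints_ds; auto with smooth).
  rewrite ds_mult, ints_plus in E by auto with smooth. lra.
Qed.

Lemma ints_Q s f g : arclength s -> Cinf1 f -> Cinf1 g ->
  ints s (fun x => Q s f x * g x) =
  ints s (fun x => f x * g x) + ints s (fun x => ds s f x * ds s g x).
Proof.
  intros H Hf Hg.
  rewrite (ints_ext s _ (fun x => f x * g x - ds s (ds s f) x * g x))
    by (intros; unfold Q; ring).
  rewrite ints_minus, ints_ibp by auto with smooth. ring.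
Qed.

Lemma ints_Q_sym s f g : arclength s -> Cinf1 f -> Cinf1 g ->
  ints s (fun x => Q s f x * g x) = ints s (fun x => f x * Q s g x).
Proof.
  intros H Hf Hg. rewrite ints_Q by auto.
  rewrite (ints_ext s (fun x => f x * Q s g x) (fun x => Q s g x * f x))
    by (intros; ring).
  rewrite ints_Q by auto. f_equal; apply ints_ext; intros; ring.
Qed.

Lemma ints_iter_Q_sym s f g n : arclength s -> Cinf1 f -> Cinf1 g ->
  ints s (fun x => Nat.iter n (Q s) f x * g x) =
  ints s (fun x => f x * Nat.iter n (Q s) g x).
Proof.
  intros H; revert f g; induction n; intros f g Hf Hg; auto.
  rewrite Nat.iter_succ_r, Nat.iter_succ. simpl. rewrite IHn by auto with smooth.
  rewrite ints_Q_sym by auto with smooth. auto.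
Qed.

(** * The quadratic form of a power of Q *)

Definition energy (n : nat) (s f : R -> R) : R :=
  ints s (fun x => Nat.iter n (Q s) f x * f x).

(** One integration by parts, then [ds] commutes past the powers of [Q]. Iterated, this Pascal
    recursion shows [energy n] to be the sum over j of binom(n, j) times the integral of (D_s^j
    f)^2. *)
Lemma energy_S n s f : arclength s -> Cinf1 f ->
  energy (S n) s f = energy n s f + energy n s (ds s f).
Proof.
  intros H Hf. unfold energy. simpl. rewrite ints_Q by auto with smooth.
  rewrite ds_iter_Q; auto.
Qed.

(** In the recursion both summands are nonnegative. The top order j = n + 1 is found in the energy
    of [ds s f], every lower order in the energy of f. *)
Lemma energy_ge n s f : arclength s -> Cinf1 f -> forall j, (j <= n)%nat ->
  ints s (fun x => Nat.iter j (ds s) f x ^ 2) <= energy n s f.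
Proof.
  intros H; revert f; induction n; intros f Hf j Hj.
  - replace j with 0%nat by lia. right. apply ints_ext; intros; simpl; ring.
  - rewrite energy_S by auto.
    assert (P : forall g, Cinf1 g -> 0 <= energy n s g).
    { intros g Hg. eapply Rle_trans; [|apply (IHn g Hg 0%nat); lia].
      apply ints_ge_0; auto; [|intros; apply pow2_ge_0].
      simpl; auto with smooth. }
    pose proof (P f Hf). pose proof (P (ds s f) (Cinf1_ds _ _ H Hf)).
    destruct (Nat.eq_dec j (S n)) as [->|Hn].
    + rewrite Nat.iter_succ_r.
      specialize (IHn (ds s f) (Cinf1_ds _ _ H Hf) n (le_n n)). lra.
    + specialize (IHn f Hf j ltac:(lia)). lra.
Qed.

Lemma energy_pos n s f x0 : arclength s -> Cinf1 f -> f x0 <> 0 -> 0 < energy n s f.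
Proof.
  intros H Hf H0. eapply Rlt_le_trans; [|apply (energy_ge n s f H Hf 0%nat); lia].
  simpl. apply (ints_pos s _ x0); auto with smooth.
  - intros x; pose proof (pow2_ge_0 (f x)); simpl in *; auto.
  - pose proof (pow2_gt_0 _ H0); simpl in *; auto.
Qed.

Lemma energy_ge_0 n s f : arclength s -> Cinf1 f -> 0 <= energy n s f.
Proof.
  intros H Hf. eapply Rle_trans; [|apply (energy_ge n s f H Hf 0%nat); lia].
  apply ints_ge_0; auto; [|intros; apply pow2_ge_0]. simpl; auto with smooth.
Qed.

(** * Inversion of [Q] *)

Definition Qinv (s g : R -> R) : R -> R := Tinv (-1) s (Tinv 1 s g).

Lemma sfam_Qinv S G : arclength_family S -> smooth_family G -> smooth_family (fun t => Qinv (S t) (G t)).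
Proof.
  intros H HG. apply (sfam_Tinv (-1) S (fun t => Tinv 1 (S t) (G t))); auto; try lra.
  apply sfam_Tinv; auto; lra.
Qed.

Lemma Cinf1_Qinv s g : arclength s -> Cinf1 g -> Cinf1 (Qinv s g).
Proof.
  intros; apply (sfam_Cinf1 (fun _ => Qinv s g) 0), (sfam_Qinv (fun _ => s) (fun _ => g));
    auto using Cinf1_sfam, arclength_const_family.
Qed.

Lemma sfam_iter_Qinv S F n :
  arclength_family S -> smooth_family F -> smooth_family (fun t => Nat.iter n (Qinv (S t)) (F t)).
Proof. intros A HF; induction n; simpl; auto using sfam_Qinv. Qed.

Lemma Cinf1_iter_Qinv s g n :
  arclength s -> Cinf1 g -> Cinf1 (Nat.iter n (Qinv s) g).
Proof. intros A HF; induction n; simpl; auto using Cinf1_Qinv. Qed.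

Lemma Cinf1_Tinv e s g : e <> 0 -> arclength s -> Cinf1 g -> Cinf1 (Tinv e s g).
Proof.
  intros; apply (sfam_Cinf1 (fun _ => Tinv e s g) 0),
    (sfam_Tinv e (fun _ => s) (fun _ => g));
    auto using Cinf1_sfam, arclength_const_family.
Qed.

Lemma T_Tinv_const e s g : e * e = 1 -> arclength s -> Cinf1 g ->
  T e s (Tinv e s g) = g.
Proof.
  intros He Hs Hg; apply functional_extensionality; intros x.
  apply (T_Tinv e (fun _ => s) (fun _ => g) 0);
    auto using Cinf1_sfam, arclength_const_family.
Qed.

Lemma Q_T s f : arclength s -> Cinf1 f -> Q s f = T 1 s (T (-1) s f).
Proof.
  intros H Hf; apply functional_extensionality; intros x. unfold T.
  rewrite ds_plus, ds_scal by auto with smooth. unfold Q. ring.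
Qed.

Lemma Q_Qinv s g : arclength s -> Cinf1 g -> Q s (Qinv s g) = g.
Proof.
  intros H Hg. rewrite Q_T by (auto using Cinf1_Qinv). unfold Qinv.
  rewrite T_Tinv_const; try lra; auto.
  - apply T_Tinv_const; auto; lra.
  - apply Cinf1_Tinv; auto; lra.
Qed.

Lemma iter_Q_Qinv s g n : arclength s -> Cinf1 g ->
  Nat.iter n (Q s) (Nat.iter n (Qinv s) g) = g.
Proof.
  intros H; revert g; induction n; intros g Hg; auto.
  rewrite Nat.iter_succ_r. simpl. rewrite Q_Qinv; auto using Cinf1_iter_Qinv.
Qed.

(** * Pointwise Leibniz estimate for jets *)

Lemma sum_f_R0_ge_0 u n : (forall i, 0 <= u i) -> 0 <= sum_f_R0 u n.
Proof. intros H; induction n; simpl; auto. specialize (H (S n)); lra. Qed.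

Lemma sum_f_R0_le u v n : (forall i, (i <= n)%nat -> u i <= v i) ->
  sum_f_R0 u n <= sum_f_R0 v n.
Proof. intros H; apply sum_Rle; auto. Qed.

Lemma sum_f_R0_le_mono u m n : (forall i, 0 <= u i) -> (m <= n)%nat ->
  sum_f_R0 u m <= sum_f_R0 u n.
Proof.
  intros H Hmn; induction Hmn; [lra|]. simpl. specialize (H (S m0)); lra.
Qed.

Lemma sum_f_R0_term_le u n i : (forall i, 0 <= u i) -> (i <= n)%nat ->
  u i <= sum_f_R0 u n.
Proof.
  intros H Hi. eapply Rle_trans; [|apply (sum_f_R0_le_mono u i n H Hi)].
  destruct i; simpl; [lra|]. pose proof (sum_f_R0_ge_0 u i H); lra.
Qed.

Lemma iter_ds_plus s f g n : arclength s -> Cinf1 f -> Cinf1 g ->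
  Nat.iter n (ds s) (fun x => f x + g x) =
  fun x => Nat.iter n (ds s) f x + Nat.iter n (ds s) g x.
Proof.
  intros H Hf Hg; induction n; simpl; auto.
  rewrite IHn, ds_plus; auto with smooth.
Qed.

Lemma iter_ds_scal s a f n :
  Nat.iter n (ds s) (fun x => a * f x) = fun x => a * Nat.iter n (ds s) f x.
Proof. induction n; simpl; auto. rewrite IHn, ds_scal; auto. Qed.

Definition jet (n : nat) (s f : R -> R) (x : R) : R :=
  sum_f_R0 (fun i => Nat.iter i (ds s) f x ^ 2) n.

Lemma jet_ge_0 n s f x : 0 <= jet n s f x.
Proof. apply sum_f_R0_ge_0; intros; apply pow2_ge_0. Qed.

Lemma jet_mono m n s f x : (m <= n)%nat -> jet m s f x <= jet n s f x.
Proof. apply sum_f_R0_le_mono; intros; apply pow2_ge_0. Qed.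

Lemma jet_ds n s f x : jet n s (ds s f) x <= jet (S n) s f x.
Proof.
  induction n.
  - unfold jet; simpl. pose proof (pow2_ge_0 (f x)); simpl in *; lra.
  - unfold jet in *. rewrite tech5, (tech5 _ (S n)).
    rewrite (Nat.iter_succ_r (S n)). lra.
Qed.

(** Instead of binomial coefficients, one derivative is split off as D^n(f' g) + D^n(f g'). The
    inequality (u + v)^2 <= 2 u^2 + 2 v^2, applied to two terms with the same bound, costs a factor
    4 at each order. *)
Lemma iter_ds_mult_le n s f g x : arclength s -> Cinf1 f -> Cinf1 g ->
  Nat.iter n (ds s) (fun x => f x * g x) x ^ 2 <= 4 ^ n * (jet n s f x * jet n s g x).
Proof.
  intros H; revert f g; induction n; intros f g Hf Hg.
  - unfold jet; simpl. right; ring.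
  - rewrite Nat.iter_succ_r, ds_mult, iter_ds_plus by auto with smooth.
    cbv beta. pose proof (IHn (ds s f) g (Cinf1_ds _ _ H Hf) Hg) as A.
    pose proof (IHn f (ds s g) Hf (Cinf1_ds _ _ H Hg)) as B.
    set (u := Nat.iter n (ds s) (fun x => ds s f x * g x) x) in *.
    set (v := Nat.iter n (ds s) (fun x => f x * ds s g x) x) in *.
    assert (U : jet n s (ds s f) x * jet n s g x <= jet (S n) s f x * jet (S n) s g x)
      by (apply Rmult_le_compat; auto using jet_ge_0, jet_ds, jet_mono).
    assert (V : jet n s f x * jet n s (ds s g) x <= jet (S n) s f x * jet (S n) s g x)
      by (apply Rmult_le_compat; auto using jet_ge_0, jet_ds, jet_mono).
    pose proof (pow_le 4 n ltac:(lra)) as P.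
    pose proof (pow2_ge_0 (u - v)) as W.
    pose proof (Rmult_le_compat_l _ _ _ P U).
    pose proof (Rmult_le_compat_l _ _ _ P V).
    replace ((u + v) ^ 2) with (2 * u ^ 2 + 2 * v ^ 2 - (u - v) ^ 2) by ring.
    change (4 ^ S n) with (4 * 4 ^ n). rewrite Rmult_assoc. lra.
Qed.

Lemma ints_jet_le n s f : arclength s -> Cinf1 f ->
  ints s (jet n s f) <= INR (S n) * energy n s f.
Proof.
  intros H Hf.
  (* Each of the m + 1 squares integrates to at most the energy. Smoothness of the partial jet is
     carried along because [ints_plus] requires it. *)
  assert (E : forall m, Cinf1 (jet m s f) /\ ((m <= n)%nat ->
    ints s (jet m s f) <= INR (S m) * energy n s f)).
  { assert (P : forall i, Cinf1 (fun x => Nat.iter i (ds s) f x ^ 2)).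
    { auto with smooth. }
    induction m.
    - split; [apply (P 0%nat)|]. intros Hm.
      pose proof (energy_ge n s f H Hf 0%nat Hm) as A. simpl INR.
      rewrite Rmult_1_l. exact A.
    - destruct IHm as [A B]. split; [apply (Cinf1_plus _ _ A (P (S m)))|].
      intros Hm. specialize (B ltac:(lia)).
      pose proof (energy_ge n s f H Hf (S m) Hm) as C.
      change (ints s (fun x => jet m s f x + Nat.iter (S m) (ds s) f x ^ 2)
        <= INR (S (S m)) * energy n s f).
      rewrite (ints_plus s (jet m s f) _ H A (P (S m))), (S_INR (S m)). lra. }
  apply (E n); auto.
Qed.

Lemma Cinf1_jet n s f : arclength s -> Cinf1 f -> Cinf1 (jet n s f).
Proof.
  intros H Hf.
  assert (P : forall i, Cinf1 (fun x => Nat.iter i (ds s) f x ^ 2)).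
  { auto with smooth. }
  unfold jet. induction n; [apply (P 0%nat)|].
  apply (Cinf1_plus _ _ IHn (P (S n))).
Qed.

(** * Uniform bounds on arclength derivatives by integrals *)

Lemma ds_has_zero s g : Cinf1 g -> exists x, 0 <= x <= 2 * PI /\ ds s g x = 0.
Proof.
  intros Hg. pose proof PI_RGT_0.
  destruct (MVT_gen g 0 (2 * PI) (Derive g)) as (c & Hc & E).
  - intros x _. apply Derive_correct, Cinf1_ex_derive; auto.
  - intros x _. apply continuity_pt_filterlim, Cinf1_cont; auto.
  - rewrite Rmin_left, Rmax_right in Hc by lra.
    exists c; split; auto. destruct Hg as [_ Hg].
    specialize (Hg 0). rewrite Rplus_0_l in Hg. rewrite Hg in E.
    unfold ds. replace (Derive g c) with 0 by nra. ring.
Qed.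

(** The increment is the integral of D_s f ds from y to x, and |r| <= 1 + r^2. As the majorant is
    nonnegative, its integral may be enlarged to the whole circle. *)
Lemma oscillation_le s f x y : arclength s -> Cinf1 f ->
  0 <= y -> y <= x -> x <= 2 * PI ->
  Rabs (f x - f y) <= ints s (fun z => 1 + ds s f z ^ 2).
Proof.
  intros H Hf Hy Hyx Hx. pose proof H as [Hs Hp].
  set (w := fun z => (1 + ds s f z ^ 2) * s z).
  assert (Hw : Cinf1 (fun z => 1 + ds s f z ^ 2)) by auto with smooth.
  assert (E : forall a b, ex_RInt w a b) by (apply ints_ex; auto).
  assert (ED : forall a b, ex_RInt (Derive f) a b).
  { intros; apply @ex_RInt_continuous; intros; apply Cinf1_cont, Cinf1_Derive; auto. }
  assert (W0 : forall z, 0 <= w z).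
  { intros z; unfold w. specialize (Hp z). pose proof (pow2_ge_0 (ds s f z)). nra. }
  assert (Hle : forall z, Derive f z <= w z /\ - Derive f z <= w z).
  { intros z. replace (Derive f z) with (ds s f z * s z).
    - unfold w. specialize (Hp z). generalize (ds s f z); intros r.
      assert (r <= 1 + r ^ 2) by nra. assert (- r <= 1 + r ^ 2) by nra.
      rewrite Ropp_mult_distr_l.
      split; apply Rmult_le_compat_r; lra.
    - unfold ds. specialize (Hp z). field; lra. }
  rewrite <- (RInt_Derive f y x).
  - assert (A : RInt (Derive f) y x <= RInt w y x)
      by (apply RInt_le; auto; intros; apply Hle).
    assert (B : - RInt (Derive f) y x <= RInt w y x).
    { rewrite <- (RInt_opp (V := R_CompleteNormedModule)) by auto.
      apply RInt_le; auto.
      - apply @ex_RInt_opp; auto.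
      - intros; apply Hle. }
    change (ints s (fun z => 1 + ds s f z ^ 2)) with (RInt w 0 (2 * PI)).
    rewrite <- (RInt_Chasles (V := R_CompleteNormedModule) w 0 y (2 * PI)) by auto.
    rewrite <- (RInt_Chasles (V := R_CompleteNormedModule) w y x (2 * PI)) by auto.
    pose proof (RInt_ge_0 w 0 y Hy (E _ _) (fun z _ => W0 z)).
    pose proof (RInt_ge_0 w x (2 * PI) Hx (E _ _) (fun z _ => W0 z)).
    unfold plus; simpl. apply Rabs_le. lra.
  - intros; apply Cinf1_ex_derive; auto.
  - intros; apply Cinf1_cont, Cinf1_Derive; auto.
Qed.

(** Periodicity moves x into the period that contains a zero of [ds s g]; the value at x is then an
    oscillation, from the zero forwards or backwards. *)
Lemma ds_sup_le s g x : arclength s -> Cinf1 g ->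
  Rabs (ds s g x) <= ints s (fun z => 1 + ds s (ds s g) z ^ 2).
Proof.
  intros H Hg. pose proof (Cinf1_ds _ _ H Hg) as Hd.
  destruct (circle_representative x) as [z Hz].
  rewrite <- (periodic_IZR (ds s g) z x (proj2 Hd)).
  set (y := x + IZR z * (2 * PI)) in *. clearbody y.
  destruct (ds_has_zero s g Hg) as (y0 & Hy0 & E).
  destruct (Rle_dec y0 y).
  - pose proof (oscillation_le s (ds s g) y y0 H Hd ltac:(lra) r ltac:(lra)) as A.
    rewrite E, Rminus_0_r in A; auto.
  - pose proof (oscillation_le s (ds s g) y0 y H Hd ltac:(lra) ltac:(lra) ltac:(lra)) as A.
    rewrite E, Rminus_0_l, Rabs_Ropp in A; auto.
Qed.

(** Bounds the arclength derivatives of order at most [l] of the unit tangent: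
    each of them is the derivative of a periodic function, hence has zeros. *)
Definition frame_bound (l : nat) (s c1 c2 : R -> R) : R :=
  1 + sum_f_R0 (fun m =>
        ints s (fun x => 1 + Nat.iter (S (S m)) (ds s) c1 x ^ 2) +
        ints s (fun x => 1 + Nat.iter (S (S m)) (ds s) c2 x ^ 2)) l.

(** The m-th derivative of a component of the tangent is D_s^(m+1) of a coordinate of c, and its
    maximum is controlled by an integral of D_s^(m+2): hence the index [S (S m)]. The l + 1 squares
    in the jet account for [INR (S l)]. *)
Lemma frame_bound_spec l s c1 c2 x : arclength s -> Cinf1 c1 -> Cinf1 c2 ->
  1 <= frame_bound l s c1 c2 /\
  jet l s (ds s c1) x <= INR (S l) * frame_bound l s c1 c2 ^ 2 /\
  jet l s (ds s c2) x <= INR (S l) * frame_bound l s c1 c2 ^ 2.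
Proof.
  intros H H1 H2.
  set (u := fun m => ints s (fun x => 1 + Nat.iter (S (S m)) (ds s) c1 x ^ 2) +
        ints s (fun x => 1 + Nat.iter (S (S m)) (ds s) c2 x ^ 2)).
  assert (P : forall c m, Cinf1 c ->
    0 <= ints s (fun x => 1 + Nat.iter (S (S m)) (ds s) c x ^ 2)).
  { intros c m Hc. apply ints_ge_0; [auto | |].
    - auto with smooth.
    - intros y. pose proof (pow2_ge_0 (Nat.iter (S (S m)) (ds s) c y)). lra. }
  assert (U : forall m, 0 <= u m).
  { intros m. pose proof (P c1 m H1). pose proof (P c2 m H2). unfold u; lra. }
  assert (F : frame_bound l s c1 c2 = 1 + sum_f_R0 u l) by reflexivity.
  assert (G : forall c, Cinf1 c ->
    (forall m, ints s (fun x => 1 + Nat.iter (S (S m)) (ds s) c x ^ 2) <= u m) ->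
    jet l s (ds s c) x <= INR (S l) * frame_bound l s c1 c2 ^ 2).
  { intros c Hc Hu. rewrite Rmult_comm, <- sum_cte.
    apply sum_f_R0_le. intros m Hm. rewrite <- Nat.iter_succ_r.
    apply pow_maj_Rabs. rewrite F.
    pose proof (ds_sup_le s (Nat.iter m (ds s) c) x H (Cinf1_iter_ds _ _ _ H Hc)) as A.
    pose proof (sum_f_R0_term_le u l m U Hm). specialize (Hu m).
    simpl in *. lra. }
  conjs.
  - rewrite F. pose proof (sum_f_R0_ge_0 u l U). lra.
  - apply G; auto. intros m. pose proof (P c2 m H2). unfold u; lra.
  - apply G; auto. intros m. pose proof (P c1 m H1). unfold u; lra.
Qed.

Lemma sfam_sum (F : nat -> R -> R -> R) n : (forall i, smooth_family (F i)) ->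
  smooth_family (fun t x => sum_f_R0 (fun i => F i t x) n).
Proof.
  intros H; induction n; simpl; auto.
  apply (sfam_plus (fun t x => sum_f_R0 (fun i => F i t x) n) (F (S n))); auto.
Qed.

Lemma sfam_frame_bound l S C1 C2 :
  arclength_family S -> smooth_family C1 -> smooth_family C2 ->
  smooth_family (fun t _ => frame_bound l (S t) (C1 t) (C2 t)).
Proof.
  intros H H1 H2.
  assert (E : forall C m, smooth_family C -> smooth_family (fun t _ =>
    ints (S t) (fun x => 1 + Nat.iter m (ds (S t)) (C t) x ^ 2))).
  { intros C m HC.
    apply (sfam_ints S (fun t x => 1 + Nat.iter m (ds (S t)) (C t) x ^ 2)); auto.
    apply (sfam_plus (fun _ _ => 1) (fun t x => Nat.iter m (ds (S t)) (C t) x ^ 2)).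
    - apply sfam_const.
    - pose proof (sfam_iter_ds S C m H HC).
      apply (sfam_mult _ (fun t x => Nat.iter m (ds (S t)) (C t) x * 1)); auto.
      apply (sfam_mult _ (fun _ _ => 1)); auto. apply sfam_const. }
  apply (sfam_plus (fun _ _ => 1)); [apply sfam_const|].
  apply (sfam_sum (fun m t _ =>
    ints (S t) (fun x => 1 + Nat.iter (Datatypes.S (Datatypes.S m)) (ds (S t)) (C1 t) x ^ 2) +
    ints (S t) (fun x => 1 + Nat.iter (Datatypes.S (Datatypes.S m)) (ds (S t)) (C2 t) x ^ 2))).
  intros m. apply sfam_plus; apply E; auto.
Qed.

(** * Reparametrization *)

(** The chain rule for psi o phi = id keeps phi' away from 0, so by the intermediate value theorem
    its sign is constant. The sign equals the degree of the circle map. *)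
Lemma Diff_sign phi : Diff phi -> exists e,
  (e = 1 \/ e = -1) /\ (forall x, 0 < e * Derive phi x) /\
  forall x, phi (x + 2 * PI) = phi x + e * (2 * PI).
Proof.
  intros ((Hs & d & Hd) & psi & (Hs' & d' & Hd') & Hpp & Hqq).
  pose proof PI_RGT_0 as HPI.
  assert (D1 : forall x, ex_derive phi x) by (apply smooth_ex_derive; auto).
  assert (D2 : forall x, ex_derive psi x) by (apply smooth_ex_derive; auto).
  assert (N : forall x, Derive phi x <> 0).
  { intros x E.
    assert (K : Derive (fun y => psi (phi y)) x = 1).
    { rewrite (Derive_ext _ (fun y => y)) by auto. apply Derive_id. }
    rewrite Derive_comp in K by auto. rewrite E in K. lra. }
  assert (Cont : continuity (Derive phi)).
  { intros x. apply continuity_pt_filterlim, @ex_derive_continuous.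
    apply (smooth_ex_derive (Derive phi)), smooth_Derive; auto. }
  assert (Sg : forall x, 0 < Derive phi 0 * Derive phi x).
  { intros x. pose proof (N 0); pose proof (N x).
    destruct (Rlt_le_dec 0 (Derive phi 0 * Derive phi x)) as [|K]; auto.
    exfalso. destruct (IVT_gen (Derive phi) 0 x 0 Cont) as (z & _ & Hz).
    - unfold Rmin, Rmax. destruct Rle_dec; split; nra.
    - apply (N z Hz). }
  assert (Per : forall y z, psi (y + IZR z * (2 * PI)) = psi y + IZR d' * (IZR z * (2 * PI))).
  { intros y z.
    assert (K : periodic (fun y => psi y - IZR d' * y)).
    { intros u. rewrite Hd'. ring. }
    pose proof (periodic_IZR _ z y K) as K'. simpl in K'. lra. }
  (* Following psi o phi = id over one period multiplies the degrees. *)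
  assert (Hdd : (d' * d = 1)%Z).
  { apply eq_IZR. rewrite mult_IZR.
    pose proof (Hqq (0 + 2 * PI)) as K. rewrite Hd, Per, Hqq in K.
    apply Rmult_eq_reg_r with (2 * PI); lra. }
  assert (Ed : d = 1%Z \/ d = (-1)%Z).
  { destruct (Z.mul_eq_1 d' d Hdd) as [-> | ->]; lia. }
  (* By the mean value theorem over a period, the degree is a value of phi'. *)
  assert (Sd : 0 < IZR d * Derive phi 0).
  { destruct (MVT_gen phi 0 (2 * PI) (Derive phi)) as (c & _ & E).
    - intros x _. apply Derive_correct; auto.
    - intros x _. apply continuity_pt_filterlim.
      apply (ex_derive_continuous phi x); auto.
    - specialize (Hd 0). rewrite Rplus_0_l in Hd. rewrite Hd in E.
      assert (K : IZR d = Derive phi c).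
      { apply Rmult_eq_reg_r with (2 * PI); lra. }
      rewrite K, Rmult_comm. apply Sg. }
  exists (IZR d). conjs; auto.
  - destruct Ed as [-> | ->]; auto.
  - intros x. specialize (Sg x). destruct Ed as [-> | ->]; nra.
Qed.

Section Reparam.
Variables (phi s : R -> R) (e : R).
Hypothesis He : e = 1 \/ e = -1.
Hypothesis Hphi : smooth phi.
Hypothesis Hpos : forall x, 0 < e * Derive phi x.
Hypothesis Hper : forall x, phi (x + 2 * PI) = phi x + e * (2 * PI).
Hypothesis Hs : arclength s.

(** As [e * Derive phi x] is |phi'(x)|, this is the speed of the reparametrized curve. *)
Let s' x := e * Derive phi x * s (phi x).

Lemma ds_reparam f : Cinf1 f ->
  ds s' (fun x => f (phi x)) = fun x => e * ds s f (phi x).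
Proof.
  intros Hf; apply functional_extensionality; intros x. unfold ds, s'.
  rewrite (Derive_comp f phi) by (exact (smooth_ex_derive phi Hphi x) || exact (Cinf1_ex_derive f Hf (phi x))).
  pose proof (Hpos x) as Hx. destruct Hs as [_ Hs']. specialize (Hs' (phi x)).
  assert (Derive phi x <> 0) by (intros K; rewrite K in Hx; lra).
  destruct He as [-> | ->]; field; split; lra.
Qed.

Lemma iter_ds_reparam f n : Cinf1 f ->
  Nat.iter n (ds s') (fun x => f (phi x)) =
  fun x => e ^ n * Nat.iter n (ds s) f (phi x).
Proof.
  intros Hf; induction n.
  - apply functional_extensionality; intros x; simpl; ring.
  - simpl. rewrite IHn, ds_scal, (ds_reparam (Nat.iter n (ds s) f)) by auto with smooth.
    apply functional_extensionality; intros x; ring.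
Qed.

(** D_s picks up the sign e, but enters [Q] only through its square. *)
Lemma Q_reparam f : Cinf1 f -> Q s' (fun x => f (phi x)) = fun x => Q s f (phi x).
Proof.
  intros Hf. unfold Q. rewrite ds_reparam, ds_scal, ds_reparam by auto with smooth.
  apply functional_extensionality; intros x. destruct He as [-> | ->]; ring.
Qed.

Lemma iter_Q_reparam f n : Cinf1 f ->
  Nat.iter n (Q s') (fun x => f (phi x)) = fun x => Nat.iter n (Q s) f (phi x).
Proof.
  intros Hf; induction n; simpl; auto.
  rewrite IHn, (Q_reparam (Nat.iter n (Q s) f)); auto with smooth.
Qed.

(** For e = -1 the image of a period is traversed backwards; the sign from exchanging the limits
    cancels e. *)
Lemma ints_reparam f : Cinf1 f -> ints s' (fun x => f (phi x)) = ints s f.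
Proof.
  intros Hf. unfold ints.
  set (w := fun x => f x * s x).
  assert (Hw : Cinf1 w) by (destruct Hs; apply Cinf1_mult; auto).
  assert (Ew : forall a b, ex_RInt w a b)
    by (intros; apply @ex_RInt_continuous; intros; apply Cinf1_cont; auto).
  transitivity (RInt (fun x => scal e (scal (Derive phi x) (w (phi x)))) 0 (2 * PI)).
  { apply RInt_ext. intros x _. unfold s', w, scal; simpl; unfold mult; simpl. ring. }
  assert (C : forall x, continuous w (phi x)) by (intros; apply Cinf1_cont; auto).
  assert (D : forall x, is_derive phi x (Derive phi x) /\ continuous (Derive phi) x).
  { intros x; split.
    - apply Derive_correct, smooth_ex_derive; auto.
    - apply @ex_derive_continuous, (smooth_ex_derive (Derive phi)), smooth_Derive; auto. }
  assert (I : is_RInt (fun x => scal (Derive phi x) (w (phi x))) 0 (2 * PI)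
    (RInt w (phi 0) (phi (2 * PI)))) by (apply (is_RInt_comp w phi); auto).
  rewrite (RInt_scal (V := R_CompleteNormedModule)) by (eexists; apply I).
  rewrite (is_RInt_unique _ _ _ _ I).
  pose proof (Hper 0) as Hp. rewrite Rplus_0_l in Hp. rewrite Hp.
  unfold scal; simpl; unfold mult; simpl.
  destruct He as [E | E]; rewrite E.
  - rewrite !Rmult_1_l. apply RInt_any_period; [apply Cinf1_cont; auto | apply Hw].
  - rewrite <- (opp_RInt_swap (V := R_CompleteNormedModule)) by auto.
    unfold opp; simpl.
    rewrite <- (RInt_any_period w (phi 0 + -1 * (2 * PI)));
      [|apply Cinf1_cont; auto | apply Hw].
    replace (phi 0 + -1 * (2 * PI) + 2 * PI) with (phi 0) by ring. ring.
Qed.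

Lemma frame_bound_reparam l c1 c2 : Cinf1 c1 -> Cinf1 c2 ->
  frame_bound l s' (fun x => c1 (phi x)) (fun x => c2 (phi x)) =
  frame_bound l s c1 c2.
Proof.
  intros H1 H2.
  assert (E : forall c m, Cinf1 c ->
    ints s' (fun x => 1 + Nat.iter m (ds s') (fun x => c (phi x)) x ^ 2) =
    ints s (fun x => 1 + Nat.iter m (ds s) c x ^ 2)).
  { intros c m Hc. rewrite iter_ds_reparam by auto.
    rewrite <- (ints_reparam (fun x => 1 + Nat.iter m (ds s) c x ^ 2))
      by auto with smooth.
    apply ints_ext. intros x. rewrite Rpow_mult_distr, <- pow_mult, Nat.mul_comm, pow_mult.
    replace (e ^ 2) with 1 by (destruct He as [-> | ->]; ring).
    rewrite pow1. ring. }
  unfold frame_bound. f_equal. apply sum_eq. intros m _. rewrite !E; auto.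
Qed.
End Reparam.

(** * Trigonometric functions and integration by parts over a period *)

(** A coinduction principle: a class of differentiable functions stable under [Derive] contains all
    iterated derivatives of its members. It serves for the families a x + b and a cos + b sin. *)
Lemma smooth_closed_class (P : (R -> R) -> Prop) f :
  (forall g, P g -> (forall x, ex_derive g x) /\ P (Derive g)) -> P f -> smooth f.
Proof.
  intros H Hf.
  assert (E : forall n, P (Derive_n f n)).
  { induction n; [exact Hf|]. apply (H _ IHn). }
  intros [|n] x; simpl; auto. apply H, E.
Qed.

Lemma smooth_id : smooth (fun x => x).
Proof.
  apply (smooth_closed_class (fun g => exists a b, g = fun x => a * x + b)).
  - intros g (a & b & ->).
    assert (K : forall x, is_derive (fun x => a * x + b) x a)
      by (intros; auto_derive; auto; ring).
    split; [intros x; eexists; apply K|].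
    exists 0, a. apply functional_extensionality; intros x.
    rewrite Rmult_0_l, Rplus_0_l. apply is_derive_unique, K.
  - exists 1, 0. apply functional_extensionality; intros x; ring.
Qed.

Lemma is_derive_trig a b w x :
  is_derive (fun x => a * cos (w * x) + b * sin (w * x)) x
    (b * w * cos (w * x) + - a * w * sin (w * x)).
Proof. auto_derive; auto. ring. Qed.

Lemma smooth_trig a b w : smooth (fun x => a * cos (w * x) + b * sin (w * x)).
Proof.
  apply (smooth_closed_class
    (fun f => exists a b, f = fun x => a * cos (w * x) + b * sin (w * x)));
    [|exists a, b; auto].
  intros g (a' & b' & ->). split.
  - intros x; eexists; apply is_derive_trig.
  - exists (b' * w), (- a' * w). apply functional_extensionality; intros x.
    apply is_derive_unique, is_derive_trig.
Qed.

Lemma smooth_cos w : smooth (fun x => cos (w * x)).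
Proof.
  replace (fun x => cos (w * x)) with (fun x => 1 * cos (w * x) + 0 * sin (w * x)).
  - apply smooth_trig.
  - apply functional_extensionality; intros; ring.
Qed.

Lemma smooth_sin w : smooth (fun x => sin (w * x)).
Proof.
  replace (fun x => sin (w * x)) with (fun x => 0 * cos (w * x) + 1 * sin (w * x)).
  - apply smooth_trig.
  - apply functional_extensionality; intros; ring.
Qed.

Lemma periodic_trig (f : R -> R) k : periodic f -> periodic (fun x => f (IZR k * x)).
Proof.
  intros H x. rewrite Rmult_plus_distr_l. apply periodic_IZR; auto.
Qed.

Lemma Cinf1_cos k : Cinf1 (fun x => cos (IZR k * x)).
Proof.
  split; [apply smooth_cos | apply periodic_trig].
  intros x. rewrite cos_plus, cos_2PI, sin_2PI. ring.
Qed.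

Lemma Cinf1_sin k : Cinf1 (fun x => sin (IZR k * x)).
Proof.
  split; [apply smooth_sin | apply periodic_trig].
  intros x. rewrite sin_plus, cos_2PI, sin_2PI. ring.
Qed.

Lemma Cinf1_ex_RInt f a b : Cinf1 f -> ex_RInt f a b.
Proof. intros H; apply @ex_RInt_continuous; intros; apply Cinf1_cont; auto. Qed.

Lemma RInt_Derive_periodic f a : Cinf1 f -> RInt (Derive f) a (a + 2 * PI) = 0.
Proof.
  intros Hf. rewrite RInt_Derive.
  - destruct Hf as [_ Hf]. specialize (Hf a). lra.
  - intros; apply Cinf1_ex_derive; auto.
  - intros; apply Cinf1_cont, Cinf1_Derive; auto.
Qed.

Lemma RInt_ibp_periodic f g : Cinf1 f -> Cinf1 g ->
  RInt (fun x => Derive f x * g x) 0 (2 * PI) =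
  - RInt (fun x => f x * Derive g x) 0 (2 * PI).
Proof.
  intros Hf Hg. pose proof (Cinf1_Derive _ Hf). pose proof (Cinf1_Derive _ Hg).
  pose proof (RInt_Derive_periodic (fun x => f x * g x) 0 ltac:(auto with smooth)) as E.
  rewrite Rplus_0_l in E.
  rewrite (RInt_ext _ (fun x => plus (Derive f x * g x) (f x * Derive g x))) in E.
  - rewrite (RInt_plus (V := R_CompleteNormedModule) (fun x => Derive f x * g x)) in E;
      [|apply (Cinf1_ex_RInt (fun x => Derive f x * g x)); auto with smooth
       |apply (Cinf1_ex_RInt (fun x => f x * Derive g x)); auto with smooth].
    unfold plus in E; simpl in E. lra.
  - intros x _. rewrite Derive_mult by (apply Cinf1_ex_derive; auto). reflexivity.
Qed.

(** * Hadamard quotients *)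

Lemma jointly_C_comp n f F : smooth f -> jointly_C n F -> jointly_C n (fun t x => f (F t x)).
Proof.
  revert f F; induction n; intros f F Hf HF; split; auto;
    try (intros; apply continuity_1d_2d_pt_comp; eauto using jointly_C_cont;
         apply continuity_pt_filterlim, (ex_derive_continuous f), smooth_ex_derive; auto).
  pose proof (IHn (Derive f) F (smooth_Derive _ Hf) (jointly_C_mono _ _ HF)) as HI.
  destruct HF as (_ & Ft & Fx & A & B & C & D).
  exists (fun t x => Ft t x * Derive f (F t x)), (fun t x => Fx t x * Derive f (F t x));
    conjs; try (apply jointly_C_mult; auto).
  - intros t x. apply (is_derive_comp f (fun u => F u x)); auto.
    apply Derive_correct, smooth_ex_derive; auto.
  - intros t x. apply (is_derive_comp f (F t)); auto.
    apply Derive_correct, smooth_ex_derive; auto.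
Qed.

Lemma jointly_C_swap n F : jointly_C n F -> jointly_C n (fun t x => F x t).
Proof.
  revert F; induction n; intros F HF; split; auto;
    try (intros t x eps; destruct (jointly_C_cont _ _ HF x t eps) as [d Hd];
         exists d; intros; apply Hd; auto).
  destruct HF as (_ & Ft & Fx & A & B & C & D).
  exists (fun t x => Fx x t), (fun t x => Ft x t); conjs; auto.
Qed.

(** The quotient is h(y) = integral over t in [0, 1] of f'(t y), since y f'(t y) is the derivative
    of f(t y) in t. Its smoothness at 0 is that of a parameter integral, with the roles of the
    variables exchanged by [jointly_C_swap]. *)
Lemma hadamard f : smooth f -> exists h, smooth h /\
  (forall y, f y - f 0 = y * h y) /\ h 0 = Derive f 0.
Proof.
  intros Hf. pose proof (smooth_Derive _ Hf) as Hd.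
  set (G := fun y t => Derive f (t * y)).
  assert (HG : smooth2 G).
  { intros n. apply (jointly_C_comp n (Derive f) (fun y t => t * y)); auto.
    apply jointly_C_mult.
    - apply (smooth_smooth2 (fun t => t)), smooth_id.
    - apply (jointly_C_swap n (fun _ y => y)). apply (smooth_smooth2 (fun t => t)), smooth_id. }
  exists (fun y => RInt (G y) 0 1). conjs.
  - apply (smooth2_smooth (fun _ y => RInt (G y) 0 1) 0).
    intros n. apply (jointly_C_swap n (fun y _ => RInt (G y) 0 1)).
    apply (smooth2_at (fun y t => RInt (G y) 0 t)), smooth2_RInt; auto.
  - intros y.
    rewrite <- (RInt_scal (V := R_CompleteNormedModule)) by
      (apply smooth2_ex_RInt; auto).
    assert (E : is_RInt (fun t => scal y (G y t)) 0 1 (minus (f (y * 1)) (f (y * 0)))).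
    { apply (is_RInt_derive (fun t => f (y * t))).
      - intros t _. unfold G. rewrite (Rmult_comm t y).
        apply (is_derive_comp f (fun t => y * t)).
        + apply Derive_correct, smooth_ex_derive; auto.
        + auto_derive; auto; ring.
      - intros t _. apply (continuous_scal_r y (G y)), smooth2_cont_x; auto. }
    rewrite Rmult_1_r, Rmult_0_r in E. symmetry. apply (is_RInt_unique _ _ _ _ E).
  - rewrite (RInt_ext _ (fun _ => Derive f 0)).
    + rewrite RInt_const. unfold scal; simpl; unfold mult; simpl. ring.
    + intros t _. unfold G. rewrite Rmult_0_r; auto.
Qed.

(** * Fourier inversion *)

(** A quantitative Riemann-Lebesgue lemma, by one integration by parts against -cos(w y) / w.
    Regularity is asked on [a, b] alone because it will be applied to a quotient whose denominator
    has zeros outside [-pi, pi]. *)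
Lemma RInt_sin_decay (g : R -> R) a b : a <= b ->
  (forall x, a <= x <= b -> ex_derive g x) ->
  (forall x, a <= x <= b -> continuous (Derive g) x) ->
  exists K, forall w, 0 < w -> Rabs (RInt (fun y => g y * sin (w * y)) a b) <= K / w.
Proof.
  intros Hab D C.
  assert (Cg : forall x, a <= x <= b -> continuous g x)
    by (intros; apply @ex_derive_continuous; auto).
  assert (CI : forall u : R -> R,
    (forall x, a <= x <= b -> continuous u x) -> ex_RInt u a b).
  { intros u Hu. apply @ex_RInt_continuous. rewrite Rmin_left, Rmax_right by auto. auto. }
  assert (Ccos : forall w x, continuous (fun y => cos (w * y)) x).
  { intros; apply @ex_derive_continuous, (smooth_ex_derive (fun y => cos (w * y))).
    apply smooth_cos. }
  assert (Csin : forall w x, continuous (fun y => sin (w * y)) x).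
  { intros; apply @ex_derive_continuous, (smooth_ex_derive (fun y => sin (w * y))).
    apply smooth_sin. }
  assert (Cm : forall (u v : R -> R) x, continuous u x -> continuous v x ->
    continuous (fun y => u y * v y) x) by (intros u v x; apply (continuous_mult u v)).
  set (M := RInt (fun y => Rabs (Derive g y)) a b).
  exists (Rabs (g b) + Rabs (g a) + M). intros w Hw.
  assert (E : is_RInt (fun y => plus (- / w * (Derive g y * cos (w * y))) (g y * sin (w * y)))
    a b (minus (- / w * (g b * cos (w * b))) (- / w * (g a * cos (w * a))))).
  { apply (is_RInt_derive (fun y => - / w * (g y * cos (w * y)))).
    - rewrite Rmin_left, Rmax_right by auto. intros x Hx.
      replace (plus (- / w * (Derive g x * cos (w * x))) (g x * sin (w * x))) with
        (- / w * (Derive g x * cos (w * x) + g x * (- (w * sin (w * x)))))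
        by (unfold plus; simpl; field; lra).
      apply (is_derive_scal (fun y => g y * cos (w * y))).
      apply (is_derive_Rmult g (fun y => cos (w * y))); [apply Derive_correct; auto|].
      auto_derive; auto; ring.
    - rewrite Rmin_left, Rmax_right by auto. intros x Hx.
      apply (continuous_plus (fun y => - / w * (Derive g y * cos (w * y)))
        (fun y => g y * sin (w * y))).
      + apply (continuous_scal_r (- / w) (fun y => Derive g y * cos (w * y))).
        apply (Cm (Derive g) (fun y => cos (w * y))); auto.
      + apply (Cm g (fun y => sin (w * y))); auto. }
  apply (is_RInt_unique (V := R_CompleteNormedModule)) in E.
  assert (I1 : ex_RInt (fun y => Derive g y * cos (w * y)) a b)
    by (apply CI; intros; apply (Cm (Derive g) (fun y => cos (w * y))); auto).
  assert (I2 : ex_RInt (fun y => g y * sin (w * y)) a b)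
    by (apply CI; intros; apply (Cm g (fun y => sin (w * y))); auto).
  rewrite (RInt_plus (V := R_CompleteNormedModule)
    (fun y => - / w * (Derive g y * cos (w * y)))) in E;
    [|apply (ex_RInt_scal (V := R_NormedModule) _ _ _ (- / w) I1) | auto].
  pose proof (RInt_scal (V := R_CompleteNormedModule)
    (fun y => Derive g y * cos (w * y)) a b (- / w) I1) as E2.
  unfold plus, minus, plus, opp, scal in E, E2; simpl in E, E2.
  unfold mult in E, E2; simpl in E, E2. rewrite E2 in E.
  assert (B : Rabs (RInt (fun y => Derive g y * cos (w * y)) a b) <= M).
  { eapply Rle_trans; [apply abs_RInt_le; auto|].
    apply RInt_le; auto.
    - apply CI. intros x Hx.
      apply (continuous_comp _ Rabs); [|apply continuous_Rabs].
      apply (Cm (Derive g) (fun y => cos (w * y))); auto.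
    - apply CI. intros x Hx.
      apply (continuous_comp _ Rabs); [|apply continuous_Rabs]. auto.
    - intros x _. rewrite Rabs_mult.
      assert (Rabs (cos (w * x)) <= 1) by (apply Rabs_le, COS_bound).
      pose proof (Rabs_pos (Derive g x)). nra. }
  assert (T1 : forall x, Rabs (g x * cos (w * x)) <= Rabs (g x)).
  { intros x. rewrite Rabs_mult.
    assert (Rabs (cos (w * x)) <= 1) by (apply Rabs_le, COS_bound).
    pose proof (Rabs_pos (g x)). nra. }
  set (I := RInt (fun y => g y * sin (w * y)) a b) in *.
  set (J := RInt (fun y => Derive g y * cos (w * y)) a b) in *.
  assert (EI : I = / w * (J + g a * cos (w * a) - g b * cos (w * b))) by lra.
  rewrite EI, Rabs_mult, (Rabs_pos_eq (/ w)) by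
    (left; apply Rinv_0_lt_compat; auto).
  unfold Rdiv. rewrite Rmult_comm. apply Rmult_le_compat_r.
  - left; apply Rinv_0_lt_compat; auto.
  - pose proof (T1 a). pose proof (T1 b).
    unfold Rminus. eapply Rle_trans; [apply Rabs_triang|].
    rewrite Rabs_Ropp.
    pose proof (Rabs_triang J (g a * cos (w * a))). lra.
Qed.

(** * The Dirichlet kernel *)

Fixpoint dirichlet (N : nat) (y : R) : R :=
  match N with
  | O => 1
  | S N' => dirichlet N' y + 2 * cos (INR (S N') * y)
  end.

(** Multiplying by sin(y/2) makes the sum telescope through 2 cos A sin B = sin(A + B) - sin(A - B).
    The product form stays valid at y = 0. *)
Lemma dirichlet_closed N y :
  dirichlet N y * sin (/ 2 * y) = sin ((INR N + / 2) * y).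
Proof.
  induction N.
  - simpl. rewrite Rplus_0_l. ring.
  - change (dirichlet (S N) y) with (dirichlet N y + 2 * cos (INR (S N) * y)).
    rewrite Rmult_plus_distr_r, IHN.
    replace ((INR (S N) + / 2) * y) with (INR (S N) * y + / 2 * y) by ring.
    replace ((INR N + / 2) * y) with (INR (S N) * y - / 2 * y) by (rewrite S_INR; field).
    rewrite sin_plus, sin_minus. ring.
Qed.

Lemma Cinf1_dirichlet N : Cinf1 (dirichlet N).
Proof.
  induction N; [apply (Cinf1_const 1)|].
  apply (Cinf1_plus (dirichlet N) (fun y => 2 * cos (INR (S N) * y))); auto. apply Cinf1_mult; [apply Cinf1_const|].
  rewrite INR_IZR_INZ. apply Cinf1_cos.
Qed.

Lemma RInt_dirichlet N a : RInt (dirichlet N) a (a + 2 * PI) = 2 * PI.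
Proof.
  induction N.
  - unfold dirichlet. rewrite RInt_const. unfold scal; simpl; unfold mult; simpl. ring.
  - assert (Hn : 0 < INR (S N)) by (apply lt_0_INR; lia).
    change (dirichlet (S N)) with (fun y => plus (dirichlet N y) (2 * cos (INR (S N) * y))).
    rewrite (RInt_plus (V := R_CompleteNormedModule) (dirichlet N)).
    + rewrite IHN.
      rewrite (RInt_ext _ (Derive (fun y => 2 / INR (S N) * sin (INR (S N) * y)))).
      * rewrite RInt_Derive_periodic; [apply Rplus_0_r|].
        apply Cinf1_mult; [apply Cinf1_const|]. rewrite INR_IZR_INZ. apply Cinf1_sin.
      * intros x _. symmetry. apply is_derive_unique.
        revert Hn. generalize (INR (S N)). intros m Hm.
        auto_derive; auto. field; lra.
    + apply Cinf1_ex_RInt, Cinf1_dirichlet.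
    + apply Cinf1_ex_RInt. apply Cinf1_mult; [apply Cinf1_const|].
      rewrite INR_IZR_INZ. apply Cinf1_cos.
Qed.

Lemma sin_half_neq_0 y : - PI <= y <= PI -> y <> 0 -> sin (/ 2 * y) <> 0.
Proof.
  intros H H0. pose proof PI_RGT_0.
  destruct (Rlt_le_dec 0 y).
  - assert (0 < sin (/ 2 * y)) by (apply sin_gt_0; lra). lra.
  - assert (0 < sin (- (/ 2 * y))) by (apply sin_gt_0; lra).
    rewrite sin_neg in H2. lra.
Qed.

Lemma Cinf1_shift g a : Cinf1 g -> Cinf1 (fun y => g (y + a)).
Proof.
  intros [Sg Pg]. split.
  - apply (smooth2_smooth (fun _ y => g (y + a)) 0). intros n.
    apply (jointly_C_comp n g (fun _ y => y + a)); auto. apply jointly_C_plus; [|apply jointly_C_const].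
    apply (smooth_smooth2 (fun t => t)), smooth_id.
  - intros y. rewrite <- (Pg (y + a)). f_equal; ring.
Qed.

(** With the period centred at x, the kernel has total mass 2 pi and reproduces f(x). In the error,
    the increment of f is y h(y) and sin(y/2) is y k(y); the factors y cancel, leaving h / k against
    sin((N + 1/2) y), which decays. *)
Lemma dirichlet_convergence f x : Cinf1 f ->
  is_lim_seq (fun N => / (2 * PI) * RInt (fun y => f y * dirichlet N (y - x)) 0 (2 * PI))
    (f x).
Proof.
  intros Hf. pose proof PI_RGT_0 as HPI.
  assert (shift : forall g : R -> R, Cinf1 g ->
    RInt g 0 (2 * PI) = RInt (fun y => g (y + x)) (- PI) (- PI + 2 * PI)).
  { intros g Hg. rewrite <- (RInt_any_period g (- PI + x)); [|apply Cinf1_cont; auto | apply Hg].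
    transitivity (RInt g (1 * (- PI) + x) (1 * (- PI + 2 * PI) + x)); [f_equal; ring|].
    rewrite <- (RInt_comp_lin (V := R_CompleteNormedModule) g) by (apply Cinf1_ex_RInt; auto).
    apply RInt_ext. intros y _. change (1 * g (1 * y + x) = g (y + x)).
    rewrite !Rmult_1_l; auto. }
  set (F := fun y => f (y + x)).
  assert (HF : Cinf1 F) by (apply Cinf1_shift; auto).
  destruct (hadamard F (proj1 HF)) as (h & Sh & Eh & _).
  destruct (hadamard (fun y => sin (/ 2 * y)) (smooth_sin _)) as (k & Sk & Ek & K0).
  (* At the removable singularity y = 0 the Hadamard quotient of sin(y/2) takes the value 1/2. *)
  assert (Hk : forall y, - PI <= y <= PI -> k y <> 0).
  { intros y Hy. destruct (Req_dec y 0) as [->|Hy0].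
    - rewrite K0, (is_derive_unique _ _ (/ 2)); [lra|].
      auto_derive; auto. rewrite Rmult_0_r, cos_0; ring.
    - intros E. apply (sin_half_neq_0 y Hy Hy0). specialize (Ek y).
      rewrite E, Rmult_0_r, sin_0 in Ek. lra. }
  destruct (RInt_sin_decay (fun y => h y / k y) (- PI) PI) as [K HK]; [lra| | |].
  - intros y Hy. apply ex_derive_div; auto using smooth_ex_derive.
  - intros y Hy.
    apply (continuous_ext_loc _ (fun y => (Derive h y * k y - h y * Derive k y) / k y ^ 2)).
    + assert (Ck : continuous k y) by apply @ex_derive_continuous, smooth_ex_derive, Sk.
      assert (L : locally y (fun z => k z <> 0)).
      { apply (Ck (fun u => u <> 0)). apply open_neq. auto. }
      eapply filter_imp; [|exact L]. intros z Hz. symmetry.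
      apply Derive_div; auto using smooth_ex_derive.
    + apply @ex_derive_continuous.
      assert (forall u, smooth u -> forall z, ex_derive u z) by apply smooth_ex_derive.
      apply ex_derive_div.
      * apply @ex_derive_minus; apply ex_derive_mult; auto using smooth_Derive.
      * apply ex_derive_pow; auto.
      * apply pow_nonzero; auto.
  - assert (Err : forall N,
      / (2 * PI) * RInt (fun y => f y * dirichlet N (y - x)) 0 (2 * PI) =
      f x + / (2 * PI) * RInt (fun y => h y / k y * sin ((INR N + / 2) * y)) (- PI) PI).
    { intros N. pose proof (Cinf1_dirichlet N) as HD.
      rewrite (shift (fun y => f y * dirichlet N (y - x)));
        [|apply Cinf1_mult; auto; apply (Cinf1_shift (dirichlet N) (- x)); auto].
      rewrite (RInt_ext _ (fun y => plus (f x * dirichlet N y) ((F y - F 0) * dirichlet N y))).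
      2:{ intros y _. unfold plus; simpl. unfold F. rewrite Rplus_0_l.
          replace (y + x - x) with y by ring. ring. }
      rewrite (RInt_plus (V := R_CompleteNormedModule) (fun y => f x * dirichlet N y));
        [|apply (Cinf1_ex_RInt (fun y => f x * dirichlet N y)); auto with smooth
         |apply (Cinf1_ex_RInt (fun y => (F y - F 0) * dirichlet N y)); auto with smooth].
      rewrite (RInt_ext (fun y => f x * dirichlet N y) (fun y => scal (f x) (dirichlet N y)))
        by reflexivity.
      rewrite (RInt_scal (V := R_CompleteNormedModule) (dirichlet N))
        by (apply Cinf1_ex_RInt; auto).
      rewrite RInt_dirichlet. replace (- PI + 2 * PI) with PI by ring.
      rewrite (RInt_ext (fun y => (F y - F 0) * dirichlet N y)
        (fun y => h y / k y * sin ((INR N + / 2) * y))).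
      - unfold plus, scal; simpl; unfold mult; simpl. field; lra.
      - rewrite Rmin_left, Rmax_right by lra. intros y Hy.
        rewrite <- dirichlet_closed, Eh. specialize (Ek y).
        rewrite Rmult_0_r, sin_0, Rminus_0_r in Ek. rewrite Ek.
        specialize (Hk y ltac:(lra)).
        change (y * h y * dirichlet N y = h y / k y * (dirichlet N y * (y * k y))).
        field; auto. }
    apply (is_lim_seq_ext (fun N => f x + / (2 * PI) *
      RInt (fun y => h y / k y * sin ((INR N + / 2) * y)) (- PI) PI));
      [intros; symmetry; apply Err|].
    replace (Finite (f x)) with (Finite (f x + / (2 * PI) * 0)) by (f_equal; ring).
    apply (is_lim_seq_plus' (fun _ => f x)); [apply is_lim_seq_const|].
    apply (is_lim_seq_scal_l _ (/ (2 * PI)) 0).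
    apply is_lim_seq_abs_0.
    apply (is_lim_seq_le_le (fun _ => 0) _ (fun N => Rabs K * / (INR N + / 2))).
    + intros N. split; [apply Rabs_pos|].
      assert (0 < INR N + / 2) by (pose proof (pos_INR N); lra).
      eapply Rle_trans; [apply HK; auto|].
      apply Rmult_le_compat_r; [left; apply Rinv_0_lt_compat; auto | apply RRle_abs].
    + apply is_lim_seq_const.
    + replace (Finite 0) with (Rbar_mult (Rabs K) (Finite 0)) by (simpl; f_equal; ring).
      apply is_lim_seq_scal_l.
      replace (Finite 0) with (Rbar_inv p_infty) by reflexivity.
      apply is_lim_seq_inv; [|discriminate].
      apply (is_lim_seq_plus _ _ p_infty (/ 2)); [apply is_lim_seq_INR | apply is_lim_seq_const | reflexivity].
Qed.

(** * Symmetric partial sums and Fourier coefficients *)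

Lemma sum_symmetric_S u N : sum_symmetric u (S N) =
  Cplus (Cplus (u (- Z.of_nat (S N))%Z) (sum_symmetric u N)) (u (Z.of_nat (S N))).
Proof.
  unfold sum_symmetric. replace (2 * S N)%nat with (S (S (2 * N))) by lia.
  rewrite sum_Sn. unfold sum_n at 1. rewrite sum_Sn_m by lia.
  rewrite <- sum_n_m_S.
  change (Cplus (Cplus (u (Z.of_nat 0 - Z.of_nat (S N))%Z)
    (sum_n (fun j => u (Z.of_nat (S j) - Z.of_nat (S N))%Z) (2 * N)))
    (u (Z.of_nat (S (S (2 * N))) - Z.of_nat (S N))%Z) =
    Cplus (Cplus (u (- Z.of_nat (S N))%Z)
      (sum_n (fun j => u (Z.of_nat j - Z.of_nat N)%Z) (2 * N))) (u (Z.of_nat (S N)))).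
  f_equal; [f_equal|].
  - apply sum_n_ext. intros j. f_equal. lia.
  - f_equal. lia.
Qed.

Lemma sum_symmetric_0 u : sum_symmetric u 0 = u 0%Z.
Proof. unfold sum_symmetric. simpl. rewrite sum_O. reflexivity. Qed.

Definition series_to (u : Z -> C) (l : R) : Prop :=
  is_lim_seq (fun N => fst (sum_symmetric u N)) l /\
  is_lim_seq (fun N => snd (sum_symmetric u N)) 0.

Lemma series_to_filterlim u l : series_to u l ->
  filterlim (sum_symmetric u) eventually (locally (RtoC l)).
Proof.
  intros [A B]. apply filterlim_locally. intros eps.
  pose proof (proj1 (filterlim_locally _ _) A eps) as A'.
  pose proof (proj1 (filterlim_locally _ _) B eps) as B'.
  eapply filter_imp; [|apply (filter_and _ _ A' B')].
  intros N [H1 H2]. split; auto.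
Qed.

Lemma sum_symmetric_plus u v N :
  sum_symmetric (fun k => Cplus (u k) (v k)) N =
  Cplus (sum_symmetric u N) (sum_symmetric v N).
Proof. apply (sum_n_plus (G := C_AbelianMonoid)). Qed.

Lemma sum_symmetric_scal (a : R) u N :
  sum_symmetric (fun k => Cmult (RtoC a) (u k)) N = Cmult (RtoC a) (sum_symmetric u N).
Proof. apply (sum_n_mult_l (K := C_Ring)). Qed.

Lemma series_to_plus u v a b : series_to u a -> series_to v b ->
  series_to (fun k => Cplus (u k) (v k)) (a + b).
Proof.
  intros [A B] [C D]; split.
  - eapply is_lim_seq_ext; [|apply (is_lim_seq_plus' _ _ _ _ A C)].
    intros N. rewrite sum_symmetric_plus; reflexivity.
  - replace (Finite 0) with (Finite (0 + 0)) by (f_equal; ring).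
    eapply is_lim_seq_ext; [|apply (is_lim_seq_plus' _ _ _ _ B D)].
    intros N. rewrite sum_symmetric_plus; reflexivity.
Qed.

Lemma series_to_scal r u a : series_to u a ->
  series_to (fun k => Cmult (RtoC r) (u k)) (r * a).
Proof.
  intros [A B]; split.
  - eapply is_lim_seq_ext; [|apply (is_lim_seq_scal_l _ r _ A)].
    intros N. rewrite sum_symmetric_scal. simpl. ring.
  - replace (Finite 0) with (Rbar_mult r (Finite 0)) by (simpl; f_equal; ring).
    eapply is_lim_seq_ext; [|apply (is_lim_seq_scal_l _ r _ B)].
    intros N. rewrite sum_symmetric_scal. simpl. ring.
Qed.

Lemma series_to_ext u v a : (forall k, u k = v k) -> series_to u a -> series_to v a.
Proof.
  intros H. replace v with u; auto. apply functional_extensionality; auto.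
Qed.

(** The exponential is absorbed into the integral, which becomes a convolution with e^(-i k (y -
    x)). *)
Lemma fourier_expi f k x : Cinf1 f -> Cmult (fourier f k) (expi (IZR k * x)) =
  (/ (2 * PI) * RInt (fun y => f y * cos (IZR k * (y - x))) 0 (2 * PI),
   - / (2 * PI) * RInt (fun y => f y * sin (IZR k * (y - x))) 0 (2 * PI)).
Proof.
  intros Hf.
  assert (Hc : ex_RInt (fun y => f y * cos (IZR k * y)) 0 (2 * PI)).
  { apply (Cinf1_ex_RInt (fun y => f y * cos (IZR k * y))).
    apply Cinf1_mult; auto. apply Cinf1_cos. }
  assert (Hs : ex_RInt (fun y => f y * sin (IZR k * y)) 0 (2 * PI)).
  { apply (Cinf1_ex_RInt (fun y => f y * sin (IZR k * y))).
    apply Cinf1_mult; auto. apply Cinf1_sin. }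
  assert (L : forall a b, RInt (fun y => a * (f y * cos (IZR k * y)) +
       b * (f y * sin (IZR k * y))) 0 (2 * PI) =
      a * RInt (fun y => f y * cos (IZR k * y)) 0 (2 * PI) +
      b * RInt (fun y => f y * sin (IZR k * y)) 0 (2 * PI)).
  { intros a b. apply is_RInt_unique.
    apply (is_RInt_plus (V := R_NormedModule)
      (fun y => a * (f y * cos (IZR k * y))) (fun y => b * (f y * sin (IZR k * y))));
    [apply (is_RInt_scal (V := R_NormedModule) (fun y => f y * cos (IZR k * y)))
    |apply (is_RInt_scal (V := R_NormedModule) (fun y => f y * sin (IZR k * y)))];
    apply (@RInt_correct R_CompleteNormedModule); auto. }
  unfold fourier, expi, Cmult; simpl. f_equal.
  - rewrite (RInt_ext (fun y => f y * cos (IZR k * (y - x)))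
       (fun y => cos (IZR k * x) * (f y * cos (IZR k * y)) +
       sin (IZR k * x) * (f y * sin (IZR k * y)))).
    + rewrite L. ring.
    + intros y _. rewrite Rmult_minus_distr_l, cos_minus.
      change (f y * (cos (IZR k * y) * cos (IZR k * x) + sin (IZR k * y) * sin (IZR k * x))
        = cos (IZR k * x) * (f y * cos (IZR k * y)) + sin (IZR k * x) * (f y * sin (IZR k * y))).
      ring.
  - rewrite (RInt_ext (fun y => f y * sin (IZR k * (y - x)))
      (fun y => (- sin (IZR k * x)) * (f y * cos (IZR k * y)) +
       cos (IZR k * x) * (f y * sin (IZR k * y)))).
    + rewrite L. ring.
    + intros y _. rewrite Rmult_minus_distr_l, sin_minus.
      change (f y * (sin (IZR k * y) * cos (IZR k * x) - cos (IZR k * y) * sin (IZR k * x))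
        = - sin (IZR k * x) * (f y * cos (IZR k * y)) + cos (IZR k * x) * (f y * sin (IZR k * y))).
      ring.
Qed.

(** The terms of index n and -n are conjugate: the imaginary parts cancel and the real parts give
    the summand 2 cos(n (y - x)) of the kernel. *)
Lemma fourier_partial_sum f x N : Cinf1 f ->
  sum_symmetric (fun k => Cmult (fourier f k) (expi (IZR k * x))) N =
  RtoC (/ (2 * PI) * RInt (fun y => f y * dirichlet N (y - x)) 0 (2 * PI)).
Proof.
  intros Hf. induction N.
  - rewrite sum_symmetric_0, fourier_expi by auto. unfold RtoC. f_equal.
    + f_equal. apply RInt_ext. intros y _. simpl. rewrite Rmult_0_l, cos_0. reflexivity.
    + rewrite (RInt_ext _ (fun _ => 0)).
      * rewrite RInt_const. unfold scal; simpl; unfold mult; simpl. ring.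
      * intros y _. rewrite Rmult_0_l, sin_0. apply Rmult_0_r.
  - rewrite sum_symmetric_S, IHN, !fourier_expi by auto.
    set (n := Z.of_nat (S N)).
    assert (C1 : Cinf1 (fun y => f y * dirichlet N (y - x))).
    { apply Cinf1_mult; auto. apply (Cinf1_shift (dirichlet N) (- x)), Cinf1_dirichlet. }
    assert (C2 : Cinf1 (fun y => f y * cos (IZR n * (y - x)))).
    { apply Cinf1_mult; auto.
      apply (Cinf1_shift (fun y => cos (IZR n * y)) (- x)), Cinf1_cos. }
    assert (Ec : RInt (fun y => f y * cos (IZR (- n) * (y - x))) 0 (2 * PI) =
      RInt (fun y => f y * cos (IZR n * (y - x))) 0 (2 * PI)).
    { apply RInt_ext. intros y _. rewrite opp_IZR, Ropp_mult_distr_l_reverse, cos_neg; auto. }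
    assert (Es : RInt (fun y => f y * sin (IZR (- n) * (y - x))) 0 (2 * PI) =
      - RInt (fun y => f y * sin (IZR n * (y - x))) 0 (2 * PI)).
    { rewrite <- (RInt_opp (V := R_CompleteNormedModule)).
      - apply RInt_ext. intros y _.
        rewrite opp_IZR, Ropp_mult_distr_l_reverse, sin_neg.
        change (f y * - sin (IZR n * (y - x)) = - (f y * sin (IZR n * (y - x)))). ring.
      - apply (Cinf1_ex_RInt (fun y => f y * sin (IZR n * (y - x)))).
        apply Cinf1_mult; auto.
        apply (Cinf1_shift (fun y => sin (IZR n * y)) (- x)), Cinf1_sin. }
    rewrite Ec, Es. unfold Cplus, RtoC; simpl fst; simpl snd. f_equal; [|ring].
    assert (I : is_RInt (fun y => plus (f y * dirichlet N (y - x))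
        (scal 2 (f y * cos (IZR n * (y - x))))) 0 (2 * PI)
      (plus (RInt (fun y => f y * dirichlet N (y - x)) 0 (2 * PI))
        (scal 2 (RInt (fun y => f y * cos (IZR n * (y - x))) 0 (2 * PI))))).
    { apply (is_RInt_plus (V := R_NormedModule));
        [|apply (is_RInt_scal (V := R_NormedModule))];
        apply (@RInt_correct R_CompleteNormedModule), Cinf1_ex_RInt; auto. }
    rewrite (RInt_ext (fun y => f y * dirichlet (S N) (y - x))
      (fun y => plus (f y * dirichlet N (y - x)) (scal 2 (f y * cos (IZR n * (y - x)))))).
    + rewrite (is_RInt_unique _ _ _ _ I).
      unfold plus, scal; simpl; unfold mult; simpl. ring.
    + intros y _. change (dirichlet (S N) (y - x)) with
        (dirichlet N (y - x) + 2 * cos (INR (S N) * (y - x))).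
      rewrite INR_IZR_INZ. fold n. unfold plus, scal; simpl; unfold mult; simpl. ring.
Qed.

Lemma fourier_inversion f x : Cinf1 f ->
  series_to (fun k => Cmult (fourier f k) (expi (IZR k * x))) (f x).
Proof.
  intros Hf; split.
  - eapply is_lim_seq_ext; [|apply (dirichlet_convergence f x Hf)].
    intros N. rewrite fourier_partial_sum; auto.
  - eapply is_lim_seq_ext; [|apply is_lim_seq_const].
    intros N. rewrite fourier_partial_sum; auto.
Qed.

Lemma fourier_Derive f k : Cinf1 f ->
  fourier (Derive f) k = Cmult (0, IZR k) (fourier f k).
Proof.
  intros Hf. unfold fourier. rewrite !RInt_ibp_periodic by auto using Cinf1_cos, Cinf1_sin.
  assert (Hc : ex_RInt (fun y => f y * cos (IZR k * y)) 0 (2 * PI)).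
  { apply (Cinf1_ex_RInt (fun y => f y * cos (IZR k * y))).
    apply Cinf1_mult; auto. apply Cinf1_cos. }
  assert (Hs : ex_RInt (fun y => f y * sin (IZR k * y)) 0 (2 * PI)).
  { apply (Cinf1_ex_RInt (fun y => f y * sin (IZR k * y))).
    apply Cinf1_mult; auto. apply Cinf1_sin. }
  assert (E1 : RInt (fun x => f x * Derive (fun y => cos (IZR k * y)) x) 0 (2 * PI) =
    - IZR k * RInt (fun y => f y * sin (IZR k * y)) 0 (2 * PI)).
  { etransitivity; [|apply (RInt_scal (V := R_CompleteNormedModule)
      (fun y => f y * sin (IZR k * y)) 0 (2 * PI) (- IZR k) Hs)].
    apply RInt_ext. intros x _. unfold scal; simpl; unfold mult; simpl.
    rewrite (is_derive_unique _ x (- (IZR k * sin (IZR k * x)))).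
    - change (f x * - (IZR k * sin (IZR k * x)) = - IZR k * (f x * sin (IZR k * x))). ring.
    - auto_derive; auto; ring. }
  assert (E2 : RInt (fun x => f x * Derive (fun y => sin (IZR k * y)) x) 0 (2 * PI) =
    IZR k * RInt (fun y => f y * cos (IZR k * y)) 0 (2 * PI)).
  { etransitivity; [|apply (RInt_scal (V := R_CompleteNormedModule)
      (fun y => f y * cos (IZR k * y)) 0 (2 * PI) (IZR k) Hc)].
    apply RInt_ext. intros x _. unfold scal; simpl; unfold mult; simpl.
    rewrite (is_derive_unique _ x (IZR k * cos (IZR k * x))).
    - change (f x * (IZR k * cos (IZR k * x)) = IZR k * (f x * cos (IZR k * x))). ring.
    - auto_derive; auto; ring. }
  rewrite E1, E2. unfold Cmult; simpl. f_equal; ring.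
Qed.

Fixpoint Cipow (w : C) (n : nat) : C :=
  match n with O => RtoC 1 | S n => Cmult w (Cipow w n) end.

Lemma Cinf1_Derive_n f n : Cinf1 f -> Cinf1 (Derive_n f n).
Proof. intros Hf; induction n; auto. apply (Cinf1_Derive _ IHn). Qed.

Lemma fourier_Derive_n f n k : Cinf1 f ->
  fourier (Derive_n f n) k = Cmult (Cipow (0, IZR k) n) (fourier f k).
Proof.
  intros Hf; induction n.
  - simpl. change (fun x => f x) with f. rewrite Cmult_1_l; auto.
  - change (Derive_n f (S n)) with (Derive (Derive_n f n)).
    rewrite fourier_Derive, IHn by (apply Cinf1_Derive_n; auto). simpl.
    rewrite Cmult_assoc; auto.
Qed.

(** * Symbols *)

(** The difference operator of [diff_k] on real sequences of the covariable alone. *)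
Fixpoint dk (n : nat) (b : Z -> R) (k : Z) : R :=
  match n with O => b k | S n => dk n b (k + 1)%Z - dk n b k end.

(** The estimates of [toroidal_symbol] for a symbol independent of theta. The constant is required
    to be nonnegative so that bounds can be multiplied. *)
Definition symbol_growth (m : R) (b : Z -> R) : Prop :=
  forall n, exists K, 0 <= K /\
    forall k, Rabs (dk n b k) <= K * Rpower (1 + Rabs (IZR k)) (m - INR n).

Lemma Rpower_base_pos k r : 0 < Rpower (1 + Rabs (IZR k)) r.
Proof. apply exp_pos. Qed.

Lemma Rpower_base_mono k r s : r <= s ->
  Rpower (1 + Rabs (IZR k)) r <= Rpower (1 + Rabs (IZR k)) s.
Proof.
  intros H. pose proof (Rabs_pos (IZR k)). destruct H as [H | ->]; [|lra].
  destruct (Req_dec (Rabs (IZR k)) 0) as [E | E].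
  - rewrite E, Rplus_0_r. unfold Rpower. rewrite ln_1, !Rmult_0_r. lra.
  - left; apply Rpower_lt; lra.
Qed.

Lemma symbol_growth_mono m m' b : m <= m' -> symbol_growth m b -> symbol_growth m' b.
Proof.
  intros Hm H n. destruct (H n) as (K & HK & B). exists K; split; auto. intros k.
  eapply Rle_trans; [apply B|]. apply Rmult_le_compat_l; auto.
  apply Rpower_base_mono. lra.
Qed.

Lemma dk_one n k : dk (S n) (fun _ => 1) k = 0.
Proof.
  revert k; induction n; intros k; [simpl; ring|].
  change (dk (S n) (fun _ => 1) (k + 1) - dk (S n) (fun _ => 1) k = 0).
  rewrite !IHn; ring.
Qed.

Lemma symbol_growth_one : symbol_growth 0 (fun _ => 1).
Proof.
  intros n. exists 1; split; [lra|]. intros k. rewrite Rmult_1_l. destruct n.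
  - simpl. rewrite Rminus_0_r, Rpower_O, Rabs_R1; [lra|].
    pose proof (Rabs_pos (IZR k)); lra.
  - rewrite dk_one, Rabs_R0. left; apply Rpower_base_pos.
Qed.

(** The discrete Leibniz rule has two terms only, the second differences of k being zero. *)
Lemma dk_mult_k n b k : dk (S n) (fun k => IZR k * b k) k =
  IZR k * dk (S n) b k + INR (S n) * dk n b (k + 1)%Z.
Proof.
  revert k; induction n; intros k.
  - simpl. rewrite plus_IZR. ring.
  - change (dk (S (S n)) (fun k => IZR k * b k) k) with
      (dk (S n) (fun k => IZR k * b k) (k + 1) - dk (S n) (fun k => IZR k * b k) k).
    rewrite !IHn.
    change (dk (S (S n)) b k) with (dk (S n) b (k + 1) - dk (S n) b k).
    change (dk (S n) b (k + 1)) with (dk n b (k + 1 + 1) - dk n b (k + 1)).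
    rewrite plus_IZR, !S_INR. ring.
Qed.

Lemma Rabs_IZR_Rpower k r :
  Rabs (IZR k) * Rpower (1 + Rabs (IZR k)) r <= Rpower (1 + Rabs (IZR k)) (r + 1).
Proof.
  pose proof (Rabs_pos (IZR k)). pose proof (Rpower_base_pos k r).
  rewrite Rpower_plus, Rpower_1 by lra. nra.
Qed.

Lemma symbol_growth_mult_k m b :
  symbol_growth m b -> symbol_growth (m + 1) (fun k => IZR k * b k).
Proof.
  intros H [|n].
  - destruct (H 0%nat) as (K & HK & B). exists K; split; auto. intros k.
    simpl dk. specialize (B k). simpl in *. rewrite Rabs_mult.
    replace (m + 1 - 0) with (m - 0 + 1) by ring.
    eapply Rle_trans; [|apply Rmult_le_compat_l; [auto | apply Rabs_IZR_Rpower]].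
    pose proof (Rabs_pos (IZR k)). nra.
  - destruct (H n) as (K0 & HK0 & B0). destruct (H (S n)) as (K1 & HK1 & B1).
    exists (K1 + INR (S n) * (K0 + K1)). pose proof (pos_INR (S n)) as Hn.
    split; [nra|]. intros k. rewrite dk_mult_k.
    replace (m + 1 - INR (S n)) with (m - INR n) by (rewrite S_INR; ring).
    set (P := Rpower (1 + Rabs (IZR k)) (m - INR n)) in *.
    specialize (B0 k). specialize (B1 k). fold P in B0.
    (* The shifted term is rewritten at k, which avoids comparing the weights at k + 1 and at k. *)
    assert (E : dk n b (k + 1) = dk (S n) b k + dk n b k) by (simpl; ring).
    assert (T1 : Rabs (IZR k) * Rabs (dk (S n) b k) <= K1 * P).
    { eapply Rle_trans; [apply Rmult_le_compat_l; [apply Rabs_pos | apply B1]|].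
      pose proof (Rabs_IZR_Rpower k (m - INR (S n))) as A.
      replace (m - INR (S n) + 1) with (m - INR n) in A by (rewrite S_INR; ring).
      fold P in A. nra. }
    assert (T2 : Rabs (dk (S n) b k) <= K1 * P).
    { eapply Rle_trans; [apply B1|]. apply Rmult_le_compat_l; auto.
      apply Rpower_base_mono. rewrite S_INR; lra. }
    eapply Rle_trans; [apply Rabs_triang|].
    rewrite !Rabs_mult, (Rabs_pos_eq (INR (S n))) by auto.
    assert (T3 : Rabs (dk n b (k + 1)) <= (K0 + K1) * P).
    { rewrite E. eapply Rle_trans; [apply Rabs_triang|]. lra. }
    pose proof (Rmult_le_compat_l _ _ _ Hn T3). lra.
Qed.

Lemma symbol_growth_pow r : symbol_growth (INR r) (fun k => IZR k ^ r).
Proof.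
  induction r; [apply symbol_growth_one|].
  rewrite S_INR. apply (symbol_growth_mult_k _ _ IHr).
Qed.

Lemma periodic_bounded f : Cinf1 f -> exists K, 0 <= K /\ forall x, Rabs (f x) <= K.
Proof.
  intros Hf. pose proof PI_RGT_0.
  destruct (continuity_ab_maj (fun x => Rabs (f x)) 0 (2 * PI)) as (M & HM & _).
  - lra.
  - intros x _. apply continuity_pt_filterlim.
    apply (continuous_comp f Rabs); [apply Cinf1_cont; auto | apply continuous_Rabs].
  - exists (Rabs (f M)). split; [apply Rabs_pos|]. intros x.
    destruct (circle_representative x) as [z Hz].
    rewrite <- (periodic_IZR f z x (proj2 Hf)). apply HM; auto.
Qed.

(** The symbol c(x) (i k)^r of the operator c D^r, with D the derivative in theta. *)
Definition monomial_symbol (c : R -> R) (r : nat) (k : Z) (x : R) : C :=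
  Cmult (RtoC (c x)) (Cipow (0, IZR k) r).

Lemma Cipow_IZR k r : Cipow (0, IZR k) r = Cmult (RtoC (IZR k ^ r)) (Cipow Ci r).
Proof.
  induction r; simpl; [rewrite Cmult_1_l; auto|].
  rewrite IHr. replace (0, IZR k) with (Cmult (RtoC (IZR k)) Ci).
  - rewrite RtoC_mult. ring.
  - unfold Cmult, RtoC, Ci; simpl. f_equal; ring.
Qed.

Lemma diff_k_monomial c r n k x : diff_k n (monomial_symbol c r) k x =
  Cmult (RtoC (c x * dk n (fun k => IZR k ^ r) k)) (Cipow Ci r).
Proof.
  revert k; induction n; intros k.
  - unfold diff_k; simpl. unfold monomial_symbol. rewrite Cipow_IZR, RtoC_mult. ring.
  - change (diff_k (S n) (monomial_symbol c r) k x) with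
      (Cminus (diff_k n (monomial_symbol c r) (k + 1)%Z x)
              (diff_k n (monomial_symbol c r) k x)).
    rewrite !IHn. simpl dk. rewrite Rmult_minus_distr_l, RtoC_minus. ring.
Qed.

Lemma Cipow_Ci_mod r : Cmod (Cipow Ci r) = 1.
Proof.
  induction r; simpl; [apply Cmod_1|].
  rewrite Cmod_mult, IHr, Rmult_1_r. unfold Cmod, Ci; simpl.
  replace (0 * (0 * 1) + 1 * (1 * 1)) with 1 by ring. apply sqrt_1.
Qed.

Lemma dtheta_scal c (w : C) n x :
  dtheta n (fun y => Cmult (RtoC (c y)) w) x = Cmult (RtoC (Derive_n c n x)) w.
Proof.
  unfold dtheta, Cmult, RtoC; simpl.
  rewrite (Derive_n_ext (fun t => c t * fst w - 0 * snd w) (fun t => fst w * c t))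
    by (intros; ring).
  rewrite (Derive_n_ext (fun t => c t * snd w + 0 * fst w) (fun t => snd w * c t))
    by (intros; ring).
  rewrite !Derive_n_scal_l. f_equal; ring.
Qed.

Lemma Cinf_scal c (w : C) : Cinf1 c -> Cinf (fun y => Cmult (RtoC (c y)) w).
Proof.
  intros H. unfold Cmult, RtoC; simpl. split; [|split]; simpl.
  - apply (Cinf1_minus (fun t => c t * fst w) (fun t => 0 * snd w)); auto with smooth.
  - apply (Cinf1_plus (fun t => c t * snd w) (fun t => 0 * fst w)); auto with smooth.
  - intros x. destruct H as [_ H]. rewrite H; auto.
Qed.

(** The variables separate: theta-derivatives fall on the bounded periodic c, differences on k^r,
    and i^r has modulus 1. *)
Lemma monomial_toroidal m c r : INR r <= m -> Cinf1 c ->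
  toroidal_symbol m (monomial_symbol c r).
Proof.
  intros Hm Hc. split; [intros k; apply Cinf_scal; auto|].
  intros n j.
  destruct (periodic_bounded (Derive_n c j)) as (B & HB & HB').
  { apply Cinf1_Derive_n; auto. }
  destruct (symbol_growth_mono _ _ _ Hm (symbol_growth_pow r) n) as (K & HK & HK').
  exists (B * K). intros k x.
  replace (diff_k n (monomial_symbol c r) k) with
    (fun y => Cmult (RtoC (c y)) (Cmult (RtoC (dk n (fun k => IZR k ^ r) k)) (Cipow Ci r))).
  2:{ apply functional_extensionality; intros y.
      rewrite diff_k_monomial, RtoC_mult. ring. }
  rewrite dtheta_scal, !Cmod_mult, Cipow_Ci_mod, !Cmod_R, Rmult_1_r, Rmult_assoc.
  apply Rmult_le_compat; auto using Rabs_pos.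
Qed.

Lemma diff_k_plus a b n k x : diff_k n (fun k x => Cplus (a k x) (b k x)) k x =
  Cplus (diff_k n a k x) (diff_k n b k x).
Proof.
  revert k; induction n; intros k; [reflexivity|].
  change (Cminus (diff_k n (fun k x => Cplus (a k x) (b k x)) (k + 1)%Z x)
              (diff_k n (fun k x => Cplus (a k x) (b k x)) k x) =
    Cplus (Cminus (diff_k n a (k + 1)%Z x) (diff_k n a k x))
          (Cminus (diff_k n b (k + 1)%Z x) (diff_k n b k x))).
  rewrite !IHn. ring.
Qed.

Lemma Cinf_plus (f g : R -> C) : Cinf f -> Cinf g -> Cinf (fun x => Cplus (f x) (g x)).
Proof.
  intros (A & B & C) (A' & B' & C').
  assert (P : forall u v, smooth u -> smooth v -> smooth (fun x => u x + v x)).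
  { intros u v Hu Hv. apply (smooth2_smooth (fun _ x => u x + v x) 0).
    apply (smooth2_plus (fun _ => u) (fun _ => v)); apply smooth_smooth2; auto. }
  split; [|split]; simpl.
  - apply P; auto.
  - apply P; auto.
  - intros x. rewrite C, C'; auto.
Qed.

Lemma diff_k_Cinf a n k : (forall k, Cinf (a k)) -> Cinf (diff_k n a k).
Proof.
  intros H; revert k; induction n; intros k; [apply H|].
  change (Cinf (fun x => Cminus (diff_k n a (k + 1)%Z x) (diff_k n a k x))).
  apply (Cinf_plus (diff_k n a (k + 1)%Z) (fun x => Copp (diff_k n a k x))); auto.
  destruct (IHn k) as (A & B & C).
  assert (P : forall u, smooth u -> smooth (fun x => - u x)).
  { intros u Hu. apply (smooth2_smooth (fun _ x => - u x) 0).
    apply (smooth2_opp (fun _ => u)); apply smooth_smooth2; auto. }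
  split; [|split]; simpl; auto.
  intros x. rewrite C; auto.
Qed.

Lemma dtheta_plus (f g : R -> C) n x : Cinf f -> Cinf g ->
  dtheta n (fun y => Cplus (f y) (g y)) x = Cplus (dtheta n f x) (dtheta n g x).
Proof.
  intros (A & B & _) (A' & B' & _). unfold dtheta, Cplus; simpl.
  rewrite !Derive_n_plus; auto; apply filter_forall; intros y k _;
    first [apply A | apply A' | apply B | apply B'].
Qed.

Lemma toroidal_plus m a b : toroidal_symbol m a -> toroidal_symbol m b ->
  toroidal_symbol m (fun k x => Cplus (a k x) (b k x)).
Proof.
  intros [A B] [A' B']. split; [intros; apply Cinf_plus; auto|].
  intros n j. destruct (B n j) as [K HK]. destruct (B' n j) as [K' HK'].
  exists (K + K'). intros k x.
  replace (diff_k n (fun k x => Cplus (a k x) (b k x)) k) with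
    (fun x => Cplus (diff_k n a k x) (diff_k n b k x)).
  2:{ apply functional_extensionality; intros; symmetry; apply diff_k_plus. }
  rewrite dtheta_plus by (apply diff_k_Cinf; auto).
  eapply Rle_trans; [apply Cmod_triangle|].
  rewrite Rmult_plus_distr_r. apply Rplus_le_compat; auto.
Qed.

(** * Differential operators *)

(** Scalar linear differential operators of order at most m on pairs of functions, given by
    generators so that closure under [Derive] and multiplication is an induction. [diffop_ext]
    compares operators on smooth periodic arguments, where the Leibniz rule holds. *)
Inductive diffop (m : nat) : ((R -> R2) -> R -> R) -> Prop :=
| diffop_monomial c (j : bool) r : Cinf1 c -> (r <= m)%nat ->
    diffop m (fun h x => c x * Derive_n (fun y => comp j (h y)) r x)
| diffop_plus A B : diffop m A -> diffop m B -> diffop m (fun h x => A h x + B h x)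
| diffop_ext A B : diffop m A -> (forall h, Cinf h -> A h = B h) -> diffop m B.

Lemma Cinf_comp h j : Cinf h -> Cinf1 (fun y => comp j (h y)).
Proof.
  intros (A & B & C). destruct j; split; simpl; auto; intros x; rewrite C; auto.
Qed.

Lemma diffop_Cinf1 m A h : diffop m A -> Cinf h -> Cinf1 (A h).
Proof.
  intros HA Hh; induction HA.
  - apply Cinf1_mult; auto. apply Cinf1_Derive_n, Cinf_comp; auto.
  - apply Cinf1_plus; auto.
  - rewrite <- H; auto.
Qed.

Lemma diffop_mono m m' A : (m <= m')%nat -> diffop m A -> diffop m' A.
Proof.
  intros Hm HA; induction HA.
  - apply diffop_monomial; auto; lia.
  - apply diffop_plus; auto.
  - eapply diffop_ext; eauto.
Qed.

Lemma diffop_mult m c A : Cinf1 c -> diffop m A -> diffop m (fun h x => c x * A h x).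
Proof.
  intros Hc HA; induction HA.
  - apply (diffop_ext _ (fun h x => (c x * c0 x) * Derive_n (fun y => comp j (h y)) r x)).
    + apply (diffop_monomial m (fun x => c x * c0 x)); auto with smooth.
    + intros h _; apply functional_extensionality; intros x; ring.
  - apply (diffop_ext _ (fun h x => c x * A h x + c x * B h x)).
    + apply diffop_plus; auto.
    + intros h _; apply functional_extensionality; intros x; ring.
  - eapply diffop_ext; [apply IHHA|]. intros h Hh.
    apply functional_extensionality; intros x. simpl. rewrite H; auto.
Qed.

Lemma diffop_Derive m A : diffop m A -> diffop (S m) (fun h => Derive (A h)).
Proof.
  intros HA; induction HA.
  - apply (diffop_ext _ (fun h x =>
      Derive c x * Derive_n (fun y => comp j (h y)) r x +
      c x * Derive_n (fun y => comp j (h y)) (S r) x)).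
    + apply diffop_plus; apply (diffop_monomial (S m)); auto using Cinf1_Derive; lia.
    + intros h Hh; apply functional_extensionality; intros x. symmetry.
      apply Derive_mult; apply Cinf1_ex_derive; auto.
      apply Cinf1_Derive_n, Cinf_comp; auto.
  - apply (diffop_ext _ (fun h x => Derive (A h) x + Derive (B h) x)).
    + apply diffop_plus; auto.
    + intros h Hh; apply functional_extensionality; intros x. symmetry.
      apply Derive_plus; apply Cinf1_ex_derive; eapply diffop_Cinf1; eauto.
  - eapply diffop_ext; [apply IHHA|]. intros h Hh. simpl. rewrite H; auto.
Qed.

Lemma Cinf1_inv f : (forall x, f x <> 0) -> Cinf1 f -> Cinf1 (fun x => / f x).
Proof.
  intros H Hf. apply (sfam_Cinf1 (fun _ x => / f x) 0), (sfam_inv (fun _ => f));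
    auto using Cinf1_sfam.
Qed.

Lemma diffop_ds m s A : arclength s -> diffop m A -> diffop (S m) (fun h => ds s (A h)).
Proof.
  intros [Hs Hp] HA. apply (diffop_mult (S m) (fun x => / s x) (fun h => Derive (A h))).
  - apply Cinf1_inv; auto. intros x; specialize (Hp x); lra.
  - apply diffop_Derive; auto.
Qed.

Lemma diffop_Q m s A : arclength s -> diffop m A -> diffop (S (S m)) (fun h => Q s (A h)).
Proof.
  intros Hs HA.
  apply (diffop_ext _ (fun h x => A h x + -1 * ds s (ds s (A h)) x)).
  - apply diffop_plus.
    + apply (diffop_mono m); auto.
    + apply (diffop_mult _ (fun _ => -1)); auto with smooth.
      apply (diffop_ds _ s (fun h => ds s (A h))); auto using diffop_ds.
  - intros h _; apply functional_extensionality; intros x; unfold Q; ring.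
Qed.

Lemma diffop_iter_Q n m s A : arclength s -> diffop m A ->
  diffop (2 * n + m) (fun h => Nat.iter n (Q s) (A h)).
Proof.
  intros Hs HA; induction n; simpl; auto.
  replace (S (n + S (n + 0) + m))%nat with (S (S (2 * n + m))) by lia.
  apply (diffop_Q _ s (fun h => Nat.iter n (Q s) (A h))); auto.
Qed.

(** [symbol_term] with the output coordinate fixed, so that each component of an operator has its
    own row of symbols. *)
Definition row_term (a : bool -> Z -> R -> C) (h : R -> R2) (x : R) (k : Z) : C :=
  Cmult (Cplus (Cmult (a false k x) (fourier (fun y => comp false (h y)) k))
               (Cmult (a true k x) (fourier (fun y => comp true (h y)) k)))
        (expi (IZR k * x)).

Lemma diffop_symbol m A : diffop m A -> exists a : bool -> Z -> R -> C,
  (forall j, toroidal_symbol (INR m) (a j)) /\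
  forall h, Cinf h -> forall x, series_to (row_term a h x) (A h x).
Proof.
  intros HA; induction HA.
  (* The monomial reads the component j only, so the other column of the row is the zero symbol. *)
  - exists (fun i => monomial_symbol (if Bool.eqb i j then c else fun _ => 0) r). split.
    + intros i. apply monomial_toroidal; [apply le_INR; auto|].
      destruct Bool.eqb; auto with smooth.
    + intros h Hh x. pose proof (Cinf_comp h j Hh) as Hj.
      eapply series_to_ext; [|apply (series_to_scal (c x)), fourier_inversion,
        (Cinf1_Derive_n _ r Hj)].
      intros k. cbv beta. rewrite fourier_Derive_n by auto.
      unfold row_term. destruct j; cbv [Bool.eqb monomial_symbol]; ring.
  - destruct IHHA1 as (a & Ha & Ea). destruct IHHA2 as (b & Hb & Eb).
    exists (fun j k x => Cplus (a j k x) (b j k x)). split.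
    + intros j; apply toroidal_plus; auto.
    + intros h Hh x. eapply series_to_ext; [|apply (series_to_plus _ _ _ _ (Ea h Hh x) (Eb h Hh x))].
      intros k. unfold row_term. ring.
  - destruct IHHA as (a & Ha & Ea). exists a; split; auto.
    intros h Hh x. rewrite <- H; auto.
Qed.

Lemma diffop_pseudo_differential m (A : (R -> R2) -> R -> R2) :
  (forall i, diffop m (fun h x => comp i (A h x))) ->
  pseudo_differential (INR m) A.
Proof.
  intros H. destruct (diffop_symbol _ _ (H false)) as (a & Ha & Ea).
  destruct (diffop_symbol _ _ (H true)) as (b & Hb & Eb).
  exists (fun i : bool => if i then b else a). split.
  - intros [] j; auto.
  - intros h Hh [] x.
    + apply (series_to_filterlim _ _ (Eb h Hh x)).
    + apply (series_to_filterlim _ _ (Ea h Hh x)).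
Qed.

(** * The moving frame along an immersed curve *)

Definition xpart (h : R -> R2) (x : R) : R := fst (h x).
Definition ypart (h : R -> R2) (x : R) : R := snd (h x).

Lemma Cinf_parts h : Cinf h <-> Cinf1 (xpart h) /\ Cinf1 (ypart h).
Proof.
  split.
  - intros (A & B & C). conjs; split; auto; intros x; unfold xpart, ypart; rewrite C; auto.
  - intros ((A & P) & (B & P')). split; [|split]; auto.
    intros x. apply injective_projections; [apply P | apply P'].
Qed.

Definition tx (c : R -> R2) : R -> R := ds (speed c) (xpart c).
Definition ty (c : R -> R2) : R -> R := ds (speed c) (ypart c).

Lemma tangent_eq c x : tangent c x = (tx c x, ty c x).
Proof. reflexivity. Qed.

Lemma speed_eq c x :
  speed c x = sqrt (Derive (xpart c) x * Derive (xpart c) x +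
                    Derive (ypart c) x * Derive (ypart c) x).
Proof. reflexivity. Qed.

Lemma speed_sq_pos c x : dtheta 1 c x <> (0, 0) ->
  0 < Derive (xpart c) x * Derive (xpart c) x + Derive (ypart c) x * Derive (ypart c) x.
Proof.
  intros H. change ((Derive (xpart c) x, Derive (ypart c) x) <> (0, 0)) in H.
  set (a := Derive (xpart c) x) in *. set (b := Derive (ypart c) x) in *.
  destruct (Req_dec a 0) as [Ha|Ha].
  - destruct (Req_dec b 0) as [Hb|Hb].
    + exfalso; apply H; congruence.
    + pose proof (Rlt_0_sqr _ Hb). unfold Rsqr in *. nra.
  - pose proof (Rlt_0_sqr _ Ha). unfold Rsqr in *. nra.
Qed.

Lemma speed_pos c x : Imm c -> 0 < speed c x.
Proof. intros [_ H]. apply sqrt_lt_R0, speed_sq_pos; auto. Qed.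

Lemma smooth_curve_parts gamma : smooth_curve gamma ->
  smooth_family (fun t => xpart (gamma t)) /\ smooth_family (fun t => ypart (gamma t)).
Proof.
  intros H. destruct (smooth_curve_smooth2 _ H) as (A & B & P).
  conjs; split; auto; intros t x; unfold xpart, ypart; rewrite P; auto.
Qed.

Lemma smooth_curve_intro F G : smooth_family F -> smooth_family G ->
  smooth_curve (fun t x => (F t x, G t x)).
Proof. intros [A B] [C D]. apply smooth2_smooth_curve; auto. Qed.

Lemma speed_family c : smooth_family (fun t => xpart (c t)) ->
  smooth_family (fun t => ypart (c t)) -> (forall t, Imm (c t)) ->
  arclength_family (fun t => speed (c t)).
Proof.
  intros Hx Hy HI. split; [|intros; apply speed_pos; auto].
  apply (sfam_sqrt (fun t x =>
    Derive (xpart (c t)) x * Derive (xpart (c t)) x +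
    Derive (ypart (c t)) x * Derive (ypart (c t)) x)).
  - intros t x. apply speed_sq_pos, HI.
  - apply sfam_Derive in Hx. apply sfam_Derive in Hy.
    apply sfam_plus; apply sfam_mult; auto.
Qed.

Lemma Imm_parts c : Imm c -> Cinf1 (xpart c) /\ Cinf1 (ypart c) /\ arclength (speed c).
Proof.
  intros H. pose proof (proj1 (Cinf_parts c) (proj1 H)) as [A B]. conjs; auto.
  split; [|intros; apply speed_pos; auto].
  apply (sfam_Cinf1 (fun _ => speed c) 0).
  apply (speed_family (fun _ => c)); auto using Cinf1_sfam.
Qed.

Lemma tangent_unit c x : Imm c -> tx c x * tx c x + ty c x * ty c x = 1.
Proof.
  intros H. pose proof (speed_pos c x H) as P.
  pose proof (speed_sq_pos c x (proj2 H x)) as Q'.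
  assert (E : speed c x * speed c x = Derive (xpart c) x * Derive (xpart c) x +
    Derive (ypart c) x * Derive (ypart c) x)
    by (rewrite speed_eq; apply sqrt_sqrt; lra).
  unfold tx, ty, ds.
  transitivity ((Derive (xpart c) x * Derive (xpart c) x +
    Derive (ypart c) x * Derive (ypart c) x) / (speed c x * speed c x)).
  - field; lra.
  - rewrite <- E. field; lra.
Qed.

(** With n = J v = (-ty, tx), these are the coefficients b and a in h = b v + a n; [vfield]
    reassembles the field. *)
Definition tcoord (c h : R -> R2) (x : R) : R := xpart h x * tx c x + ypart h x * ty c x.
Definition ncoord (c h : R -> R2) (x : R) : R := ypart h x * tx c x - xpart h x * ty c x.

Definition vfield (c : R -> R2) (b a : R -> R) (x : R) : R2 :=
  (b x * tx c x - a x * ty c x, b x * ty c x + a x * tx c x).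

Lemma vfield_coords c h : Imm c -> vfield c (tcoord c h) (ncoord c h) = h.
Proof.
  intros H. apply functional_extensionality; intros x.
  pose proof (tangent_unit c x H) as U.
  unfold vfield, tcoord, ncoord, xpart, ypart. destruct (h x) as [p q]; simpl.
  set (a := tx c x) in *. set (b := ty c x) in *. f_equal.
  - transitivity (p * (a * a + b * b)); [ring | rewrite U; ring].
  - transitivity (q * (a * a + b * b)); [ring | rewrite U; ring].
Qed.

Lemma tcoord_vfield c b a : Imm c -> tcoord c (vfield c b a) = b.
Proof.
  intros H. apply functional_extensionality; intros x.
  unfold vfield, tcoord, xpart, ypart; simpl.
  transitivity (b x * (tx c x * tx c x + ty c x * ty c x)); [ring|].
  rewrite tangent_unit by auto; ring.
Qed.

Lemma ncoord_vfield c b a : Imm c -> ncoord c (vfield c b a) = a.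
Proof.
  intros H. apply functional_extensionality; intros x.
  unfold vfield, ncoord, xpart, ypart; simpl.
  transitivity (a x * (tx c x * tx c x + ty c x * ty c x)); [ring|].
  rewrite tangent_unit by auto; ring.
Qed.

Lemma dot_vfield c b a b' a' x : Imm c ->
  dot (vfield c b a x) (vfield c b' a' x) = b x * b' x + a x * a' x.
Proof.
  intros H. unfold dot, vfield; simpl.
  transitivity ((b x * b' x + a x * a' x) * (tx c x * tx c x + ty c x * ty c x)); [ring|].
  rewrite tangent_unit by auto; ring.
Qed.

Lemma Cinf1_frame c : Imm c -> Cinf1 (tx c) /\ Cinf1 (ty c).
Proof. intros H. destruct (Imm_parts c H) as (A & B & C). split; apply Cinf1_ds; auto. Qed.

Lemma Cinf1_coords c h : Imm c -> Cinf h -> Cinf1 (tcoord c h) /\ Cinf1 (ncoord c h).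
Proof.
  intros H Hh. destruct (Cinf1_frame c H). apply Cinf_parts in Hh. destruct Hh.
  split; [apply Cinf1_plus | apply Cinf1_minus]; auto with smooth.
Qed.

Lemma Cinf_vfield c b a : Imm c -> Cinf1 b -> Cinf1 a -> Cinf (vfield c b a).
Proof.
  intros H Hb Ha. destruct (Cinf1_frame c H). apply Cinf_parts.
  split; [apply (Cinf1_minus (fun x => b x * tx c x) (fun x => a x * ty c x))
         | apply (Cinf1_plus (fun x => b x * ty c x) (fun x => a x * tx c x))];
    auto with smooth.
Qed.

Lemma L2_vfield c b a b' a' : Imm c -> Cinf1 b -> Cinf1 a -> Cinf1 b' -> Cinf1 a' ->
  L2 c (vfield c b a) (vfield c b' a') =
  ints (speed c) (fun x => b x * b' x) + ints (speed c) (fun x => a x * a' x).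
Proof.
  intros H Hb Ha Hb' Ha'. destruct (Imm_parts c H) as (_ & _ & S).
  rewrite <- ints_plus by auto with smooth.
  apply (ints_ext (speed c)). intros x. apply dot_vfield; auto.
Qed.

(** * The metric *)

(** The constants are those of the domination estimate: 4^l from the Leibniz rule, one 2 from
    splitting the square of a sum, one 2 from adding the two components of h. The three factors
    [INR (S l)] count the orders in the jet of h, in the jet of the tangent, and in
    [ints_jet_le]. *)
Definition factor (l : nat) (c : R -> R2) : R :=
  4 * 4 ^ l * INR (S l) ^ 3 * frame_bound l (speed c) (xpart c) (ypart c) ^ 2.

Definition Lop (l : nat) (c h : R -> R2) : R -> R2 :=
  vfield c (fun x => factor l c * Nat.iter l (Q (speed c)) (tcoord c h) x)
          (fun x => factor l c * Nat.iter l (Q (speed c)) (ncoord c h) x).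

Definition Mop (l : nat) (c h : R -> R2) : R -> R2 :=
  vfield c (fun x => / factor l c * Nat.iter l (Qinv (speed c)) (tcoord c h) x)
          (fun x => / factor l c * Nat.iter l (Qinv (speed c)) (ncoord c h) x).

Lemma factor_pos l c : Imm c -> 0 < factor l c.
Proof.
  intros H. destruct (Imm_parts c H) as (A & B & C).
  destruct (frame_bound_spec l (speed c) (xpart c) (ypart c) 0 C A B) as [F _].
  pose proof (pow_lt 4 l ltac:(lra)).
  pose proof (pow_lt _ 3 (lt_0_INR (S l) ltac:(lia))).
  pose proof (pow_lt _ 2 (Rlt_le_trans _ _ _ Rlt_0_1 F)).
  unfold factor. apply Rmult_lt_0_compat; auto. apply Rmult_lt_0_compat; auto. lra.
Qed.

(** * The operator L as a smooth bundle automorphism *)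

(** If the images agree, f - g has zero energy, while a nonzero function has positive energy. *)
Lemma iter_Q_inj s f g n : arclength s -> Cinf1 f -> Cinf1 g ->
  Nat.iter n (Q s) f = Nat.iter n (Q s) g -> f = g.
Proof.
  intros H Hf Hg E. apply functional_extensionality; intros x.
  destruct (Req_dec (f x - g x) 0) as [|N]; [lra|]. exfalso.
  assert (P : 0 < energy n s (fun y => f y + -1 * g y))
    by (apply (energy_pos n s _ x); auto with smooth; simpl; lra).
  unfold energy in P. rewrite iter_Q_plus, iter_Q_scal, E in P by auto with smooth.
  rewrite (ints_ext s _ (fun y => 0 * 0)) in P by (intros; ring).
  rewrite ints_scal in P by auto with smooth. lra.
Qed.

(** A right inverse of an injective operator is also a left inverse. *)
Lemma iter_Qinv_Q s f n : arclength s -> Cinf1 f ->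
  Nat.iter n (Qinv s) (Nat.iter n (Q s) f) = f.
Proof.
  intros H Hf. apply (iter_Q_inj s _ _ n); auto.
  - apply Cinf1_iter_Qinv; auto with smooth.
  - apply iter_Q_Qinv; auto with smooth.
Qed.

(** Both sides have the same image under the linear, injective power of [Q]; the integral formula
    for [Qinv] need not be opened. *)
Lemma iter_Qinv_plus s f g n : arclength s -> Cinf1 f -> Cinf1 g ->
  Nat.iter n (Qinv s) (fun x => f x + g x) =
  fun x => Nat.iter n (Qinv s) f x + Nat.iter n (Qinv s) g x.
Proof.
  intros H Hf Hg. pose proof (Cinf1_iter_Qinv s f n H Hf).
  pose proof (Cinf1_iter_Qinv s g n H Hg). apply (iter_Q_inj s _ _ n); auto with smooth.
  - apply Cinf1_iter_Qinv; auto with smooth.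
  - rewrite iter_Q_plus, !iter_Q_Qinv; auto with smooth.
Qed.

Lemma iter_Qinv_scal s a f n : arclength s -> Cinf1 f ->
  Nat.iter n (Qinv s) (fun x => a * f x) = fun x => a * Nat.iter n (Qinv s) f x.
Proof.
  intros H Hf. pose proof (Cinf1_iter_Qinv s f n H Hf).
  apply (iter_Q_inj s _ _ n); auto with smooth.
  - apply Cinf1_iter_Qinv; auto with smooth.
  - rewrite iter_Q_scal, !iter_Q_Qinv; auto with smooth.
Qed.

Lemma tcoord_plus c h k :
  tcoord c (fun x => plus (h x) (k x)) = fun x => tcoord c h x + tcoord c k x.
Proof.
  apply functional_extensionality; intros x. unfold tcoord, xpart, ypart.
  change (plus (h x) (k x)) with (fst (h x) + fst (k x), snd (h x) + snd (k x)).
  simpl; ring.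
Qed.

Lemma ncoord_plus c h k :
  ncoord c (fun x => plus (h x) (k x)) = fun x => ncoord c h x + ncoord c k x.
Proof.
  apply functional_extensionality; intros x. unfold ncoord, xpart, ypart.
  change (plus (h x) (k x)) with (fst (h x) + fst (k x), snd (h x) + snd (k x)).
  simpl; ring.
Qed.

Lemma tcoord_scal c r h : tcoord c (fun x => scal r (h x)) = fun x => r * tcoord c h x.
Proof.
  apply functional_extensionality; intros x. unfold tcoord, xpart, ypart.
  change (scal r (h x)) with (r * fst (h x), r * snd (h x)). simpl; ring.
Qed.

Lemma ncoord_scal c r h : ncoord c (fun x => scal r (h x)) = fun x => r * ncoord c h x.
Proof.
  apply functional_extensionality; intros x. unfold ncoord, xpart, ypart.
  change (scal r (h x)) with (r * fst (h x), r * snd (h x)). simpl; ring.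
Qed.

Lemma linear_op_coordinatewise c (P : (R -> R) -> R -> R) : Imm c ->
  (forall f, Cinf1 f -> Cinf1 (P f)) ->
  (forall f g, Cinf1 f -> Cinf1 g -> forall x, P (fun y => f y + g y) x = P f x + P g x) ->
  (forall r f, Cinf1 f -> forall x, P (fun y => r * f y) x = r * P f x) ->
  linear_op (fun h => vfield c (P (tcoord c h)) (P (ncoord c h))).
Proof.
  intros H HP Hadd Hscal. split; [|split].
  - intros h Hh. destruct (Cinf1_coords c h H Hh). apply Cinf_vfield; auto.
  - intros h k Hh Hk x. destruct (Cinf1_coords c h H Hh).
    destruct (Cinf1_coords c k H Hk). rewrite tcoord_plus, ncoord_plus.
    unfold vfield. rewrite !Hadd by auto. unfold plus; simpl. unfold prod_plus; simpl.
    unfold plus; simpl. f_equal; ring.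
  - intros r h Hh x. destruct (Cinf1_coords c h H Hh). rewrite tcoord_scal, ncoord_scal.
    unfold vfield. rewrite !Hscal by auto. unfold scal; simpl. unfold prod_scal; simpl.
    unfold scal; simpl. unfold mult; simpl. f_equal; ring.
Qed.

Lemma linear_Lop l c : Imm c -> linear_op (Lop l c).
Proof.
  intros H. destruct (Imm_parts c H) as (_ & _ & S).
  apply (linear_op_coordinatewise c
    (fun f x => factor l c * Nat.iter l (Q (speed c)) f x)); auto with smooth.
  - intros f g Hf Hg x. rewrite iter_Q_plus by auto. ring.
  - intros r f Hf x. rewrite iter_Q_scal by auto. ring.
Qed.

Lemma linear_Mop l c : Imm c -> linear_op (Mop l c).
Proof.
  intros H. destruct (Imm_parts c H) as (_ & _ & S).
  apply (linear_op_coordinatewise c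
    (fun f x => / factor l c * Nat.iter l (Qinv (speed c)) f x)); auto.
  - intros f Hf. apply Cinf1_mult; auto with smooth. apply Cinf1_iter_Qinv; auto.
  - intros f g Hf Hg x. rewrite iter_Qinv_plus by auto. ring.
  - intros r f Hf x. rewrite iter_Qinv_scal by auto. ring.
Qed.

Lemma Mop_Lop l c h x : Imm c -> Cinf h -> Mop l c (Lop l c h) x = h x.
Proof.
  intros H Hh. destruct (Imm_parts c H) as (_ & _ & S).
  destruct (Cinf1_coords c h H Hh). pose proof (factor_pos l c H).
  transitivity (vfield c (tcoord c h) (ncoord c h) x);
    [|rewrite vfield_coords; auto]. unfold Mop, Lop.
  rewrite tcoord_vfield, ncoord_vfield by auto.
  rewrite !iter_Qinv_scal, !iter_Qinv_Q by auto with smooth.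
  unfold vfield. f_equal; field; lra.
Qed.

Lemma Lop_Mop l c h x : Imm c -> Cinf h -> Lop l c (Mop l c h) x = h x.
Proof.
  intros H Hh. destruct (Imm_parts c H) as (_ & _ & S).
  destruct (Cinf1_coords c h H Hh). pose proof (factor_pos l c H).
  transitivity (vfield c (tcoord c h) (ncoord c h) x);
    [|rewrite vfield_coords; auto]. unfold Mop, Lop.
  rewrite tcoord_vfield, ncoord_vfield by auto.
  rewrite !iter_Q_scal, !iter_Q_Qinv by auto with smooth.
  unfold vfield. f_equal; field; lra.
Qed.

Lemma sfam_frame c : smooth_curve c -> (forall t, Imm (c t)) ->
  arclength_family (fun t => speed (c t)) /\
  smooth_family (fun t => tx (c t)) /\ smooth_family (fun t => ty (c t)).
Proof.
  intros Hc HI. destruct (smooth_curve_parts c Hc) as [A B].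
  pose proof (speed_family c A B HI) as S. conjs; auto.
  - apply (sfam_ds (fun t => speed (c t)) (fun t => xpart (c t))); auto.
  - apply (sfam_ds (fun t => speed (c t)) (fun t => ypart (c t))); auto.
Qed.

Lemma sfam_coords c h : smooth_curve c -> (forall t, Imm (c t)) -> smooth_curve h ->
  smooth_family (fun t => tcoord (c t) (h t)) /\
  smooth_family (fun t => ncoord (c t) (h t)).
Proof.
  intros Hc HI Hh. destruct (sfam_frame c Hc HI) as (_ & U & V).
  destruct (smooth_curve_parts h Hh) as [A B].
  split; [apply sfam_plus | apply sfam_minus]; apply sfam_mult; auto.
Qed.

Lemma smooth_curve_vfield c F G : smooth_curve c -> (forall t, Imm (c t)) ->
  smooth_family F -> smooth_family G -> smooth_curve (fun t => vfield (c t) (F t) (G t)).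
Proof.
  intros Hc HI HF HG. destruct (sfam_frame c Hc HI) as (_ & U & V).
  apply (smooth_curve_intro (fun t x => F t x * tx (c t) x - G t x * ty (c t) x)
    (fun t x => F t x * ty (c t) x + G t x * tx (c t) x)).
  - apply sfam_minus; apply sfam_mult; auto.
  - apply sfam_plus; apply sfam_mult; auto.
Qed.

Lemma sfam_factor l c : smooth_curve c -> (forall t, Imm (c t)) ->
  smooth_family (fun t _ => factor l (c t)).
Proof.
  intros Hc HI. destruct (sfam_frame c Hc HI) as (S & _).
  destruct (smooth_curve_parts c Hc) as [A B].
  pose proof (sfam_frame_bound l _ _ _ S A B) as F.
  apply (sfam_mult (fun _ _ => 4 * 4 ^ l * INR (Datatypes.S l) ^ 3)
    (fun t _ => frame_bound l (speed (c t)) (xpart (c t)) (ypart (c t)) ^ 2)).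
  - apply sfam_const.
  - apply (sfam_mult _ (fun t _ => frame_bound l (speed (c t)) (xpart (c t)) (ypart (c t)) * 1)); auto.
    apply (sfam_mult _ (fun _ _ => 1)); auto. apply sfam_const.
Qed.

Lemma smooth_Lop l : smooth_on_TImm (Lop l).
Proof.
  intros c h Hc HI Hh. destruct (sfam_frame c Hc HI) as (S & _).
  destruct (sfam_coords c h Hc HI Hh) as [A B].
  pose proof (sfam_factor l c Hc HI) as F.
  apply (smooth_curve_vfield c
    (fun t x => factor l (c t) * Nat.iter l (Q (speed (c t))) (tcoord (c t) (h t)) x)
    (fun t x => factor l (c t) * Nat.iter l (Q (speed (c t))) (ncoord (c t) (h t)) x)); auto;
    apply (sfam_mult (fun t _ => factor l (c t))); auto.
  - apply (sfam_iter_Q (fun t => speed (c t)) (fun t => tcoord (c t) (h t))); auto.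
  - apply (sfam_iter_Q (fun t => speed (c t)) (fun t => ncoord (c t) (h t))); auto.
Qed.

Lemma smooth_Mop l : smooth_on_TImm (Mop l).
Proof.
  intros c h Hc HI Hh. destruct (sfam_frame c Hc HI) as (S & _).
  destruct (sfam_coords c h Hc HI Hh) as [A B].
  pose proof (sfam_factor l c Hc HI) as F.
  assert (F' : smooth_family (fun t _ => / factor l (c t))).
  { apply (sfam_inv (fun t _ => factor l (c t))); auto. intros t _.
    pose proof (factor_pos l (c t) (HI t)). lra. }
  apply (smooth_curve_vfield c
    (fun t x => / factor l (c t) * Nat.iter l (Qinv (speed (c t))) (tcoord (c t) (h t)) x)
    (fun t x => / factor l (c t) * Nat.iter l (Qinv (speed (c t))) (ncoord (c t) (h t)) x)); auto;
    apply (sfam_mult (fun t _ => / factor l (c t))); auto.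
  - apply (sfam_iter_Qinv (fun t => speed (c t)) (fun t => tcoord (c t) (h t))); auto.
  - apply (sfam_iter_Qinv (fun t => speed (c t)) (fun t => ncoord (c t) (h t))); auto.
Qed.

Lemma automorphism_Lop l : smooth_bundle_automorphism (Lop l).
Proof.
  split; [|split].
  - intros c; apply linear_Lop.
  - apply smooth_Lop.
  - exists (Mop l). split; [|split].
    + intros c; apply linear_Mop.
    + apply smooth_Mop.
    + intros c h H Hh x; split; [apply Mop_Lop | apply Lop_Mop]; auto.
Qed.

(** * Order, symmetry, positivity and equivariance of L *)

Lemma diffop_coords c : Imm c ->
  diffop 0 (fun h => tcoord c h) /\ diffop 0 (fun h => ncoord c h).
Proof.
  intros H. destruct (Cinf1_frame c H) as [A B]. split.
  - apply (diffop_ext _ (fun h x => tx c x * Derive_n (fun y => comp false (h y)) 0 x +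
      ty c x * Derive_n (fun y => comp true (h y)) 0 x)).
    + apply diffop_plus; apply (diffop_monomial 0); auto.
    + intros h _; apply functional_extensionality; intros x.
      unfold tcoord, xpart, ypart; simpl; ring.
  - apply (diffop_ext _ (fun h x => tx c x * Derive_n (fun y => comp true (h y)) 0 x +
      (- ty c x) * Derive_n (fun y => comp false (h y)) 0 x)).
    + apply diffop_plus; [apply (diffop_monomial 0) | apply (diffop_monomial 0 (fun x => - ty c x))];
        auto with smooth.
    + intros h _; apply functional_extensionality; intros x.
      unfold ncoord, xpart, ypart; simpl; ring.
Qed.

Lemma pseudo_differential_Lop l c : Imm c -> pseudo_differential (2 * INR l) (Lop l c).
Proof.
  intros H. destruct (Imm_parts c H) as (_ & _ & S).
  destruct (Cinf1_frame c H) as [Hx Hy]. destruct (diffop_coords c H) as [A B].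
  replace (2 * INR l) with (INR (2 * l + 0)).
  2:{ rewrite Nat.add_0_r, mult_INR. reflexivity. }
  apply diffop_pseudo_differential.
  pose proof (diffop_iter_Q l 0 (speed c) _ S A) as A'.
  pose proof (diffop_iter_Q l 0 (speed c) _ S B) as B'.
  intros [|].
  - apply (diffop_ext _ (fun h x =>
      (factor l c * ty c x) * Nat.iter l (Q (speed c)) (tcoord c h) x +
      (factor l c * tx c x) * Nat.iter l (Q (speed c)) (ncoord c h) x)).
    + apply diffop_plus.
      * apply (diffop_mult _ (fun x => factor l c * ty c x)); auto with smooth.
      * apply (diffop_mult _ (fun x => factor l c * tx c x)); auto with smooth.
    + intros h _; apply functional_extensionality; intros x; simpl; ring.
  - apply (diffop_ext _ (fun h x =>
      (factor l c * tx c x) * Nat.iter l (Q (speed c)) (tcoord c h) x +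
      (factor l c * - ty c x) * Nat.iter l (Q (speed c)) (ncoord c h) x)).
    + apply diffop_plus.
      * apply (diffop_mult _ (fun x => factor l c * tx c x)); auto with smooth.
      * apply (diffop_mult _ (fun x => factor l c * - ty c x)); auto with smooth.
    + intros h _; apply functional_extensionality; intros x; simpl; ring.
Qed.

Lemma L2_Lop l c h k : Imm c -> Cinf h -> Cinf k -> L2 c (Lop l c h) k =
  factor l c *
  (ints (speed c) (fun x => Nat.iter l (Q (speed c)) (tcoord c h) x * tcoord c k x) +
   ints (speed c) (fun x => Nat.iter l (Q (speed c)) (ncoord c h) x * ncoord c k x)).
Proof.
  intros H Hh Hk. destruct (Imm_parts c H) as (_ & _ & S).
  destruct (Cinf1_coords c h H Hh). destruct (Cinf1_coords c k H Hk).
  transitivity (L2 c (Lop l c h) (vfield c (tcoord c k) (ncoord c k)));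
    [rewrite vfield_coords; auto|]. unfold Lop.
  rewrite L2_vfield by auto with smooth.
  rewrite Rmult_plus_distr_l, <- !ints_scal by auto with smooth.
  f_equal; apply ints_ext; intros; ring.
Qed.

Lemma L2_Lop_diag l c h : Imm c -> Cinf h -> L2 c (Lop l c h) h =
  factor l c * (energy l (speed c) (tcoord c h) + energy l (speed c) (ncoord c h)).
Proof. intros; apply L2_Lop; auto. Qed.

Lemma L2_sym c h k : L2 c h k = L2 c k h.
Proof. apply (ints_ext (speed c)). intros x. unfold dot; ring. Qed.

Lemma symmetric_Lop l c : Imm c -> symmetric_op c (Lop l c).
Proof.
  intros H h k Hh Hk. destruct (Imm_parts c H) as (_ & _ & S).
  destruct (Cinf1_coords c h H Hh). destruct (Cinf1_coords c k H Hk).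
  rewrite (L2_sym c h), !L2_Lop by auto.
  rewrite (ints_iter_Q_sym _ (tcoord c h)), (ints_iter_Q_sym _ (ncoord c h)) by auto.
  f_equal. f_equal; apply ints_ext; intros; ring.
Qed.

Lemma positive_Lop l c : Imm c -> positive_op c (Lop l c).
Proof.
  intros H h Hh [x Hx]. destruct (Imm_parts c H) as (_ & _ & S).
  destruct (Cinf1_coords c h H Hh) as [A B].
  rewrite L2_Lop_diag by auto. apply Rmult_lt_0_compat; [apply factor_pos; auto|].
  pose proof (energy_ge_0 l _ _ S A). pose proof (energy_ge_0 l _ _ S B).
  destruct (Req_dec (tcoord c h x) 0) as [E1|N].
  - destruct (Req_dec (ncoord c h x) 0) as [E2|N].
    + exfalso; apply Hx. rewrite <- (vfield_coords c h H). unfold vfield.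
      rewrite E1, E2. f_equal; ring.
    + pose proof (energy_pos l _ _ x S B N). lra.
  - pose proof (energy_pos l _ _ x S A N). lra.
Qed.

(** Under reparametrization v, n and both coordinates are multiplied by e, whereas [factor] and the
    powers of [Q] are unchanged. Each component therefore carries e^2 = 1. *)
Lemma equivariant_Lop l : reparam_equivariant (Lop l).
Proof.
  intros c h phi H Hh Hphi x.
  destruct (Diff_sign phi Hphi) as (e & He & Hpos & Hper).
  destruct Hphi as ((Sphi & _) & _).
  destruct (Imm_parts c H) as (Hx & Hy & S). destruct (Cinf1_coords c h H Hh) as [Ht Hn].
  assert (D : forall f, Cinf1 f -> forall y,
    Derive (fun z => f (phi z)) y = Derive phi y * Derive f (phi y)).
  { intros f Hf y. apply (Derive_comp f phi).
    - apply Cinf1_ex_derive; auto.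
    - apply smooth_ex_derive; auto. }
  assert (ES : speed (fun y => c (phi y)) = fun y => e * Derive phi y * speed c (phi y)).
  { apply functional_extensionality; intros y. rewrite !speed_eq.
    rewrite (D (xpart c) Hx y : Derive (xpart (fun y => c (phi y))) y = _).
    rewrite (D (ypart c) Hy y : Derive (ypart (fun y => c (phi y))) y = _).
    specialize (Hpos y).
    (* The factor |phi'| = e phi' is brought under the root as a square. *)
    rewrite <- (sqrt_square (e * Derive phi y)) at 1 by lra.
    pose proof (speed_sq_pos c (phi y) (proj2 H (phi y))).
    rewrite <- sqrt_mult by nra. f_equal.
    destruct He as [-> | ->]; ring. }
  assert (E1 : forall f, Cinf1 f -> ds (speed (fun y => c (phi y))) (fun y => f (phi y)) =
    fun y => e * ds (speed c) f (phi y)).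
  { intros f Hf. rewrite ES. apply ds_reparam; auto. }
  assert (Ex : tx (fun y => c (phi y)) = fun y => e * tx c (phi y))
    by apply (E1 (xpart c) Hx).
  assert (Ey : ty (fun y => c (phi y)) = fun y => e * ty c (phi y))
    by apply (E1 (ypart c) Hy).
  assert (Et : tcoord (fun y => c (phi y)) (fun y => h (phi y)) =
    fun y => e * tcoord c h (phi y)).
  { apply functional_extensionality; intros y. unfold tcoord.
    rewrite Ex, Ey. unfold xpart, ypart. ring. }
  assert (En : ncoord (fun y => c (phi y)) (fun y => h (phi y)) =
    fun y => e * ncoord c h (phi y)).
  { apply functional_extensionality; intros y. unfold ncoord.
    rewrite Ex, Ey. unfold xpart, ypart. ring. }
  assert (EF : factor l (fun y => c (phi y)) = factor l c).
  { unfold factor. f_equal. f_equal. rewrite ES.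
    apply (frame_bound_reparam phi (speed c) e He Sphi Hpos Hper S l _ _ Hx Hy). }
  assert (EQ : forall f, Cinf1 f ->
    Nat.iter l (Q (speed (fun y => c (phi y)))) (fun y => e * f (phi y)) =
    fun y => e * Nat.iter l (Q (speed c)) f (phi y)).
  { intros f Hf. rewrite iter_Q_scal, ES, iter_Q_reparam; auto. }
  unfold Lop, vfield. rewrite EF, Et, En, Ex, Ey, !EQ by auto.
  destruct He as [-> | ->]; f_equal; ring.
Qed.

Lemma metric_Lop l : metric (fun c h k => L2 c (Lop l c h) k).
Proof.
  exists (Lop l). conjs; auto.
  - apply automorphism_Lop.
  - exists (INR l). intros c; apply pseudo_differential_Lop.
  - intros c H; split; [apply symmetric_Lop | apply positive_Lop]; auto.
  - apply equivariant_Lop.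
Qed.

(** * Domination of the Sobolev metric *)

Lemma iter_Ds c h n : Nat.iter n (Ds c) h =
  fun x => (Nat.iter n (ds (speed c)) (xpart h) x, Nat.iter n (ds (speed c)) (ypart h) x).
Proof.
  induction n.
  - apply functional_extensionality; intros x. simpl. apply surjective_pairing.
  - simpl. rewrite IHn. apply functional_extensionality; intros x. reflexivity.
Qed.

Lemma sobolev_jet l c h : sobolev l c h =
  ints (speed c) (fun x => jet l (speed c) (xpart h) x + jet l (speed c) (ypart h) x).
Proof.
  apply (ints_ext (speed c)). intros x. unfold jet. rewrite <- plus_sum.
  apply sum_eq. intros i _. rewrite iter_Ds. unfold dot; simpl; ring.
Qed.

(** Both components of b v + a n have this form: f and g stand for b and a, u and v for components
    of the tangent, and w for the sign coming from J. The bound holds for each of the l + 1 orders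
    separately and is then summed. *)
Lemma jet_combination_le l s f g u v w W x : arclength s ->
  Cinf1 f -> Cinf1 g -> Cinf1 u -> Cinf1 v ->
  jet l s u x <= W -> jet l s v x <= W -> (w = 1 \/ w = -1) ->
  jet l s (fun y => f y * u y + w * (g y * v y)) x <=
  2 * 4 ^ l * INR (S l) * W * (jet l s f x + jet l s g x).
Proof.
  intros H Hf Hg Hu Hv Wu Wv Hw.
  replace (2 * 4 ^ l * INR (S l) * W * (jet l s f x + jet l s g x)) with
    (2 * 4 ^ l * W * (jet l s f x + jet l s g x) * INR (S l)) by ring.
  rewrite <- sum_cte. apply sum_f_R0_le. intros i Hi.
  rewrite iter_ds_plus, iter_ds_scal by auto with smooth.
  pose proof (iter_ds_mult_le i s f u x H Hf Hu) as A.
  pose proof (iter_ds_mult_le i s g v x H Hg Hv) as B.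
  set (p := Nat.iter i (ds s) (fun y => f y * u y) x) in *.
  set (q := Nat.iter i (ds s) (fun y => g y * v y) x) in *.
  assert (P4 : 0 < 4 ^ i <= 4 ^ l) by (split; [apply pow_lt; lra | apply Rle_pow; lra || lia]).
  assert (C : forall a b, jet l s b x <= W ->
    4 ^ i * (jet i s a x * jet i s b x) <= 4 ^ l * (jet l s a x * W)).
  { intros a b Hb. pose proof (jet_ge_0 i s a x). pose proof (jet_ge_0 i s b x).
    pose proof (jet_mono i l s b x Hi).
    apply Rmult_le_compat; try lra; [apply Rmult_le_pos; auto|].
    apply Rmult_le_compat; auto; [apply jet_mono; auto | lra]. }
  pose proof (C f u Wu). pose proof (C g v Wv).
  pose proof (pow2_ge_0 (p - w * q)).
  replace ((p + w * q) ^ 2) with (2 * p ^ 2 + 2 * (w * w) * q ^ 2 - (p - w * q) ^ 2) by ring.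
  replace (w * w) with 1 by (destruct Hw as [-> | ->]; ring).
  lra.
Qed.

Lemma dominates_Lop l : dominates (fun c h k => L2 c (Lop l c h) k) l.
Proof.
  intros c h H Hh. destruct (Imm_parts c H) as (Hx & Hy & S).
  destruct (Cinf1_coords c h H Hh) as [A B]. destruct (Cinf1_frame c H) as [Tx Ty].
  pose proof (proj1 (Cinf_parts h) Hh) as [Ph Qh].
  rewrite L2_Lop_diag, sobolev_jet by auto.
  set (s := speed c) in *. set (b := tcoord c h) in *. set (a := ncoord c h) in *.
  set (F := frame_bound l s (xpart c) (ypart c)).
  set (W := INR (Datatypes.S l) * F ^ 2).
  assert (EX : xpart h = fun y => b y * tx c y + -1 * (a y * ty c y)).
  { transitivity (xpart (vfield c b a)); [unfold b, a; rewrite vfield_coords; auto|].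
    apply functional_extensionality; intros y. unfold vfield, xpart; simpl. ring. }
  assert (EY : ypart h = fun y => b y * ty c y + 1 * (a y * tx c y)).
  { transitivity (ypart (vfield c b a)); [unfold b, a; rewrite vfield_coords; auto|].
    apply functional_extensionality; intros y. unfold vfield, ypart; simpl. ring. }
  set (k := 4 * 4 ^ l * INR (Datatypes.S l) * W).
  apply Rle_trans with (ints s (fun x => k * (jet l s b x + jet l s a x))).
  - apply ints_le; auto.
    + apply Cinf1_plus; apply Cinf1_jet; auto.
    + apply (Cinf1_mult (fun _ => k)); auto with smooth.
      apply Cinf1_plus; apply Cinf1_jet; auto.
    + intros x. destruct (frame_bound_spec l s (xpart c) (ypart c) x S Hx Hy) as (_ & U & V).
      rewrite EX, EY.
      pose proof (jet_combination_le l s b a (tx c) (ty c) (-1) W x S A B Tx Ty U V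
        ltac:(auto)) as J1.
      pose proof (jet_combination_le l s b a (ty c) (tx c) 1 W x S A B Ty Tx V U
        ltac:(auto)) as J2.
      unfold k. lra.
  - assert (J1 : Cinf1 (jet l s b)) by (apply Cinf1_jet; auto).
    assert (J2 : Cinf1 (jet l s a)) by (apply Cinf1_jet; auto).
    rewrite (ints_scal s k (fun x => jet l s b x + jet l s a x)) by auto with smooth.
    rewrite ints_plus by auto.
    pose proof (ints_jet_le l s b S A). pose proof (ints_jet_le l s a S B).
    assert (Ek : factor l c = k * INR (Datatypes.S l))
      by (unfold factor, k, W; fold s; fold F; ring).
    rewrite Ek, Rmult_assoc. apply Rmult_le_compat_l.
    + unfold k, W. pose proof (pow_lt 4 l ltac:(lra)). pose proof (pos_INR (Datatypes.S l)).
      pose proof (pow2_ge_0 F).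
      apply Rmult_le_pos; apply Rmult_le_pos; auto. lra.
    + lra.
Qed.

(** * The horizontal bundle *)

Lemma vfield_tangent c b x : vfield c b (fun _ => 0) x = scal (b x) (tangent c x).
Proof.
  rewrite tangent_eq. unfold vfield. change (scal (b x) (tx c x, ty c x)) with
    (b x * tx c x, b x * ty c x). f_equal; ring.
Qed.

Lemma vfield_normal c a x : vfield c (fun _ => 0) a x = scal (a x) (normal c x).
Proof.
  unfold normal. rewrite tangent_eq. unfold vfield, J.
  change (scal (a x) (- snd (tx c x, ty c x), fst (tx c x, ty c x))) with
    (a x * - ty c x, a x * tx c x). f_equal; ring.
Qed.

Lemma Hor_Lop l c h : Imm c -> Hor (fun c h k => L2 c (Lop l c h) k) c h <-> Nor c h.
Proof.
  intros H. destruct (Imm_parts c H) as (_ & _ & S). pose proof (factor_pos l c H) as Fp.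
  split.
  - intros [Hh Ho]. destruct (Cinf1_coords c h H Hh) as [A B].
    exists (ncoord c h). split; auto.
    assert (E0 : tcoord c h = fun _ => 0).
    { apply functional_extensionality; intros x.
      destruct (Req_dec (tcoord c h x) 0) as [|N]; auto. exfalso.
      (* The test vector is the tangential part of h itself, for which the pairing is [factor] times
         the energy of [tcoord c h]. *)
      specialize (Ho (vfield c (tcoord c h) (fun _ => 0))).
      rewrite L2_Lop in Ho; auto.
      - rewrite tcoord_vfield, ncoord_vfield in Ho by auto.
        rewrite (ints_ext (speed c)
          (fun x => Nat.iter l (Q (speed c)) (ncoord c h) x * 0) (fun _ => 0 * 0)) in Ho
          by (intros; ring).
        rewrite ints_scal in Ho by auto with smooth.
        pose proof (energy_pos l _ _ x S A N) as P. unfold energy in P.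
        assert (Tan c (vfield c (tcoord c h) (fun _ => 0))).
        { exists (tcoord c h). split; auto. intros y; apply vfield_tangent. }
        specialize (Ho ltac:(auto)). nra.
      - apply Cinf_vfield; auto with smooth. }
    intros x. rewrite <- vfield_normal, <- E0, vfield_coords; auto.
  - intros (a & Ha & Eh).
    assert (E : h = vfield c (fun _ => 0) a).
    { apply functional_extensionality; intros x. rewrite Eh, vfield_normal; auto. }
    subst h. assert (Hh : Cinf (vfield c (fun _ => 0) a)) by (apply Cinf_vfield; auto with smooth).
    split; auto. intros k (b & Hb & Ek).
    assert (E : k = vfield c b (fun _ => 0)).
    { apply functional_extensionality; intros x. rewrite Ek, vfield_tangent; auto. }
    subst k. rewrite L2_Lop; auto; [|apply Cinf_vfield; auto with smooth].
    rewrite !tcoord_vfield, !ncoord_vfield by auto.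
    (* Symmetry moves the power of [Q] from the zero function onto b, leaving a product with 0. *)
    rewrite ints_iter_Q_sym by auto with smooth.
    rewrite (ints_ext (speed c) (fun x => 0 * Nat.iter l (Q (speed c)) b x) (fun _ => 0 * 0))
      by (intros; ring).
    rewrite (ints_ext (speed c)
      (fun x => Nat.iter l (Q (speed c)) a x * 0) (fun _ => 0 * 0)) by (intros; ring).
    rewrite !ints_scal by auto with smooth. ring.
Qed.

Theorem theorem10 : forall l : nat,
  exists G : (R -> R2) -> (R -> R2) -> (R -> R2) -> R,
    metric G /\
    dominates G l /\
    forall c : R -> R2, Imm c -> forall h : R -> R2, Hor G c h <-> Nor c h.
Proof.
  intros l. exists (fun c h k => L2 c (Lop l c h) k). conjs.
  - apply metric_Lop.
  - apply dominates_Lop.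
  - intros c H h; apply Hor_Lop; auto.
Qed.
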